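(* There exists a function $f:\mathbb{R}\to\mathbb{R}$ that is infinitely often differentiable and computable with finitely many mind changes (and hence low and limit computable), but that is not computable relative to the halting problem.
   Context: $\mathbb{R}$ is a computable metric space with the Euclidean metric and a standard numbering $\alpha$ of the rational numbers, represented by the Cauchy representation $\delta_{\mathbb{R}}(p):=\lim_{n\to\infty}\alpha p(n)$ with $\mathrm{dom}(\delta_{\mathbb{R}})=\{p\in\mathbb{N}^{\mathbb{N}}:(\forall k)(\forall n\geq k)\;|\alpha p(n)-\alpha p(k)|<2^{-k}\}$. A function $f:\mathbb{R}\to\mathbb{R}$ has one of the computability properties below if it has a realizer with that property, i.e. such an $F:\subseteq\mathbb{N}^{\mathbb{N}}\to\mathbb{N}^{\mathbb{N}}$ with $\delta_{\mathbb{R}}F(p)=f\delta_{\mathbb{R}}(p)$ for all $p\in\mathrm{dom}(\delta_{\mathbb{R}})$. A partial function $F:\subseteq\mathbb{N}^{\mathbb{N}}\to\mathbb{N}^{\mathbb{N}}$ is computable if there is a Turing machine (infinite input tape, one-way output tape) that on each $p\in\mathrm{dom}(F)$ produces $F(p)$ in the long run; it is limit computable if there is a Turing machine with a two-way output tape (it may revise its output) that on each $p\in\mathrm{dom}(F)$ computes $F(p)$ such that each output position $n$ has, after finitely many steps, the content $F(p)(n)$ and is never changed again; it is computable with finitely many mind changes if moreover for each fixed input $p\in\mathrm{dom}(F)$ the machine revises its output only finitely many times in total (over all positions); it is computable relative to $q\in\mathbb{N}^{\mathbb{N}}$ if there is a computable $G$ with $F(p)=G\langle q,p\rangle$ for all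 $p\in\mathrm{dom}(F)$, where $\langle q,p\rangle(2n):=q(n)$, $\langle q,p\rangle(2n+1):=p(n)$. Nothing is required outside $\mathrm{dom}(F)$. The Turing jump $\mathsf{J}:\mathbb{N}^{\mathbb{N}}\to\mathbb{N}^{\mathbb{N}}$ is given by $\mathsf{J}(p)(i)=1$ if the $i$-th Turing machine halts upon input $p$, and $0$ otherwise; it is injective. The halting problem is $0':=\mathsf{J}(000\dots)$. With $\langle n,k\rangle:=\frac12(n+k)(n+k+1)+k$, $\langle p_0,p_1,\dots\rangle\langle n,k\rangle:=p_n(k)$ and $\lim:\langle p_0,p_1,\dots\rangle\mapsto\lim_{i\to\infty}p_i$, a partial function $F$ on $\mathbb{N}^{\mathbb{N}}$ is low if $F=\mathsf{J}^{-1}\circ\lim\circ\,G$ for some computable $G:\subseteq\mathbb{N}^{\mathbb{N}}\to\mathbb{N}^{\mathbb{N}}$. *)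

(* Defs.v *)
From HB Require Import structures.
From mathcomp Require Import all_boot all_order all_algebra.
From mathcomp Require Import all_classical all_reals all_analysis.
Set Implicit Arguments.
Unset Strict Implicit.
Unset Printing Implicit Defensive.
Import Order.TTheory GRing.Theory Num.Theory.
Import numFieldNormedType.Exports.

Definition baire := nat -> nat.

(* F p = None means that p is outside the domain of F. *)
Definition pfun := baire -> option baire.

(* Turing machines with three tapes, infinite to the right: a read-only input
   tape, a work tape and an output tape.  Tape symbols are natural numbers, 0
   being the blank; a machine is a finite table, so it distinguishes and writes
   only finitely many of them. *)

Inductive dir := Stay | Left | Right.

Record instr := Instr {
  cur : nat;  rd_in : nat;  rd_work : nat;  rd_out : nat;
  nxt : nat;  wr_work : nat;  wr_out : nat;
  mv_in : dir;  mv_work : dir;  mv_out : dir }.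

Definition machine := seq instr.

Record config := Config {
  state : nat;
  in_head : nat;
  work : nat -> nat;  work_head : nat;
  out : nat -> nat;  out_head : nat }.

(* A left move from the leftmost cell leaves the head where it is. *)
Definition move (d : dir) (h : nat) : nat :=
  match d with Stay => h | Left => h.-1 | Right => h.+1 end.

Definition write (u : nat -> nat) (h a : nat) : nat -> nat :=
  fun c => if c == h then a else u c.

Definition matches (inp : nat -> nat) (x : config) (i : instr) : bool :=
  [&& cur i == state x, rd_in i == inp (in_head x),
      rd_work i == work x (work_head x) & rd_out i == out x (out_head x)].

Definition exec (x : config) (i : instr) : config :=
  Config (nxt i) (move (mv_in i) (in_head x))
    (write (work x) (work_head x) (wr_work i)) (move (mv_work i) (work_head x))
    (write (out x) (out_head x) (wr_out i)) (move (mv_out i) (out_head x)).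

(* The first matching instruction is executed; None means that the machine
   halts. *)
Definition step (M : machine) (inp : nat -> nat) (x : config) : option config :=
  omap (exec x) (ohead [seq i <- M | matches inp x i]).

Definition init : config := Config 0 0 (fun=> 0) 0 (fun=> 0) 0.

(* p is written on a tape as 1^{p(0)} 2 1^{p(1)} 2 1^{p(2)} 2 ... *)
Definition tape_of (p : baire) : nat -> nat := fun c =>
  if [exists n : 'I_c.+1, c == (\sum_(i < n.+1) p i) + n] then 2 else 1.

Definition run (M : machine) (p : baire) (t : nat) : config :=
  iter t (fun x => odflt x (step M (tape_of p) x)) init.

Definition halts (M : machine) (p : baire) : Prop :=
  exists t, step M (tape_of p) (run M p t) = None.

(* The output head never moves left, and a cell is written only when the head
   leaves it for good. *)
Definition one_way (M : machine) : bool :=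
  all (fun i => match mv_out i with
                | Stay => wr_out i == rd_out i
                | Left => false
                | Right => true
                end) M.

(* Every output cell eventually holds the right symbol and keeps it.  For a
   one-way machine this says that tape_of r is produced in the long run. *)
Definition outputs (M : machine) (p r : baire) : Prop :=
  forall c, exists T, forall t, T <= t -> out (run M p t) c = tape_of r c.

(* Filling a blank cell is not a revision. *)
Definition finitely_many_revisions (M : machine) (p : baire) : Prop :=
  exists T, forall t c, T <= t ->
    out (run M p t) c <> 0 -> out (run M p t.+1) c = out (run M p t) c.

Definition computable (F : pfun) : Prop :=
  exists M, one_way M /\ forall p r, F p = Some r -> outputs M p r.

Definition limit_computable (F : pfun) : Prop :=
  exists M, forall p r, F p = Some r -> outputs M p r.

Definition mind_change_computable (F : pfun) : Prop :=
  exists M, forall p r, F p = Some r ->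
    outputs M p r /\ finitely_many_revisions M p.

Definition join (q p : baire) : baire :=
  fun n => if odd n then p n./2 else q n./2.

Definition computable_relative (q : baire) (F : pfun) : Prop :=
  exists G, computable G /\ forall p r, F p = Some r -> G (join q p) = Some r.

(* Numbering of all machines, through the bijection CodeSeq.decode from nat to
   seq nat. *)
Definition dir_of_nat (n : nat) : dir :=
  match n with 0 => Stay | 1 => Left | _ => Right end.

Definition instr_of_seq (s : seq nat) : instr :=
  let x := nth 0 s in
  Instr (x 0) (x 1) (x 2) (x 3) (x 4) (x 5) (x 6)
    (dir_of_nat (x 7)) (dir_of_nat (x 8)) (dir_of_nat (x 9)).

Definition tm (i : nat) : machine :=
  [seq instr_of_seq (CodeSeq.decode a) | a <- CodeSeq.decode i].

Lemma tm_surj (M : machine) : exists i, tm i = M.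
Proof.
pose nd d := match d with Stay => 0 | Left => 1 | Right => 2 end.
pose f (i : instr) := CodeSeq.code
  [:: cur i; rd_in i; rd_work i; rd_out i; nxt i; wr_work i; wr_out i;
      nd (mv_in i); nd (mv_work i); nd (mv_out i)].
exists (CodeSeq.code (map f M)); rewrite /tm CodeSeq.codeK -map_comp.
rewrite -[RHS]map_id; apply: eq_map => -[q a b c q' b' c' d1 d2 d3].
by rewrite /= CodeSeq.codeK /instr_of_seq /=; case: d1 d2 d3 => [] [] [].
Qed.

Definition jump (p : baire) : baire := fun i => `[< halts (tm i) p >].

Definition halting_problem : baire := jump (fun=> 0).

Definition cpair (n k : nat) : nat := ((n + k) * (n + k).+1)./2 + k.

(* g = <p_0, p_1, ...> with p_n(k) = g <n,k>, and the p_n converge to l in Baire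
   space. *)
Definition baire_lim (g l : baire) : Prop :=
  forall k, exists N, forall n, N <= n -> g (cpair n k) = l k.

(* Equality of the graphs of F and of jump^-1 o lim o G. *)
Definition low (F : pfun) : Prop :=
  exists G, computable G /\
    forall p r, F p = Some r <->
      exists g, G p = Some g /\ baire_lim g (jump r).

(* Walks along the diagonals in the order of cpair. *)
Definition cunpair (m : nat) : nat * nat :=
  iter m (fun nk => if nk.1 is n.+1 then (n, nk.2.+1) else (nk.2.+1, 0)) (0, 0).

Lemma cunpairK (m : nat) : cpair (cunpair m).1 (cunpair m).2 = m.
Proof.
elim: m => // m; rewrite [cunpair m.+1]/=.
case: (cunpair m) => -[|n] k /= <-; rewrite /cpair; last by rewrite !addnS addSn.
rewrite add0n !addn0 -[k.+2]addn2 mulnDr muln2 halfD odd_double andbF doubleK.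
by rewrite mulnC addnS.
Qed.

(* <i,<j,k>> denotes (i - j) / (k + 1). *)
Definition alpha (m : nat) : rat :=
  let: (i, m') := cunpair m in
  let: (j, k) := cunpair m' in
  ((i%:R - j%:R) / k.+1%:R)%R.

Local Open Scope classical_set_scope.
Local Open Scope ring_scope.

Definition cauchy_name (p : baire) : Prop :=
  forall k n : nat, (k <= n)%N -> `|alpha (p n) - alpha (p k)| < 2 ^- k.

Definition delta (R : realType) (p : baire) (x : R) : Prop :=
  cauchy_name p /\ (fun n => ratr (alpha (p n)) : R) @ \oo --> x.

Definition realizes (R : realType) (F : pfun) (f : R -> R) : Prop :=
  forall p x, delta p x -> exists r, F p = Some r /\ delta r (f x).

Definition has_realizer (R : realType) (P : pfun -> Prop) (f : R -> R) : Prop :=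
  exists F, realizes F f /\ P F.

Definition smooth (R : realType) (f : R -> R) : Prop :=
  forall (n : nat) (x : R), derivable (derive1n n f) x 1.

(* Main.v *)
Require Import Defs.
From mathcomp Require Import all_boot all_order all_algebra.
From mathcomp Require Import all_classical all_reals all_analysis.
From mathcomp Require Import zify ring lra.

(**
  On [n, n+1) the function f is either zero or one bump of height about
  256 exp(-4), supported in (n + 1/K, n + 2/K).  The scale K is the limit of a
  nondecreasing computable sequence [scale n s]; f vanishes on [n, n+1) if the
  sequence is unbounded.

  Diagonalisation: at stage s, the n-th machine is run on the s-th approximation
  of the halting problem and the constant name of n, and the scale is raised to
  about 2^t, where t is the number of steps until the first output entry is
  complete.  If the n-th machine computes f relative to the halting problem, the
  run stabilises, so K is finite and the peak of the bump is within 2^-t of n: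
  a name of the peak can begin like the constant name of n for t entries.  The
  first output entry is then the same at n, where f is 0, and at the peak, where
  f > 2, although it has error at most 1.

  Mind changes: away from n the bump moves only finitely often before it
  stabilises or is out of reach, and at n it is never seen, since [scale n s]
  grows at most linearly in s while the input is known up to 4^-s.  So all but
  finitely many consecutive approximations are close, and the output restarts
  when they are not.

  Lowness: the output after the last restart is known from some stage on, so
  halting of the e-th machine on the current output within the available number
  of steps converges to the jump of the final output.
*)

Set Implicit Arguments.
Unset Strict Implicit.
Unset Printing Implicit Defensive.

(** * Machines given by transition functions *)

(** A machine with the halting problem as oracle must fix its first output entry after finitely many
    steps, having seen finitely many oracle bits and entries of the name. The scale waits for this
    commitment, and since only a finite part of the oracle enters into it, approximations of the
    halting problem find it in the limit.

    The constants: with s = K (x - n), the bump is 256 exp(-1/q) for q = (s - 1)(2 - s), so its peak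
    is at s = 3/2, where q = 1/4. Two reals whose names share their first entry differ by at most 2,
    hence the factor 256. All scales are at least 4, so a bump stays in the left half of its unit
    interval. Therefore f vanishes to the left of every integer, and each point has a neighbourhood
    on which f is a single bump, however large K is; this gives smoothness.

    Computability refers to concrete finite tables. The machines are therefore written as register
    programs and compiled, and since the scale itself runs arbitrary machines, an interpreter of
    machines is needed among these programs. *)

Record action := Action {
  act_nxt : nat; act_work : nat; act_out : nat;
  act_mvi : dir; act_mvw : dir; act_mvo : dir }.

(** The instructions for one state, as a function of the symbols on the input, work and output tape;
    the state is the index of the row. *)
Definition trow := nat -> nat -> nat -> action.

Definition trow0 : trow := fun _ b c => Action 0 b c Stay Stay Stay.

Definition apply_action (x : config) (a : action) : config :=
  Config (act_nxt a) (move (act_mvi a) (in_head x))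
    (write (work x) (work_head x) (act_work a)) (move (act_mvw a) (work_head x))
    (write (out x) (out_head x) (act_out a)) (move (act_mvo a) (out_head x)).

Definition row_instr (rows : seq trow) (k : (nat * nat) * (nat * nat)) : instr :=
  let a := nth trow0 rows k.1.1 k.1.2 k.2.1 k.2.2 in
  Instr k.1.1 k.1.2 k.2.1 k.2.2 (act_nxt a) (act_work a) (act_out a)
    (act_mvi a) (act_mvw a) (act_mvo a).

(** There are A work symbols. A state beyond the last row has no instruction, so the machine halts
    on entering it. *)
Definition machine_of (A : nat) (rows : seq trow) : machine :=
  map (row_instr rows)
    (allpairs pair (allpairs pair (iota 0 (size rows)) [:: 1; 2])
                   (allpairs pair (iota 0 A) (iota 0 3))).

Lemma ohead_filter_pred1 (T : eqType) (s : seq T) (x : T) :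
  x \in s -> ohead [seq y <- s | y == x] = Some x.
Proof.
elim: s => //= y s IH; rewrite inE eq_sym.
by case: eqP => [->|_ /IH].
Qed.

Lemma step_machine_of A rows inp x :
  state x < size rows -> inp (in_head x) \in [:: 1; 2] ->
  work x (work_head x) < A -> out x (out_head x) < 3 ->
  step (machine_of A rows) inp x =
  Some (apply_action x (nth trow0 rows (state x) (inp (in_head x))
                         (work x (work_head x)) (out x (out_head x)))).
Proof.
move=> hq ha hb hc; rewrite /step /machine_of filter_map.
pose k := ((state x, inp (in_head x)), (work x (work_head x), out x (out_head x))).
rewrite (@eq_filter _ _ (fun y => y == k)); last first.
  by move=> [[q a] [b c]]; rewrite /matches /= /k !xpair_eqE -!andbA.
have kin : k \in allpairs pair (allpairs pair (iota 0 (size rows)) [:: 1; 2])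
                          (allpairs pair (iota 0 A) (iota 0 3)).
  by apply: allpairs_f; apply: allpairs_f; rewrite ?mem_iota.
move/ohead_filter_pred1: kin.
by case: [seq y <- _ | _] => //= y s [->].
Qed.

Section Run.
Variables (M : machine) (inp : nat -> nat).

Definition nextc (x : config) : config := odflt x (step M inp x).

Definition keeps (x y : config) : Prop :=
  forall c, out x c <> 0 -> out y c = out x c.

(* If [b] is set, no nonblank output cell changes on the way. *)
Definition reaches (b : bool) (x : config) (n : nat) (y : config) : Prop :=
  iter n nextc x = y /\
  (b -> forall k, k < n -> keeps (iter k nextc x) (iter k.+1 nextc x)).

Lemma reaches_trans b x n y n' z :
  reaches b x n y -> reaches b y n' z -> reaches b x (n + n') z.
Proof.
move=> [e h] [e' h']; split; first by rewrite addnC iterD e.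
move=> hb k hk; case: (ltnP k n) => kn; first exact: h.
have -> : k = (k - n) + n by rewrite subnK.
rewrite -addSn !iterD e; apply: h' => //; lia.
Qed.

Lemma reaches1 (b : bool) x y :
  nextc x = y -> (b -> keeps x y) -> reaches b x 1 y.
Proof. by move=> e h; split => //= hb [] // _; rewrite e; apply: h. Qed.

End Run.

(** * While programs over registers, and their compilation *)

Inductive test := Reg of nat | In1.

(** The output is a word in which [false] and [true] stand for the tape symbols 1 and 2; [Back]
    erases its last letter. *)
Inductive cmd :=
  | Skip | Inc of nat | Dec of nat | InR | Put of bool | Back
  | Seq of cmd & cmd | While of test & cmd.

Record st := St { regs : nat -> nat; ipos : nat; ow : seq bool }.

Definition upd (s : st) (j v : nat) : st :=
  St (fun k => if k == j then v else regs s k) (ipos s) (ow s).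

Definition test_true (inp : nat -> nat) (t : test) (s : st) : bool :=
  match t with Reg j => 0 < regs s j | In1 => inp (ipos s) == 1 end.

(* The flag excludes executions of [Back]. *)
Inductive evals (inp : nat -> nat) (b : bool) : cmd -> st -> st -> Prop :=
  | ev_skip s : evals inp b Skip s s
  | ev_inc s j : evals inp b (Inc j) s (upd s j (regs s j).+1)
  | ev_dec s j : evals inp b (Dec j) s (upd s j (regs s j).-1)
  | ev_inr s : evals inp b InR s (St (regs s) (ipos s).+1 (ow s))
  | ev_put s a : evals inp b (Put a) s (St (regs s) (ipos s) (rcons (ow s) a))
  | ev_back s : ~~ b ->
      evals inp b Back s (St (regs s) (ipos s) (take (size (ow s)).-1 (ow s)))
  | ev_seq c1 c2 s1 s2 s3 :
      evals inp b c1 s1 s2 -> evals inp b c2 s2 s3 -> evals inp b (Seq c1 c2) s1 s3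
  | ev_wf t c s : ~~ test_true inp t s -> evals inp b (While t c) s s
  | ev_wt t c s1 s2 s3 : test_true inp t s1 -> evals inp b c s1 s2 ->
      evals inp b (While t c) s2 s3 -> evals inp b (While t c) s1 s3.

(* Register 0 always holds 1 and marks the left end of the work tape. *)
Fixpoint wf_cmd (ob : bool) (m : nat) (c : cmd) : bool :=
  match c with
  | Inc j | Dec j => 0 < j <= m
  | Back => ~~ ob
  | Seq c1 c2 => wf_cmd ob m c1 && wf_cmd ob m c2
  | While (Reg j) c => (j <= m) && wf_cmd ob m c
  | While In1 c => wf_cmd ob m c
  | _ => true
  end.

Lemma wf_mono (ob ob' : bool) m m' c :
  m <= m' -> (ob' -> ob) -> wf_cmd ob m c -> wf_cmd ob' m' c.
Proof.
move=> mm' hob; elim: c => //=.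
- by move=> j /andP[-> /leq_trans ->].
- by move=> j /andP[-> /leq_trans ->].
- by apply: contra.
- by move=> c1 h1 c2 h2 /andP[/h1 -> /h2 ->].
- by move=> [j|] c h //= /andP[/leq_trans -> // /h].
Qed.

Lemma ev_reg0 inp (b : bool) ob m c s s' : evals inp b c s s' -> wf_cmd ob m c ->
  regs s' 0 = regs s 0.
Proof.
elim => //=.
- by move=> ? [].
- by move=> ? [].
- by move=> c1 c2 s1 s2 s3 _ h1 _ h2 /andP[/h1 <- /h2 ->].
- move=> t d s1 s2 s3 _ _ h1 _ h2 hw; rewrite h2 // h1 //.
  by case: t hw {h2} => [j /andP[]|].
Qed.

Section Compile.
Variable m : nat.

(* One track per register: track j of cell c of the work tape is set iff c is
   less than the content of register j. *)
Definition tracks := {ffun 'I_m.+1 -> bool}.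

(** The all-false column is coded by the blank, so that cells never visited already hold the right
    symbol. *)
Definition sym_of_tracks (f : tracks) : nat :=
  if f == [ffun=> false] then 0 else (enum_rank f).+1.

Definition tracks_of_sym (b : nat) : tracks :=
  if b is b'.+1 then nth [ffun=> false] (enum {: tracks}) b' else [ffun=> false].

Definition nsym := #|{: tracks}|.+1.

Lemma encK : cancel sym_of_tracks tracks_of_sym.
Proof.
move=> f; rewrite /sym_of_tracks; case: eqP => [->//|_] /=.
by rewrite -(enum_val_nth [ffun=> false]) enum_rankK.
Qed.

Lemma enc_lt f : sym_of_tracks f < nsym.
Proof. by rewrite /sym_of_tracks; case: eqP => // _; rewrite ltnS ltn_ord. Qed.

Definition bit (j b : nat) : bool := tracks_of_sym b (inord j).

Definition setbit (j : nat) (v : bool) (b : nat) : nat :=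
  sym_of_tracks [ffun k : 'I_m.+1 => if k == inord j then v else tracks_of_sym b k].

Definition bits (r : nat -> nat) (c : nat) : tracks := [ffun k : 'I_m.+1 => c < r k].

Lemma bit_bits j r c : j <= m -> bit j (sym_of_tracks (bits r c)) = (c < r j).
Proof. by move=> hj; rewrite /bit encK ffunE inordK. Qed.

Definition keep q b c := Action q b c Stay Stay Stay.

(** Register 0 holds 1, so its track is set in cell 0 only; walking left until it is set finds the
    end of the tape. *)
Definition row_home (q : nat) : trow := fun _ b c =>
  if bit 0 b then keep q.+1 b c else Action q b c Stay Left Stay.

(** [q] is the state of the first row, and control leaves in the state after the last one. A
    register is a block of set cells on its track: [Inc] sets the first unset cell, [Dec] clears the
    last set one. At content 0 the left move of [Dec] stays put and an unset cell is cleared. *)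
Fixpoint compile (p : cmd) (q : nat) : seq trow :=
  match p with
  | Skip => [::]
  | Inc j =>
     [:: (fun _ b c => if bit j b then Action q b c Stay Right Stay
                       else keep q.+1 (setbit j true b) c);
      row_home q.+1]
  | Dec j =>
     [:: (fun _ b c => if bit j b then Action q b c Stay Right Stay
                       else Action q.+1 b c Stay Left Stay);
      (fun _ b c => keep q.+2 (setbit j false b) c);
      row_home q.+2]
  | InR => [:: (fun _ b c => Action q.+1 b c Right Stay Stay)]
  | Put a => [:: (fun _ b _ => Action q.+1 b (if a then 2 else 1) Stay Stay Right)]
  | Back => [:: (fun _ b c => Action q.+1 b c Stay Stay Left);
                (fun _ b _ => keep q.+2 b 0)]
  | Seq c1 c2 => let u := compile c1 q in u ++ compile c2 (q + size u)
  | While t c =>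
     let u := compile c q.+1 in
     (fun a b o =>
        keep (if match t with Reg j => bit j b | In1 => a == 1 end
              then q.+1 else q + (size u).+2) b o)
     :: rcons u (fun _ b o => keep q b o)
  end.

Definition sym (a : bool) : nat := if a then 2 else 1.

Definition otape (w : seq bool) : nat -> nat := nth 0 (map sym w).

Definition wtape (r : nat -> nat) : nat -> nat := fun c => sym_of_tracks (bits r c).

Definition config_of (q : nat) (s : st) : config :=
  Config q (ipos s) (wtape (regs s)) 0 (otape (ow s)) (size (ow s)).

Lemma otape_lt3 w c : otape w c < 3.
Proof.
rewrite /otape; case: (ltnP c (size w)) => h.
  by rewrite (nth_map false) //; case: (nth _ _ _).
by rewrite nth_default // size_map.
Qed.

Lemma otape_size w : otape w (size w) = 0.
Proof. by rewrite /otape nth_default // size_map. Qed.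

Lemma write_id u h : write u h (u h) = u.
Proof. by apply/funext => c; rewrite /write; case: eqP => [->|]. Qed.

Section Correct.
Variables (rows : seq trow) (inp : nat -> nat).
Hypothesis inpE : forall c, inp c \in [:: 1; 2].

Let M := machine_of nsym rows.

Lemma nextcE x (pre post : seq trow) (r : trow) :
  rows = pre ++ r :: post -> state x = size pre ->
  (exists f, work x (work_head x) = sym_of_tracks f) -> out x (out_head x) < 3 ->
  nextc M inp x = apply_action x (r (inp (in_head x)) (work x (work_head x))
                                  (out x (out_head x))).
Proof.
move=> hr hs [f hf] ho; rewrite /nextc step_machine_of //=.
- by rewrite hr hs nth_cat ltnn subnn.
- by rewrite hr hs size_cat /= addnS ltnS leq_addr.
- by rewrite hf enc_lt.
Qed.

Lemma keeps_refl x y : out x = out y -> keeps x y.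
Proof. by move=> e c _; rewrite e. Qed.

(** The scan shared by [Inc] and [Dec]; [g] and [d] are what happens at the first unset cell.
    Induction on the distance to that cell. *)
Lemma scan_right pre post j q2 (g : nat -> nat) (d : dir) s b :
  0 < j <= m ->
  rows = pre ++ (fun _ b c => if bit j b then Action (size pre) b c Stay Right Stay
           else Action q2 (g b) c Stay d Stay) :: post ->
  exists n, reaches M inp b (config_of (size pre) s) n
    (Config q2 (ipos s)
      (write (wtape (regs s)) (regs s j) (g (wtape (regs s) (regs s j))))
      (move d (regs s j)) (otape (ow s)) (size (ow s))).
Proof.
move=> /andP[j0 jm] hr.
suff H k : k <= regs s j -> exists n, reaches M inp b
   (Config (size pre) (ipos s) (wtape (regs s)) (regs s j - k) (otape (ow s)) (size (ow s)))
   n (Config q2 (ipos s)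
      (write (wtape (regs s)) (regs s j) (g (wtape (regs s) (regs s j))))
      (move d (regs s j)) (otape (ow s)) (size (ow s))).
  by have := H _ (leqnn _); rewrite subnn.
elim: k => [|k IH] hk.
  rewrite subn0; exists 1; apply: reaches1; last by move=> _; apply: keeps_refl.
  rewrite (nextcE hr) //=; [|by eexists|exact: otape_lt3].
  rewrite bit_bits // ltnn /apply_action /= .
  by rewrite write_id.
have [n hn] := IH (ltnW hk).
exists (1 + n); apply: reaches_trans hn; apply: reaches1 => [|_]; last exact: keeps_refl.
rewrite (nextcE hr) //=; [|by eexists|exact: otape_lt3].
rewrite bit_bits // ifT; last by rewrite ltn_subrL (leq_trans _ hk).
rewrite /apply_action /= !write_id; congr Config; lia.
Qed.

Lemma scan_home pre post s h b :
  regs s 0 = 1 -> rows = pre ++ row_home (size pre) :: post ->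
  exists n, reaches M inp b
   (Config (size pre) (ipos s) (wtape (regs s)) h (otape (ow s)) (size (ow s)))
   n (config_of (size pre).+1 s).
Proof.
move=> s0 hr; elim: h => [|h [n hn]].
  exists 1; apply: reaches1 => [|_]; last exact: keeps_refl.
  rewrite (nextcE hr) //=; [|by eexists|exact: otape_lt3].
  by rewrite /row_home bit_bits // s0 /apply_action /= !write_id.
exists (1 + n); apply: reaches_trans hn; apply: reaches1 => [|_]; last exact: keeps_refl.
rewrite (nextcE hr) //=; [|by eexists|exact: otape_lt3].
by rewrite /row_home bit_bits // s0 /apply_action /= !write_id.
Qed.

(** The hypothesis says that old and new content differ at most in whether they exceed c, so a
    single cell is rewritten. *)
Lemma wtape_upd r j v c :
  0 < j <= m -> (forall c', c' != c -> (c' < r j) = (c' < v)) ->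
  wtape (fun k => if k == j then v else r k) =
  write (wtape r) c (setbit j (c < v) (wtape r c)).
Proof.
move=> /andP[j0 jm] hv; apply/funext => c'; rewrite /write /wtape /setbit encK.
have E k : (k == inord j :> 'I_m.+1) = (k == j :> nat).
  by rewrite -val_eqE /= inordK.
case: eqP => [->|/eqP ne]; congr sym_of_tracks; apply/ffunP => k; rewrite !ffunE ?E.
  by case: eqP.
by case: eqP => // ->; rewrite hv.
Qed.

(** By induction on the evaluation, since the command does not shrink when a loop is unfolded; [pre]
    and [post] let a command sit anywhere in the table. *)
Lemma compile_correct p b ob s s' : evals inp b p s s' -> wf_cmd ob m p -> regs s 0 = 1 ->
  forall pre post, rows = pre ++ compile p (size pre) ++ post ->
  exists n, reaches M inp b (config_of (size pre) s) n
                    (config_of (size pre + size (compile p (size pre))) s').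
Proof.
elim => {p s s'} /=.
- move=> s _ _ pre post _; exists 0; rewrite addn0; split => //.
- move=> s j hj s0 pre post hr.
  have [n1 h1] := scan_right s b (d := Stay) hj hr.
  have hr2 : rows = rcons pre (nth trow0 rows (size pre)) ++
      row_home (size (rcons pre (nth trow0 rows (size pre)))) :: post.
    by rewrite size_rcons cat_rcons {2}hr nth_cat ltnn subnn /= hr.
  pose s' := upd s j (regs s j).+1.
  have s'0 : regs s' 0 = 1 by rewrite /s' /=; case/andP: hj; case: (j).
  have [n2 h2] := scan_home (s := s') (regs s j) b s'0 hr2.
  exists (n1 + n2); rewrite size_rcons in h2.
  rewrite addn2; apply: reaches_trans h2.
  move: h1; rewrite /s' /= (@wtape_upd _ _ _ (regs s j) hj) ?ltnSn //.
  by move=> c' ne; apply/idP/idP; lia.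
- move=> s j hj s0 pre post hr.
  have [n1 h1] := scan_right s b (g := id) (d := Left) hj hr.
  have hr2 := hr; rewrite -cat_rcons in hr2.
  have hr3 := hr2; rewrite -cat_rcons in hr3.
  set pre2 := rcons _ _ in hr2 h1 *; set pre3 := rcons _ _ in hr3 *.
  pose s' := upd s j (regs s j).-1.
  have s'0 : regs s' 0 = 1 by rewrite /s' /=; case/andP: hj; case: (j).
  have e2 : size pre2 = (size pre).+1 by rewrite size_rcons.
  have e3 : size pre3 = (size pre).+2 by rewrite !size_rcons.
  rewrite -e3 in hr3.
  have [n3 h3] := scan_home (s := s') (regs s j).-1 b s'0 hr3.
  exists (n1 + (1 + n3)); rewrite addn3 -e3.
  apply: reaches_trans h1 _; apply: reaches_trans h3; rewrite write_id /=.
  apply: reaches1 => [|_]; last exact: keeps_refl.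
  rewrite (nextcE hr2) //=; [|by eexists|exact: otape_lt3].
  rewrite /apply_action /= e3 write_id (@wtape_upd _ _ _ (regs s j).-1 hj) ?ltnn //.
  by move=> c' ne; apply/idP/idP; lia.
- move=> s _ s0 pre post hr; exists 1.
  apply: reaches1 => [|_]; last exact: keeps_refl.
  rewrite (nextcE hr) //=; [|by eexists|exact: otape_lt3].
  by rewrite /apply_action /= !write_id addn1.
- move=> s a _ s0 pre post hr; exists 1.
  have E : otape (rcons (ow s) a) = write (otape (ow s)) (size (ow s)) (sym a).
    apply/funext => c; rewrite /otape map_rcons nth_rcons size_map /write.
    case: ltngtP => //; move=> h; by rewrite nth_default // size_map ltnW.
  apply: reaches1 => [|_ c /=].
    rewrite (nextcE hr) //=; [|by eexists|exact: otape_lt3].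
    rewrite /apply_action /= !write_id addn1 /config_of /= E size_rcons.
    by case: a {hr E}.
  by rewrite E /write; case: eqP => // ->; rewrite otape_size.
- move=> s nb _ s0 pre post hr; exists (1 + 1).
  have hr2 := hr; rewrite -cat_rcons in hr2.
  (* [Back] is evaluated only with the flag off, so nothing has to be preserved. *)
  have nk x y : b -> keeps x y by rewrite (negbTE nb).
  apply: reaches_trans.
    apply: reaches1; last exact: nk.
    by rewrite (nextcE hr) //=; [by eexists|exact: otape_lt3].
  apply: reaches1; last exact: nk.
  rewrite (nextcE hr2) /apply_action //=; last first.
  - by rewrite !write_id otape_lt3.
  - by rewrite write_id; eexists.
  - by rewrite size_rcons.
  rewrite addn2 !write_id /config_of /=; congr Config.
    apply/funext => c; rewrite /otape /write.
    case: (ow s) => [|a w] /=; first by rewrite !nth_nil if_same.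
    have [->|ne] := eqVneq c (size w).
      by rewrite nth_default // size_map size_take /= ltnSn.
    have [h|h] := ltnP c (size w).
      by rewrite map_take nth_take.
    rewrite !nth_default //= ?size_map ?size_take /= ?ltnSn //.
    by rewrite ltn_neqAle eq_sym ne.
  rewrite size_take; case: (size _) => //= k; by rewrite ltnSn.
- move=> c1 c2 s1 s2 s3 e1 h1 e2 h2 /andP[w1 w2] s0 pre post hr.
  rewrite -catA in hr.
  have [n1 r1] := h1 w1 s0 _ _ hr.
  have s20 : regs s2 0 = 1 by rewrite (ev_reg0 e1 w1).
  rewrite catA -size_cat in hr.
  have [n2 r2] := h2 w2 s20 _ _ hr.
  exists (n1 + n2); rewrite size_cat addnA -size_cat.
  apply: reaches_trans r1 _.
  by rewrite size_cat in r2 *.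
- move=> t c s nt hw s0 pre post hr; exists 1.
  apply: reaches1 => [|_]; last exact: keeps_refl.
  rewrite (nextcE hr) //=; [|by eexists|exact: otape_lt3].
  rewrite /apply_action /= !write_id size_rcons ifF //.
  by case: t nt hw {hr} => [j /= nj /andP[jm _]|/negbTE//]; rewrite bit_bits // (negbTE nj).
- move=> t c s1 s2 s3 ht e1 h1 _ h2 hw s0 pre post hr.
  have wc : wf_cmd ob m c by case: t hw {ht hr h2} => [j /andP[]|].
  have s20 : regs s2 0 = 1 by rewrite (ev_reg0 e1 wc).
  have [n2 r2] := h2 hw s20 _ _ hr.
  have hr1 := hr; rewrite -cat_rcons in hr1; set pre1 := rcons _ _ in hr1.
  have e' : (size pre).+1 = size pre1 by rewrite size_rcons.
  rewrite cat_rcons e' in hr1.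
  have [n1 r1] := h1 wc s0 _ _ hr1.
  exists (1 + (n1 + (1 + n2))); apply: reaches_trans.
    apply: reaches1 => [|_].
      rewrite (nextcE hr) //=; [by eexists|exact: otape_lt3].
    by apply: keeps_refl; rewrite /= write_id.
  rewrite /apply_action /= ifT; last first.
    by case: t ht hw {hr h2 r2 hr1 e' pre1 r1} => [j /= nj /andP[jm _]|//]; rewrite bit_bits.
  rewrite /= e' in r2; rewrite !write_id e'; apply: reaches_trans r1 _.
  apply: reaches_trans r2; apply: reaches1 => [|_]; last exact: keeps_refl.
  rewrite catA in hr1.
  rewrite (nextcE hr1) //=; [|by rewrite size_cat|by eexists|exact: otape_lt3].
  by rewrite /apply_action /= !write_id.
Qed.

End Correct.
End Compile.

Definition one_way_action (c : nat) (a : action) : bool :=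
  match act_mvo a with Stay => act_out a == c | Left => false | Right => true end.

(** Without [Back], only [Put] moves the output head, and every other row writes back the output
    symbol that it reads. *)
Lemma one_way_compile m p q : wf_cmd true m p ->
  forall k a b c, one_way_action c (nth trow0 (compile m p q) k a b c).
Proof.
pose P (s : seq trow) := forall k a b c, one_way_action c (nth trow0 s k a b c).
have nilP : P [::] by move=> k a b c; rewrite nth_nil /one_way_action /=.
have consP r s : (forall a b c, one_way_action c (r a b c)) -> P s -> P (r :: s).
  by move=> hr hs [|k] a b c; [apply: hr|apply: hs].
have home j : P [:: row_home m j].
  by apply: (consP _ _ _ nilP) => a b c; rewrite /row_home; case: ifP => _; apply/eqP.
rewrite -/(P _); elim: p q => //=.
- by move=> j q _; apply: (consP _ _ _ (home _)) => a b c; case: ifP => _; apply/eqP.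
- move=> j q _; apply: (consP); last by apply: (consP _ _ _ (home _)) => a b c; apply/eqP.
  by move=> a b c; case: ifP => _; apply/eqP.
- by move=> q _; apply: (consP _ _ _ nilP) => a b c; apply/eqP.
- by move=> x q _; apply: (consP _ _ _ nilP) => a b c.
- move=> c1 h1 c2 h2 q /andP[w1 w2] k a b c; rewrite nth_cat; case: ifP => _.
    exact: h1.
  exact: h2.
- move=> t c h q hw; have wc : wf_cmd true m c by case: t hw => [j /andP[]|].
  apply: (consP) => [a b o|k a b o]; first exact/eqP.
  rewrite nth_rcons; case: ifP => _; first exact: h.
  by case: ifP => _; apply/eqP.
Qed.

(** * Endless loops as machines *)

Section Loop.
Variables (ob : bool) (m : nat) (body : cmd).
Hypothesis wfb : wf_cmd ob m body.

(** State 0 writes the marker on the blank tape; then register 0 holds 1 and the loop never ends. *)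
Definition loop_rows : seq trow :=
  (fun _ b c => keep 1 (setbit m 0 true b) c) :: compile m (While (Reg 0) body) 1.

Definition loop_machine : machine := machine_of (nsym m) loop_rows.

Lemma one_way_loop : ob -> one_way loop_machine.
Proof.
move=> hob; rewrite /one_way /loop_machine /machine_of all_map.
have w : wf_cmd true m (While (Reg 0) body) by rewrite -hob.
have H k a b c : one_way_action c (nth trow0 loop_rows k a b c).
  case: k => [|k]; first by rewrite /one_way_action /=.
  exact: (one_way_compile 1 w).
by apply/allP => -[[q a] [b c]] _; apply: H.
Qed.

Definition st0 : st := St (fun j => j == 0) 0 [::].

(** [t i] is the time at which pass i begins. Each pass takes at least one step for the loop test,
    so these times increase strictly. *)
Lemma loop_run (p : baire) (S : nat -> st) (b : nat -> bool) :
  (forall c, tape_of p c \in [:: 1; 2]) ->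
  S 0 = st0 -> (forall i, evals (tape_of p) (b i) body (S i) (S i.+1)) ->
  exists t : nat -> nat, forall i,
    [/\ t i < t i.+1, out (run loop_machine p (t i)) = otape (ow (S i)) &
        b i -> forall k, t i <= k < t i.+1 ->
          keeps (run loop_machine p k) (run loop_machine p k.+1)].
Proof.
move=> hp S0 hS.
have runE t : run loop_machine p t = iter t (nextc loop_machine (tape_of p)) init by [].
have hr : loop_rows = [:: (fun _ b c => keep 1 (setbit m 0 true b) c)] ++
   compile m (While (Reg 0) body) 1 ++ [::] by rewrite cats0.
have S1 i : regs (S i) 0 = 1.
  by elim: i => [|i IH]; [rewrite S0|rewrite (ev_reg0 (hS i) wfb)].
have nx0 : nextc loop_machine (tape_of p) init = config_of m 1 (S 0).
  rewrite (nextcE hp (pre := [::]) hr) //=; last first.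
    by exists [ffun=> false]; rewrite /sym_of_tracks eqxx.
  rewrite S0 /apply_action /= /config_of /=; congr Config; last first.
    by apply/funext => c; rewrite /write /otape /= nth_nil if_same.
  apply/funext => c; rewrite /write /wtape /setbit /=.
  case: eqP => [->|/eqP c0].
    congr sym_of_tracks; apply/ffunP => k; rewrite !ffunE -val_eqE /= inordK //.
    by case: eqP => // ->.
  rewrite /sym_of_tracks ifT //; apply/eqP/ffunP => k; rewrite !ffunE /=.
  by case: (c) c0 => // c' _; case: eqP.
have seg i : exists n, reaches loop_machine (tape_of p) (b i) (config_of m 1 (S i)) n.+1 (config_of m 1 (S i.+1)).
  have e : 2 = size (([:: (fun _ b c => keep 1 (setbit m 0 true b) c)]) ++
     [:: nth trow0 (compile m (While (Reg 0) body) 1) 0 ]) by [].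
  have hr1 : loop_rows = ([:: (fun _ b c => keep 1 (setbit m 0 true b) c)] ++
     [:: nth trow0 (compile m (While (Reg 0) body) 1) 0 ]) ++ compile m body 2 ++
     [:: (fun _ b o => keep 1 b o)].
    by rewrite hr cats0 /= cats1.
  rewrite [in compile _ _ 2]e in hr1; set pre1 := _ ++ _ in e hr1.
  have [n hn] := compile_correct hp (hS i) wfb (S1 i) hr1.
  exists (n + 1); rewrite -[(n + 1).+1]add1n.
  apply: reaches_trans.
    apply: reaches1 => [|_].
      by rewrite (nextcE hp (pre := [:: _]) hr) //=; [by eexists|exact: otape_lt3].
    by apply: keeps_refl; rewrite /= write_id.
  rewrite /apply_action /= bit_bits // S1 /= !write_id.
  apply: (reaches_trans hn).
  rewrite catA in hr1.
  apply: reaches1 => [|_]; last exact: keeps_refl.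
  rewrite (nextcE hp hr1) //=; [|by eexists|exact: otape_lt3].
  by rewrite /apply_action /= !write_id.
have [l hl] := choice seg.
pose t i := (\sum_(k < i) (l k).+1).+1.
have tS i : t i.+1 = (l i).+1 + t i by rewrite /t big_ord_recr /=; lia.
have ht i : run loop_machine p (t i) = config_of m 1 (S i).
  elim: i => [|i IH]; first by rewrite /t big_ord0 runE /= nx0.
  by rewrite tS runE iterD -runE IH; have [-> _] := hl i.
exists t => i; split; first by rewrite tS -{1}[t i]add0n ltn_add2r.
  by rewrite ht.
move=> hb k /andP[k1 k2]; have [_ /(_ hb (k - t i))] := hl i.
have -> : k - t i < (l i).+1 by rewrite tS in k2; lia.
by move=> /(_ isT); rewrite -(ht i) runE iterS -iterD subnK.
Qed.

End Loop.

(** * Computable functions of registers *)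

Definition agree (d : nat) (s s' : st) : Prop :=
  [/\ forall j, j < d -> regs s' j = regs s j, ipos s' = ipos s & ow s' = ow s].

Lemma agree_trans d s1 s2 s3 : agree d s1 s2 -> agree d s2 s3 -> agree d s1 s3.
Proof.
by move=> [h1 i1 o1] [h2 i2 o2]; split=> [j hj||]; rewrite ?h2 ?h1 ?i2 ?o2.
Qed.

Lemma agree_le d d' s s' : d <= d' -> agree d' s s' -> agree d s s'.
Proof. by move=> h [r i o]; split=> // j hj; apply: r; apply: leq_trans h. Qed.

Lemma agree_upd d s j v : d <= j -> agree d s (upd s j v).
Proof. by move=> h; split=> //= k hk; case: eqP => // e; lia. Qed.

Lemma agree_updr d s s' j v : d <= j -> agree d s s' -> agree d s (upd s' j v).
Proof. by move=> h /agree_trans; apply; apply: agree_upd. Qed.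

Lemma st_eq s s' : regs s =1 regs s' -> ipos s = ipos s' -> ow s = ow s' -> s = s'.
Proof. by case: s s' => [r i o] [r' i' o'] /= /funext -> -> ->. Qed.

(* [pr F]: some program computes F of the registers r 0, r 1, ... into register
   d, for any choice of r and d, using the registers from d on as scratch. *)
Definition pr (F : (nat -> nat) -> nat) : Prop :=
  forall r d, (forall i, 0 < r i < d) ->
  exists c m, wf_cmd true m c /\ forall inp (b : bool) s, exists s',
    [/\ evals inp b c s s', regs s' d = F (fun i => regs s (r i)) & agree d s s'].

Lemma ev_while_ind inp b j c (I : nat -> st -> Prop) n s :
  (forall n s, I n s -> regs s j = n) ->
  (forall n s, I n.+1 s -> exists s', evals inp b c s s' /\ I n s') ->
  I n s -> exists s', evals inp b (While (Reg j) c) s s' /\ I 0 s'.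
Proof.
move=> hj hc; elim: n s => [|n IH] s hs.
  by exists s; split=> //; apply: ev_wf; rewrite /= (hj _ _ hs).
have [s1 [e1 /IH [s2 [e2 h2]]]] := hc _ _ hs.
by exists s2; split=> //; apply: ev_wt e1 e2; rewrite /= (hj _ _ hs).
Qed.

Definition clear (j : nat) : cmd := While (Reg j) (Dec j).

Lemma ev_clear inp b j s : evals inp b (clear j) s (upd s j 0).
Proof.
have [|n s1||s1 [h e]] := @ev_while_ind inp b j (Dec j) (fun n s1 => s1 = upd s j n)
  (regs s j) s.
- by move=> n s1 ->; rewrite /= eqxx.
- move=> ->; eexists; split; first exact: ev_dec.
  by apply: st_eq => // k /=; rewrite eqxx; case: eqP.
- by apply: st_eq => //= k; case: eqP => // ->.
by rewrite -e.
Qed.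

Definition moveto (a d : nat) : cmd :=
  Seq (clear d) (While (Reg a) (Seq (Dec a) (Inc d))).

Lemma ev_moveto inp b a d s : a != d ->
  evals inp b (moveto a d) s (upd (upd s d (regs s a)) a 0).
Proof.
move=> ad; have da : d != a by rewrite eq_sym.
have [|n s1||s1 [h [_ e1]]] := @ev_while_ind inp b a (Seq (Dec a) (Inc d))
  (fun n s1 => n <= regs s a /\ s1 = upd (upd s d (regs s a - n)) a n)
  (regs s a) (upd s d 0).
- by move=> n s1 [_ ->]; rewrite /= eqxx.
- move=> [hn ->]; eexists; split; first by apply: ev_seq; [exact: ev_dec|exact: ev_inc].
  split; first exact: ltnW.
  apply: st_eq => // k /=; rewrite !eqxx (negbTE da) /=.
  by case: eqP => [->|_]; [rewrite (negbTE da); lia|case: eqP].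
- split=> //; rewrite subnn; apply: st_eq => //= k.
  by case: (k =P a) => // ->; rewrite (negbTE ad).
by rewrite subn0 in e1; rewrite e1 in h; apply: ev_seq (ev_clear _ _ _ _) h.
Qed.

(** A register can only be read by emptying it, so its content goes to both d and d.+1 and then
    returns from d.+1. *)
Definition copyto (a d : nat) : cmd :=
  Seq (clear d) (Seq (clear d.+1) (Seq
    (While (Reg a) (Seq (Dec a) (Seq (Inc d) (Inc d.+1)))) (moveto d.+1 a))).

Lemma ev_copyto inp b a d s : a < d ->
  evals inp b (copyto a d) s (upd (upd s d (regs s a)) d.+1 0).
Proof.
move=> ad.
have [|n s1||s1 [h [_ e1]]] := @ev_while_ind inp b a (Seq (Dec a) (Seq (Inc d) (Inc d.+1)))
  (fun n s1 => n <= regs s a /\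
     s1 = upd (upd (upd s d (regs s a - n)) d.+1 (regs s a - n)) a n)
  (regs s a) (upd (upd s d 0) d.+1 0).
- by move=> n s1 [_ ->]; rewrite /= eqxx.
- move=> [hn ->]; eexists; split.
    by apply: ev_seq; [exact: ev_dec|apply: ev_seq; exact: ev_inc].
  split; first exact: ltnW.
  apply: st_eq => // k /=; rewrite !eqxx.
  have [e1 e2 e3 e4] : [/\ (d.+1 == a) = false, (d.+1 == d) = false,
      (d == a) = false & (d == d.+1) = false] by split; apply/eqP; lia.
  have [->|n1] := eqVneq k d.+1; first by rewrite ?(e1, e2); lia.
  have [->|n2] := eqVneq k d; first by rewrite ?(e3, e4); lia.
  by case: eqP.
- split=> //; rewrite subnn; apply: st_eq => //= k.
  have [->|n1] := eqVneq k a; first by rewrite ltn_eqF ?ltn_eqF // ltnW.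
  by [].
rewrite subn0 in e1; rewrite e1 in h.
apply: ev_seq (ev_clear _ _ _ _) _; apply: ev_seq (ev_clear _ _ _ _) _.
apply: ev_seq h _; have := @ev_moveto inp b d.+1 a s1; rewrite e1 => H.
suff -> : upd (upd s d (regs s a)) d.+1 0 =
   upd (upd s1 a (regs s1 d.+1)) d.+1 0 by rewrite e1; apply: H; apply/eqP; lia.
rewrite e1; apply: st_eq => //= k; rewrite eqxx.
have -> : d.+1 == a = false by apply/eqP; lia.
case: (eqVneq k d.+1) => [//|n1].
case: (eqVneq k a) => [->|//].
by rewrite ltn_eqF.
Qed.

Lemma wf_clear m j : 0 < j <= m -> wf_cmd true m (clear j).
Proof. by move=> /= h; rewrite h; case/andP: h => _ ->. Qed.

Lemma wf_moveto m a d : 0 < a <= m -> 0 < d <= m -> wf_cmd true m (moveto a d).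
Proof. by move=> ha hd; rewrite /= ha hd /=; case/andP: ha => _ ->; case/andP: hd => _ ->. Qed.

Lemma wf_copyto m a d : 0 < a < d -> d < m -> wf_cmd true m (copyto a d).
Proof.
move=> ad dm; have [h1 h2 h4 h5] : [/\ 0 < a <= m, 0 < d <= m, a <= m & d <= m] by split; lia.
by rewrite /= h1 h2 h4 h5 dm.
Qed.

Lemma wf_seq ob m c1 c2 : wf_cmd ob m (Seq c1 c2) = wf_cmd ob m c1 && wf_cmd ob m c2.
Proof. by []. Qed.

Lemma pr_ext F G : F =1 G -> pr F -> pr G.
Proof. by move=> /funext ->. Qed.

(** Immediate because [pr] quantifies over the placement of the arguments. *)
Lemma pr_ren f F : pr F -> pr (fun r => F (fun i => r (f i))).
Proof. by move=> h r d hr; apply: (h (fun i => r (f i)) d). Qed.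

Lemma pr_var i : pr (fun r => r i).
Proof.
move=> r d hr; exists (copyto (r i) d), d.+2; split; first exact: wf_copyto.
move=> inp b s; eexists; split; first by apply: ev_copyto; case/andP: (hr i).
  by rewrite /= eqxx; case: eqP => //; lia.
by apply: (agree_trans (s2 := upd s d (regs s (r i)))); apply: agree_upd.
Qed.

Lemma pr_zero : pr (fun _ => 0).
Proof.
move=> r d hr; have d0 : 0 < d by have := hr 0; lia.
exists (clear d), d; split; first by apply: wf_clear; rewrite d0 /=.
move=> inp b s; eexists; split; first exact: ev_clear.
  by rewrite /= eqxx.
exact: agree_upd.
Qed.

Lemma pr_succ F : pr F -> pr (fun r => (F r).+1).
Proof.
move=> hF r d hr; have d0 : 0 < d by have := hr 0; lia.
have [c [m [w h]]] := hF r d hr.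
exists (Seq c (Inc d)), (maxn m d); split.
  by apply/andP; split; [apply: (wf_mono _ _ w) => //|rewrite /= d0]; lia.
move=> inp b s; have [s1 [e1 r1 a1]] := h inp b s; eexists; split.
- by apply: ev_seq e1 _; exact: ev_inc.
- by rewrite /= eqxx r1.
- by apply: agree_trans a1 _; apply: agree_upd.
Qed.

Definition push (x : nat) (r : nat -> nat) : nat -> nat :=
  fun i => if i is i'.+1 then r i' else x.

Lemma agree_env d s s' (r : nat -> nat) : agree d s s' -> (forall i, 0 < r i < d) ->
  (fun i => regs s' (r i)) = (fun i => regs s (r i)).
Proof. by move=> [h _ _] hr; apply/funext => i; rewrite h //; case/andP: (hr i). Qed.

(** As with de Bruijn indices: the value of A stays in register d and becomes argument 0 of the
    body, whose scratch space starts at d.+1. *)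
Lemma pr_let A (g : nat -> (nat -> nat) -> nat) :
  pr A -> pr (fun r => g (r 0) (fun i => r i.+1)) -> pr (fun r => g (A r) r).
Proof.
move=> hA hg r d hr; have d0 : 0 < d by have := hr 0; lia.
have [c [m [w h]]] := hA r d hr.
have [|c' [m' [w' h']]] := hg (push d r) d.+1.
  by move=> [|i] /=; [rewrite d0 /=|have := hr i; lia].
exists (Seq c (Seq c' (moveto d.+1 d))), (maxn (maxn m m') d.+1); split.
  rewrite !wf_seq.
  apply/and3P; split; last by apply: wf_moveto; lia.
  - by apply: (wf_mono _ _ w) => //; lia.
  - by apply: (wf_mono _ _ w') => //; lia.
move=> inp b s; have [s1 [e1 r1 a1]] := h inp b s.
have [s2 [e2 r2 a2]] := h' inp b s1.
eexists; split.
- apply: ev_seq e1 _; apply: ev_seq e2 _; apply: ev_moveto; apply/eqP; lia.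
- rewrite /= eqxx; case: eqP => [|_]; first by lia.
  by rewrite r2 /= r1 (agree_env a1 hr).
- apply: agree_trans a1 _; apply: agree_trans (agree_le _ a2) _ => //.
  apply: (agree_trans (s2 := upd s2 d (regs s2 d.+1))); apply: agree_upd => //.
Qed.

Fixpoint prec (a : nat) (g : nat -> nat -> nat) (n : nat) : nat :=
  if n is n'.+1 then g n' (prec a g n') else a.

(** Registers d, d.+1 and d.+2 hold the number of passes left, the value so far and the index; the
    step function computes into d.+3. *)
Lemma pr_rec N A (g : nat -> nat -> (nat -> nat) -> nat) :
  pr N -> pr A -> pr (fun r => g (r 1) (r 0) (fun i => r i.+2)) ->
  pr (fun r => prec (A r) (fun k y => g k y r) (N r)).
Proof.
move=> hN hA hg r d hr; have d0 : 0 < d by have := hr 0; lia.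
have [c [m [w h]]] := hN r d hr.
have hr1 i : 0 < r i < d.+1 by have := hr i; lia.
have [c' [m' [w' h']]] := hA r d.+1 hr1.
have [|b' [m2 [w2 h2]]] := hg (push d.+1 (push d.+2 r)) d.+3.
  by move=> [|[|i]] /=; [lia|lia|have := hr i; lia].
pose loop := While (Reg d) (Seq b' (Seq (moveto d.+3 d.+1) (Seq (Inc d.+2) (Dec d)))).
exists (Seq c (Seq c' (Seq (clear d.+2) (Seq loop (moveto d.+1 d))))),
  (maxn (maxn m m') (maxn m2 d.+3)); split.
  rewrite /=; repeat (apply/andP; split); try lia.
  - by apply: (wf_mono _ _ w) => //; lia.
  - by apply: (wf_mono _ _ w') => //; lia.
  - by apply: (wf_mono _ _ w2) => //; lia.
move=> inp b s; have [s1 [e1 r1 a1]] := h inp b s.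
have [s2 [e2 r2 a2]] := h' inp b s1.
pose E := fun i => regs s (r i).
pose G k y := g k y E.
have Q k : ((d + k.+1 == d) = false) * ((d == d + k.+1) = false) by split; apply/eqP; lia.
have Q1 := Q 0; have Q2 := Q 1; have Q3 := Q 2; rewrite addn1 addn2 addn3 in Q1 Q2 Q3.
have [|||s3 [e3 [_ [j0 j1 j2 ja]]]] := @ev_while_ind inp b d
   (Seq b' (Seq (moveto d.+3 d.+1) (Seq (Inc d.+2) (Dec d))))
   (fun n s' => n <= regs s1 d /\ [/\ regs s' d = n,
     regs s' d.+1 = prec (A E) G (regs s1 d - n), regs s' d.+2 = regs s1 d - n
     & agree d s s']) (regs s1 d) (upd s2 d.+2 0).
- by move=> n s' [_ []].
- move=> n s' [hn [j0 j1 j2 ja]].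
  have [s3 [e3 r3 a3]] := h2 inp b s'.
  eexists; split.
    apply: ev_seq e3 _; apply: ev_seq; first by apply: ev_moveto; apply/eqP; lia.
    by apply: ev_seq; [exact: ev_inc|exact: ev_dec].
  have [q0 q1 q2] : [/\ regs s3 d = n.+1, regs s3 d.+1 = prec (A E) G (regs s1 d - n.+1)
    & regs s3 d.+2 = regs s1 d - n.+1] by have [q _ _] := a3; rewrite !q; try lia.
  split; first exact: ltnW.
  split.
  + by rewrite /= !(eqxx, eqSS, Q1, Q2, Q3) //= q0.
  + rewrite /= !(eqxx, eqSS, Q1, Q2, Q3) //= r3 /= j1 j2.
    have -> : regs s1 d - n = (regs s1 d - n.+1).+1 by lia.
    by rewrite /= /G (agree_env ja hr).
  + by rewrite /= !(eqxx, eqSS, Q1, Q2, Q3) //= q2; lia.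
  + apply: agree_trans ja _; apply: agree_trans (agree_le _ a3) _; first by lia.
    by do 4 (apply: agree_updr; first by lia).
- split=> //; split; rewrite /= ?(eqxx, eqSS, Q1, Q2, Q3) // ?subnn //.
  + by case: a2 => -> //.
  + by rewrite r2 (agree_env a1 hr).
  + apply: agree_trans a1 _; apply: agree_trans (agree_le _ a2) _; first by lia.
    by apply: agree_upd; lia.
eexists; split.
- apply: ev_seq e1 _; apply: ev_seq e2 _; apply: ev_seq; first exact: ev_clear.
  apply: ev_seq e3 _; apply: ev_moveto; apply/eqP; lia.
- by rewrite /= !(eqxx, eqSS, Q1, Q2, Q3) // j1 r1 subn0.
- apply: agree_trans ja _.
  by do 2 (apply: agree_updr; first by lia).
Qed.

Lemma pr_app1 f A : pr (fun r => f (r 0)) -> pr A -> pr (fun r => f (A r)).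
Proof.
move=> hf hA; apply: (pr_let (g := fun x r => f x) hA).
exact: (pr_ren (fun i => i) hf).
Qed.

Lemma pr_app2 f A B : pr (fun r => f (r 0) (r 1)) -> pr A -> pr B ->
  pr (fun r => f (A r) (B r)).
Proof.
move=> hf hA hB; apply: (pr_let (g := fun x r => f x (B r)) hA).
apply: (pr_let (A := fun r => B (fun i => r i.+1)) (g := fun y r => f (r 0) y)).
  exact: pr_ren hB.
exact: (pr_ren (fun i => if i is 0 then 1 else 0) hf).
Qed.

Lemma pr_app3 f A B C : pr (fun r => f (r 0) (r 1) (r 2)) -> pr A -> pr B -> pr C ->
  pr (fun r => f (A r) (B r) (C r)).
Proof.
move=> hf hA hB hC; apply: (pr_let (g := fun x r => f x (B r) (C r)) hA).
apply: (pr_let (A := fun r => B (fun i => r i.+1))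
  (g := fun y r => f (r 0) y (C (fun i => r i.+1)))); first exact: pr_ren hB.
apply: (pr_let (A := fun r => C (fun i => r i.+2))
  (g := fun z r => f (r 1) (r 0) z)); first exact: pr_ren hC.
exact: (pr_ren (fun i => match i with 0 => 2 | 1 => 1 | _ => 0 end) hf).
Qed.

Lemma pr_const n : pr (fun=> n).
Proof. by elim: n => [|n IH]; [exact: pr_zero|exact: (pr_succ IH)]. Qed.

Lemma pr_add A B : pr A -> pr B -> pr (fun r => A r + B r).
Proof.
apply: pr_app2; apply: (pr_ext (F := fun r => prec (r 0) (fun _ y => y.+1) (r 1))).
  by move=> r; elim: (r 1) => [|n /= ->]; rewrite ?addn0 ?addnS.
apply: (pr_rec (g := fun k y r => y.+1)); [exact: pr_var..|].
exact: pr_succ (pr_var 0).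
Qed.

Lemma pr_pred A : pr A -> pr (fun r => (A r).-1).
Proof.
apply: pr_app1; apply: (pr_ext (F := fun r => prec 0 (fun k y => k) (r 0))).
  by move=> r; case: (r 0).
apply: (pr_rec (g := fun k y r => k)); [exact: pr_var|exact: pr_zero|exact: pr_var].
Qed.

Lemma pr_sub A B : pr A -> pr B -> pr (fun r => A r - B r).
Proof.
apply: pr_app2; apply: (pr_ext (F := fun r => prec (r 0) (fun _ y => y.-1) (r 1))).
  by move=> r; elim: (r 1) => [|n /= ->]; rewrite ?subn0 ?subnS.
apply: (pr_rec (g := fun k y r => y.-1)); [exact: pr_var..|].
exact: pr_pred (pr_var 0).
Qed.

Lemma pr_mul A B : pr A -> pr B -> pr (fun r => A r * B r).
Proof.
apply: pr_app2; apply: (pr_ext (F := fun r => prec 0 (fun _ y => y + r 0) (r 1))).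
  by move=> r; elim: (r 1) => [|n /= ->]; rewrite ?muln0 // mulnS addnC.
apply: (pr_rec (g := fun k y r => y + r 0)); [exact: pr_var|exact: pr_zero|].
exact: (pr_add (pr_var 0) (pr_var 2)).
Qed.

Lemma pr_exp A B : pr A -> pr B -> pr (fun r => A r ^ B r).
Proof.
apply: pr_app2; apply: (pr_ext (F := fun r => prec 1 (fun _ y => y * r 0) (r 1))).
  by move=> r; elim: (r 1) => [|n /= ->] //; rewrite expnSr.
apply: (pr_rec (g := fun k y r => y * r 0)); [exact: pr_var|exact: pr_const|].
exact: (pr_mul (pr_var 0) (pr_var 2)).
Qed.

Lemma pr_leq A B : pr A -> pr B -> pr (fun r => A r <= B r).
Proof.
move=> hA hB; apply: (pr_ext (F := fun r => 1 - (A r - B r))).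
  by move=> r; case: leqP => h /=; lia.
exact: pr_sub (pr_const 1) (pr_sub hA hB).
Qed.

Lemma pr_and (A B : (nat -> nat) -> bool) : pr A -> pr B -> pr (fun r => A r && B r).
Proof.
move=> hA hB; apply: (pr_ext (F := fun r => A r * B r)).
  by move=> r; case: (A r) (B r) => [] [].
exact: pr_mul hA hB.
Qed.

Lemma pr_neg (A : (nat -> nat) -> bool) : pr A -> pr (fun r => ~~ A r).
Proof.
move=> hA; apply: (pr_ext (F := fun r => 1 - A r)); first by move=> r; case: (A r).
exact: pr_sub (pr_const 1) hA.
Qed.

Lemma pr_eqn A B : pr A -> pr B -> pr (fun r => A r == B r).
Proof.
move=> hA hB; apply: (pr_ext (F := fun r => (A r <= B r) && (B r <= A r))).
  by move=> r; rewrite eqn_leq.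
by apply: pr_and; apply: pr_leq.
Qed.

Lemma pr_if (C : (nat -> nat) -> bool) A B : pr C -> pr A -> pr B ->
  pr (fun r => if C r then A r else B r).
Proof.
move=> hC hA hB; apply: (pr_ext (F := fun r => C r * A r + (1 - C r) * B r)).
  by move=> r; case: (C r); lia.
exact: pr_add (pr_mul hC hA) (pr_mul (pr_sub (pr_const 1) hC) hB).
Qed.

Lemma pr_sum N (g : nat -> (nat -> nat) -> nat) :
  pr N -> pr (fun r => g (r 0) (fun i => r i.+1)) ->
  pr (fun r => \sum_(i < N r) g i r).
Proof.
move=> hN hg; apply: (pr_ext (F := fun r => prec 0 (fun k y => y + g k r) (N r))).
  by move=> r; elim: (N r) => [|n /= ->]; rewrite ?big_ord0 ?big_ord_recr.
apply: (pr_rec (g := fun k y r => y + g k r)); [by []|exact: pr_zero|].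
apply: pr_add (pr_var 0) _.
exact: (pr_ren (fun i => i.+1) hg).
Qed.

Lemma pr_max N (g : nat -> (nat -> nat) -> nat) :
  pr N -> pr (fun r => g (r 0) (fun i => r i.+1)) ->
  pr (fun r => \max_(i < N r) g i r).
Proof.
move=> hN hg.
apply: (pr_ext (F := fun r => prec 0 (fun k y => y + (g k r - y)) (N r))).
  by move=> r; elim: (N r) => [|n /= ->]; rewrite ?big_ord0 ?big_ord_recr //= maxnE.
apply: (pr_rec (g := fun k y r => y + (g k r - y))); [by []|exact: pr_zero|].
apply: pr_add (pr_var 0) (pr_sub _ (pr_var 0)).
exact: (pr_ren (fun i => i.+1) hg).
Qed.

Lemma pr_ex N (g : nat -> (nat -> nat) -> bool) :
  pr N -> pr (fun r => g (r 0) (fun i => r i.+1)) ->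
  pr (fun r => [exists i : 'I_(N r), g i r]).
Proof.
move=> hN hg; apply: (pr_ext (F := fun r => 0 < \sum_(i < N r) g i r)).
  move=> r; congr nat_of_bool; rewrite lt0n sum_nat_eq0 negb_forall.
  by apply: eq_existsb => i /=; case: (g i r).
apply: pr_leq (pr_const 1) _; exact: (pr_sum (g := fun i r => g i r : nat) hN hg).
Qed.

(** The accumulator equals the index k exactly as long as no smaller index satisfies g. *)
Lemma pr_find N (g : nat -> (nat -> nat) -> bool) :
  pr N -> pr (fun r => g (r 0) (fun i => r i.+1)) ->
  pr (fun r => find (fun i => g i r) (iota 0 (N r))).
Proof.
move=> hN hg; apply: (pr_ext (F := fun r =>
   prec 0 (fun k y => if (y == k) && ~~ g k r then k.+1 else y) (N r))).
  move=> r; elim: (N r) => [//|n IH]; rewrite [LHS]/= {}IH.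
  rewrite -[in RHS]addn1 iotaD find_cat size_iota add0n /= has_find size_iota.
  have := find_size (g^~ r) (iota 0 n); rewrite size_iota.
  case: ltngtP => //= [->] _; case: (g n r) => /=; lia.
apply: (pr_rec (g := fun k y r => if (y == k) && ~~ g k r then k.+1 else y)).
- by [].
- exact: pr_zero.
- apply: pr_if (pr_succ (pr_var 1)) (pr_var 0); apply: pr_and.
    exact: pr_eqn (pr_var 0) (pr_var 1).
  apply: pr_neg; exact: (pr_ren (fun i => i.+1) hg).
Qed.

Lemma pr_iter N A (g : nat -> (nat -> nat) -> nat) :
  pr N -> pr A -> pr (fun r => g (r 0) (fun i => r i.+1)) ->
  pr (fun r => iter (N r) (fun y => g y r) (A r)).
Proof.
move=> hN hA hg; apply: (pr_ext (F := fun r => prec (A r) (fun k y => g y r) (N r))).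
  by move=> r; elim: (N r) => [//|n /= ->].
apply: (pr_rec (g := fun k y r => g y r)) => //.
exact: (pr_ren (fun i => if i is i'.+1 then i'.+2 else 0) hg).
Qed.

(** The quotient counts the positive multiples of d up to m; the test 0 < d matches the convention
    for division by 0. *)
Lemma divn_sum m d : m %/ d = \sum_(k < m) ((0 < d) && (k.+1 * d <= m)).
Proof.
case: d => [|d]; first by rewrite divn0 big1.
transitivity (\sum_(k < m) (k < m %/ d.+1)); last first.
  by apply: eq_bigr => k _ /=; rewrite leq_divRL.
have: m %/ d.+1 <= m by exact: leq_div.
move: (m %/ d.+1) => q; elim: m => [|n IH] h; first by rewrite big_ord0; lia.
rewrite big_ord_recr /=; move: h; rewrite leq_eqVlt => /orP[/eqP h|h].
  rewrite h ltnSn (eq_bigr (fun=> 1)); first by rewrite sum1_card card_ord addn1.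
  by move=> i _; rewrite ltnS ltnW.
by rewrite -IH // ltnNge -ltnS h addn0.
Qed.

Lemma pr_div A B : pr A -> pr B -> pr (fun r => A r %/ B r).
Proof.
apply: pr_app2; apply: (pr_ext (F := fun r =>
  \sum_(k < r 0) ((0 < r 1) && (k.+1 * r 1 <= r 0)))).
  by move=> r; rewrite -divn_sum.
apply: (pr_sum (g := fun k r => (0 < r 1) && (k.+1 * r 1 <= r 0))); first exact: pr_var.
apply: pr_and; first exact: pr_leq (pr_const 1) (pr_var 2).
exact: pr_leq (pr_mul (pr_succ (pr_var 0)) (pr_var 2)) (pr_var 1).
Qed.

Lemma pr_mod A B : pr A -> pr B -> pr (fun r => A r %% B r).
Proof.
move=> hA hB; apply: (pr_ext (F := fun r => A r - A r %/ B r * B r)).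
  by move=> r; rewrite {1}(divn_eq (A r) (B r)) addKn.
exact: pr_sub hA (pr_mul (pr_div hA hB) hB).
Qed.

Lemma pr_half A : pr A -> pr (fun r => (A r)./2).
Proof.
move=> hA; apply: (pr_ext (F := fun r => A r %/ 2)) => [r|]; first by rewrite divn2.
exact: pr_div hA (pr_const 2).
Qed.

Lemma pr_odd A : pr A -> pr (fun r => odd (A r)).
Proof.
move=> hA; apply: (pr_ext (F := fun r => A r %% 2)) => [r|]; first by rewrite modn2.
exact: pr_mod hA (pr_const 2).
Qed.

Lemma pr_min A B : pr A -> pr B -> pr (fun r => minn (A r) (B r)).
Proof.
move=> hA hB; apply: pr_if => //; exact: pr_leq (pr_succ hA) hB.
Qed.

Lemma pr_cpair A B : pr A -> pr B -> pr (fun r => cpair (A r) (B r)).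
Proof.
move=> hA hB; apply: pr_add => //; apply: pr_half.
by apply: pr_mul; [|apply: pr_succ]; apply: pr_add.
Qed.

(** Induction along the diagonal walk: the pair before (n, k.+1) is (n.+1, k), and the one before
    (n.+1, 0) is (0, n). *)
Lemma cpairK n k : cunpair (cpair n k) = (n, k).
Proof.
have inj m n' k' : cpair n' k' = m -> cunpair m = (n', k').
  elim: m n' k' => [|m IH] n' k'.
    rewrite /cpair => e; have k0 : k' = 0 by lia.
    move: e; rewrite k0 !addn0; case: n' => //.
  case: k' => [|k'].
    case: n' => [|n']; first by [].
    move=> e; have -> : cunpair m.+1 = (if (0, n') is (i.+1, j) then (i, j.+1) else (n'.+1, 0)).
      rewrite /cunpair iterS -/(cunpair m) (IH 0 n') //.
      apply: succn_inj; rewrite -e /cpair !addn0 add0n.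
      rewrite -[n'.+2]addn2 mulnDr muln2 halfD odd_double andbF doubleK mulnC.
      by rewrite addnS.
    by [].
  move=> e; rewrite /cunpair iterS -/(cunpair m) (IH n'.+1 k') //.
  by apply: succn_inj; rewrite -e /cpair !addnS !addSn.
exact: inj.
Qed.

Lemma cpair_bound n k : n <= cpair n k /\ k <= cpair n k.
Proof.
rewrite /cpair; split; last by lia.
apply: leq_trans (leq_addr _ _); rewrite -divn2 leq_divRL //.
case: n => // n; rewrite addSn; have := leq_mul (leq_addr k n.+1) (leq_addl (n + k) 2).
rewrite addSn; lia.
Qed.

(** Both components are bounded by the code, and only the right pair contributes to the bounded
    maximum. *)
Lemma pr_cunpair1 A : pr A -> pr (fun r => (cunpair (A r)).1).
Proof.
apply: (pr_app1 (f := fun x => (cunpair x).1)); apply: (pr_ext (F := fun r =>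
  \max_(i < (r 0).+1) \max_(j < (r 0).+1) (if cpair i j == r 0 then i : nat else 0))).
  move=> r; set m := r 0; apply/eqP; rewrite eqn_leq; apply/andP; split.
    apply/bigmax_leqP => i _; apply/bigmax_leqP => j _.
    by case: eqP => // e; have -> : cunpair m = (i : nat, j : nat) by rewrite -(cpairK i j) e.
  have [b1 b2] := cpair_bound (cunpair m).1 (cunpair m).2.
  rewrite cunpairK -ltnS in b1; rewrite cunpairK -ltnS in b2.
  apply: (bigmax_sup (Ordinal b1)) => //; apply: (bigmax_sup (Ordinal b2)) => //=.
  by rewrite cunpairK eqxx.
apply: (pr_max (g := fun i r => \max_(j < (r 0).+1) (if cpair i j == r 0 then i : nat else 0))).
  exact: pr_succ (pr_var 0).
apply: (pr_max (g := fun j r => if cpair (r 0) j == r 1 then r 0 else 0)).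
  exact: pr_succ (pr_var 1).
apply: pr_if (pr_var 1) (pr_const 0).
exact: pr_eqn (pr_cpair (pr_var 1) (pr_var 0)) (pr_var 2).
Qed.

Lemma pr_cunpair2 A : pr A -> pr (fun r => (cunpair (A r)).2).
Proof.
apply: (pr_app1 (f := fun x => (cunpair x).2)); apply: (pr_ext (F := fun r =>
  \max_(i < (r 0).+1) \max_(j < (r 0).+1) (if cpair i j == r 0 then j : nat else 0))).
  move=> r; set m := r 0; apply/eqP; rewrite eqn_leq; apply/andP; split.
    apply/bigmax_leqP => i _; apply/bigmax_leqP => j _.
    by case: eqP => // e; have -> : cunpair m = (i : nat, j : nat) by rewrite -(cpairK i j) e.
  have [b1 b2] := cpair_bound (cunpair m).1 (cunpair m).2.
  rewrite cunpairK -ltnS in b1; rewrite cunpairK -ltnS in b2.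
  apply: (bigmax_sup (Ordinal b1)) => //; apply: (bigmax_sup (Ordinal b2)) => //=.
  by rewrite cunpairK eqxx.
apply: (pr_max (g := fun i r => \max_(j < (r 0).+1) (if cpair i j == r 0 then j : nat else 0))).
  exact: pr_succ (pr_var 0).
apply: (pr_max (g := fun j r => if cpair (r 0) j == r 1 then j else 0)).
  exact: pr_succ (pr_var 1).
apply: pr_if (pr_var 0) (pr_const 0).
exact: pr_eqn (pr_cpair (pr_var 1) (pr_var 0)) (pr_var 2).
Qed.

(** Redefined whenever new functions become available to [pr_solve]. *)
Ltac pr_hook := fail.

Ltac pr_step := cbn beta iota; lazymatch goal with
  | |- forall _, _ => intro
  | |- pr (fun _ => ?n) => exact (pr_const n)
  | |- pr (fun r => r ?i) => exact (pr_var i)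
  | |- pr (fun r => (@?a r).+1) => apply (@pr_succ a)
  | |- pr (fun r => (@?a r).-1) => apply (@pr_pred a)
  | |- pr (fun r => (@?a r)./2) => apply (@pr_half a)
  | |- pr (fun r => @?a r + @?b r) => apply (@pr_add a b)
  | |- pr (fun r => @?a r - @?b r) => apply (@pr_sub a b)
  | |- pr (fun r => @?a r * @?b r) => apply (@pr_mul a b)
  | |- pr (fun r => @?a r ^ @?b r) => apply (@pr_exp a b)
  | |- pr (fun r => @?a r %/ @?b r) => apply (@pr_div a b)
  | |- pr (fun r => @?a r %% @?b r) => apply (@pr_mod a b)
  | |- pr (fun r => minn (@?a r) (@?b r)) => apply (@pr_min a b)
  | |- pr (fun r => cpair (@?a r) (@?b r)) => apply (@pr_cpair a b)
  | |- pr (fun r => (cunpair (@?a r)).1) => apply (@pr_cunpair1 a)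
  | |- pr (fun r => (cunpair (@?a r)).2) => apply (@pr_cunpair2 a)
  | |- pr (fun r => nat_of_bool (@?a r <= @?b r)) => apply (@pr_leq a b)
  | |- pr (fun r => nat_of_bool (@?a r && @?b r)) => apply (@pr_and a b)
  (* A bounded existential unfolds to a negation, which the next rule must not take apart. *)
  | |- pr (fun r => nat_of_bool (~~ FiniteQuant.quant0b _)) => idtac
  | |- pr (fun r => nat_of_bool (~~ @?a r)) => apply (@pr_neg a)
  | |- pr (fun r => nat_of_bool (odd (@?a r))) => apply (@pr_odd a)
  | |- pr (fun r => nat_of_bool (@?a r == @?b r)) => apply (@pr_eqn a b)
  | |- pr (fun r => find _ (iota 0 _)) => apply pr_find
  | |- pr (fun r => iter _ _ _) => apply pr_iter
  | |- pr (fun r => prec _ _ _) => apply pr_rec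
  | |- _ => first [assumption | match goal with H : pr _ |- _ => apply (pr_ren _ H) end | pr_hook |
     lazymatch goal with |- pr (fun r => nat_of_bool _) => fail | |- _ => apply pr_if end]
  end.

Ltac pr_solve := repeat progress pr_step.

(** * Arithmetic on codes of sequences *)

Definition consc (n m : nat) : nat := 2 ^ n * (2 * m).+1.

Lemma consc_code n s : consc n (CodeSeq.code s) = CodeSeq.code (n :: s).
Proof. by rewrite /consc /= mul2n. Qed.

Lemma consc_inj n m n' m' : consc n m = consc n' m' -> n = n' /\ m = m'.
Proof.
rewrite -(CodeSeq.decodeK m) -(CodeSeq.decodeK m') !consc_code.
by move/(can_inj CodeSeq.codeK) => [-> ->].
Qed.

(** n is the head of x iff x is rebuilt from n and its quotient by 2 ^ n.+1. The search may stop at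
    x because n < 2 ^ n; for x = 0 it yields 0. *)
Definition hdc (x : nat) : nat := find (fun n => x == consc n (x %/ 2 ^ n.+1)) (iota 0 x).

Definition tlc (x : nat) : nat := x %/ 2 ^ (hdc x).+1.

Lemma consc_div n m : consc n m %/ 2 ^ n.+1 = m.
Proof.
rewrite /consc expnS mulnC divnMr ?expn_gt0 // -addn1 mulnC divnMDl //.
by rewrite divn_small // addn0.
Qed.

Lemma hdc_consc n m : hdc (consc n m) = n.
Proof.
rewrite /hdc; set P := (fun _ => _); set x := consc n m.
have Pn : P n by rewrite /P consc_div.
have nx : n < x by rewrite /x /consc mulnS (leq_trans (ltn_expl n (ltnSn 1))) // leq_addr.
have hP : has P (iota 0 x) by apply/hasP; exists n => //; rewrite mem_iota.
have := nth_find 0 hP; rewrite nth_iota; last by rewrite has_find size_iota in hP.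
by rewrite add0n => /eqP /consc_inj [].
Qed.

Lemma tlc_consc n m : tlc (consc n m) = m.
Proof. by rewrite /tlc hdc_consc consc_div. Qed.

Lemma iter_tlc i s : iter i tlc (CodeSeq.code s) = CodeSeq.code (drop i s).
Proof.
elim: i s => [|i IH] s; first by rewrite drop0.
rewrite iterSr; case: s => [|n s]; first by rewrite -[tlc _]/(CodeSeq.code [::]) IH.
by rewrite -consc_code tlc_consc IH.
Qed.

Lemma size_code s : size s <= CodeSeq.code s.
Proof.
elim: s => //= n s IH; have := leq_pmull (CodeSeq.code s).*2.+1 (expn_gt0 2 n).
lia.
Qed.

Notation nthc x i := (nth 0 (CodeSeq.decode x) i).

Lemma pr_consc A B : pr A -> pr B -> pr (fun r => consc (A r) (B r)).
Proof. by move=> hA hB; rewrite /consc; pr_solve. Qed.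

Lemma pr_code_cons A (B : (nat -> nat) -> seq nat) : pr A -> pr (fun r => CodeSeq.code (B r)) ->
  pr (fun r => CodeSeq.code (A r :: B r)).
Proof.
move=> hA hB; apply: pr_ext (pr_consc hA hB) => r; exact: consc_code.
Qed.

Lemma pr_hdc A : pr A -> pr (fun r => hdc (A r)).
Proof. by apply: pr_app1; rewrite /hdc /consc; pr_solve. Qed.

Lemma pr_tlc A : pr A -> pr (fun r => tlc (A r)).
Proof. by apply: pr_app1; rewrite /tlc; apply: pr_div; [|apply: pr_exp; [|apply: pr_succ; apply: pr_hdc]]; pr_solve. Qed.

Ltac pr_hook ::= lazymatch goal with
  | |- pr (fun r => consc (@?a r) (@?b r)) => apply (@pr_consc a b)
  | |- pr (fun r => hdc (@?a r)) => apply (@pr_hdc a)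
  | |- pr (fun r => tlc (@?a r)) => apply (@pr_tlc a)
  end.

Lemma hdc_code s : hdc (CodeSeq.code s) = head 0 s.
Proof. by case: s => // n s; rewrite -consc_code hdc_consc. Qed.

Lemma pr_nthc A I : pr A -> pr I -> pr (fun r => nthc (A r) (I r)).
Proof.
move=> hA hI; apply: (pr_ext (F := fun r => hdc (iter (I r) tlc (A r)))).
  by move=> r; rewrite -{1}[A r]CodeSeq.decodeK iter_tlc hdc_code -nth0 nth_drop addn0.
by apply: pr_hdc; apply: (pr_iter (g := fun y r => tlc y)) => //; apply: pr_tlc; pr_solve.
Qed.

Lemma find_leq_iota k n : find (leq k) (iota 0 n) = minn k n.
Proof.
elim: n => [|n IH]; first by rewrite minn0.
rewrite -[n.+1 in LHS]addn1 iotaD find_cat has_find size_iota IH add0n /=.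
by case: ltnP => h; [|case: leqP => h' /=]; lia.
Qed.

(** The length is the first k at which the k-th tail is empty, and the code bounds it. *)
Lemma pr_size A : pr A -> pr (fun r => size (CodeSeq.decode (A r))).
Proof.
move=> hA; apply: (pr_ext (F := fun r => find (fun k => iter k tlc (A r) == 0) (iota 0 (A r)))).
  move=> r; set x := A r; set s := CodeSeq.decode x.
  have xs : x = CodeSeq.code s by rewrite CodeSeq.decodeK.
  have sx : size s <= x by rewrite xs size_code.
  have E k : (iter k tlc x == 0) = (size s <= k).
    rewrite xs iter_tlc; case: (leqP (size s) k) => h; first by rewrite drop_oversize.
    by rewrite (drop_nth 0 h) /= muln_eq0 expn_eq0.
  by rewrite (eq_find E) find_leq_iota; apply/minn_idPl.
pr_solve.
Qed.

(** Codes grow at the head, so the sequence is built from its last entry backwards. *)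
Lemma pr_mkseq N (g : nat -> (nat -> nat) -> nat) :
  pr N -> pr (fun r => g (r 0) (fun i => r i.+1)) ->
  pr (fun r => CodeSeq.code (mkseq (fun i => g i r) (N r))).
Proof.
move=> hN hg; apply: (pr_ext (F := fun r =>
  prec 0 (fun k y => consc (g (N r - k.+1) r) y) (N r))).
  move=> r; rewrite /mkseq.
  suff H k : k <= N r -> prec 0 (fun k y => consc (g (N r - k.+1) r) y) k =
      CodeSeq.code [seq g i r | i <- iota (N r - k) k] by rewrite H // subnn.
  elim: k => // k IH kN; rewrite [LHS]/= IH 1?ltnW // consc_code /=.
  by have -> : (N r - k.+1).+1 = N r - k by lia.
apply: (pr_rec (g := fun k y r => consc (g (N r - k.+1) r) y)) => //; first by pr_solve.
apply: pr_consc; last by pr_solve.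
pose h r i := g (N (fun k => r k.+2) - (r 1).+1) i.
apply: (pr_let (A := fun r => N (fun k => r k.+2) - (r 1).+1)
   (g := fun x r => g x (fun i => r i.+2))).
  by pr_solve; exact: (pr_ren (fun i => i.+2) hN).
exact: (pr_ren (fun i => if i is i'.+1 then i'.+3 else 0) hg).
Qed.

(** * Tapes, locality of runs and halting times *)

Lemma tape_ofP p c : tape_of p c = 2 <-> exists n, c = \sum_(i < n.+1) p i + n.
Proof.
rewrite /tape_of; case: existsP => [[n /eqP ->]|H].
  by split=> // _; exists n.
split=> // -[n e]; case: H; have hn : n < c.+1 by rewrite e ltnS leq_addl.
by exists (Ordinal hn); rewrite /= -e.
Qed.

Lemma tape_of12 p c : tape_of p c \in [:: 1; 2].
Proof. by rewrite /tape_of; case: ifP. Qed.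

(** The block of entry i starts at cell i or later. *)
Lemma tape_of_eq p p' n : (forall i, i <= n -> p i = p' i) ->
  forall c, c <= n -> tape_of p c = tape_of p' c.
Proof.
move=> h c cn; rewrite /tape_of; congr (if _ then _ else _).
apply: eq_existsb => k; congr (_ == _ + _); apply: eq_bigr => i _.
by apply: h; have := ltn_ord i; have := ltn_ord k; lia.
Qed.

Lemma move_le d h : move d h <= h.+1.
Proof. by case: d => /=; lia. Qed.

Lemma nextc_head M inp x :
  [/\ in_head (nextc M inp x) <= (in_head x).+1,
      work_head (nextc M inp x) <= (work_head x).+1 &
      out_head (nextc M inp x) <= (out_head x).+1].
Proof.
rewrite /nextc /step; case: ohead => [i|] /=; split; rewrite ?leqnSn //; exact: move_le.
Qed.

Lemma runS M p t : run M p t.+1 = nextc M (tape_of p) (run M p t).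
Proof. by []. Qed.

Lemma run_head M p t :
  [/\ in_head (run M p t) <= t, work_head (run M p t) <= t & out_head (run M p t) <= t].
Proof.
elim: t => // t [h1 h2 h3]; rewrite runS.
by have [g1 g2 g3] := nextc_head M (tape_of p) (run M p t); split; lia.
Qed.

Lemma matches_eq inp inp' x : inp (in_head x) = inp' (in_head x) ->
  matches inp x = matches inp' x.
Proof. by move=> h; apply/funext => i; rewrite /matches h. Qed.

(** The use principle: during t steps the input head inspects only cells below t. *)
Lemma run_eq M p p' t : (forall i, i < t -> p i = p' i) -> run M p t = run M p' t.
Proof.
elim: t => // t IH h; rewrite !runS -IH => [|i hi]; last by apply: h; lia.
rewrite /nextc /step (@matches_eq (tape_of p) (tape_of p')) //.
by apply: (@tape_of_eq _ _ t) => //; have [] := run_head M p t.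
Qed.

Definition halted (e : nat) (p : baire) (t : nat) : bool :=
  ~~ has (matches (tape_of p) (run (tm e) p t)) (tm e).

Lemma halted_eq e p p' t : (forall i, i <= t -> p i = p' i) -> halted e p t = halted e p' t.
Proof.
move=> h; rewrite /halted (@run_eq _ p p'); last by move=> i hi; apply: h; lia.
rewrite (@matches_eq (tape_of p) (tape_of p')) //.
by apply: (@tape_of_eq _ _ t) => //; have [] := run_head (tm e) p' t.
Qed.

Lemma ohead_filter (T : Type) (x0 : T) (P : pred T) s :
  ohead [seq x <- s | P x] = if has P s then Some (nth x0 s (find P s)) else None.
Proof. by elim: s => //= x s IH; case: (P x). Qed.

Lemma halted_step e p t : halted e p t <-> step (tm e) (tape_of p) (run (tm e) p t) = None.
Proof.
rewrite /halted /step (ohead_filter (Instr 0 0 0 0 0 0 0 Stay Stay Stay)).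
by case: has.
Qed.

Lemma halted_mono e p t t' : t <= t' -> halted e p t -> halted e p t'.
Proof.
move=> /subnK <-; elim: (t' - t) => // k IH /IH h.
move/halted_step: (h) => hs; rewrite /halted addSn runS /nextc hs /=.
exact: h.
Qed.

Lemma jumpE p e t0 : (forall t, t0 <= t -> halted e p t = halted e p t0) ->
  jump p e = halted e p t0.
Proof.
move=> h; rewrite /jump; congr nat_of_bool; apply/asboolP/idP => [[t ht]|ht].
  rewrite -(h (maxn t t0)) ?leq_maxr //.
  by apply: (@halted_mono _ _ t); [exact: leq_maxl|exact/halted_step].
by exists t0; apply/halted_step.
Qed.

Lemma halted_stable e p : exists t0, forall t, t0 <= t -> halted e p t = halted e p t0.
Proof.
case: (pselect (exists t, halted e p t)) => [[t0 h]|h].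
  by exists t0 => t /halted_mono ->.
have F t : halted e p t = false by apply/negbTE/negP => H; apply: h; exists t.
by exists 0 => t _; rewrite !F.
Qed.

Lemma jump_halted e p : exists t0, forall t, t0 <= t -> jump p e = halted e p t.
Proof.
have [t0 h] := halted_stable e p; exists t0 => t ht.
by rewrite (h t ht); apply: jumpE.
Qed.

(** * Simulation of machines by computable functions *)

(* The tapes are cut off at n; in n steps the heads stay to the left of that. *)
Definition ncode (n : nat) (x : config) : nat :=
  CodeSeq.code [:: state x; in_head x; CodeSeq.code (mkseq (work x) n); work_head x;
                   CodeSeq.code (mkseq (out x) n); out_head x].

(** Here and below the semantics is mirrored on codes: [e] numbers the machine, [a] is the input
    symbol read and [y] codes a configuration. *)
Definition umatch (e a y j : nat) : bool :=
  (nthc (nthc e j) 0 == nthc y 0) && ((nthc (nthc e j) 1 == a) &&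
  ((nthc (nthc e j) 2 == nthc (nthc y 2) (nthc y 3)) &&
   (nthc (nthc e j) 3 == nthc (nthc y 4) (nthc y 5)))).

Definition uidx (e a y : nat) : nat := find (fun j => umatch e a y j) (iota 0 (size (CodeSeq.decode e))).

Definition umove (d h : nat) : nat := if d == 0 then h else if d == 1 then h.-1 else h.+1.

Definition uwrite (n w h b : nat) : nat :=
  CodeSeq.code (mkseq (fun c => if c == h then b else nthc w c) n).

Definition uexec (i n y : nat) : nat :=
  CodeSeq.code [:: nthc i 4; umove (nthc i 7) (nthc y 1);
    uwrite n (nthc y 2) (nthc y 3) (nthc i 5); umove (nthc i 8) (nthc y 3);
    uwrite n (nthc y 4) (nthc y 5) (nthc i 6); umove (nthc i 9) (nthc y 5)].

Definition ustep (e a n y : nat) : nat :=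
  if uidx e a y < size (CodeSeq.decode e) then uexec (nthc e (uidx e a y)) n y else y.

Section Ustep.
Variables (e n : nat) (inp : nat -> nat) (x : config).
Hypotheses (hw : work_head x < n) (ho : out_head x < n).

Lemma umatchP j : j < size (CodeSeq.decode e) ->
  umatch e (inp (in_head x)) (ncode n x) j =
  matches inp x (instr_of_seq (CodeSeq.decode (nthc e j))).
Proof. by move=> _; rewrite /umatch /ncode !CodeSeq.codeK /= !nth_mkseq // /matches. Qed.

Lemma uidxP : uidx e (inp (in_head x)) (ncode n x) = find (matches inp x) (tm e).
Proof.
rewrite /uidx /tm find_map -[in RHS](mkseq_nth 0 (CodeSeq.decode e)) /mkseq find_map.
apply: eq_in_find => j; rewrite mem_iota add0n => /= hj; exact: umatchP.
Qed.

Lemma umoveE d h : umove d h = move (dir_of_nat d) h.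
Proof. by case: d => [|[|d]]. Qed.

Lemma uwriteE u h b : h < n ->
  uwrite n (CodeSeq.code (mkseq u n)) h b = CodeSeq.code (mkseq (write u h b) n).
Proof.
move=> hn; rewrite /uwrite; congr CodeSeq.code; apply/eq_in_map => c.
by rewrite mem_iota add0n => /= hc; rewrite CodeSeq.codeK nth_mkseq.
Qed.

Lemma ustepP : ustep e (inp (in_head x)) n (ncode n x) = ncode n (nextc (tm e) inp x).
Proof.
rewrite /ustep uidxP /nextc /step (ohead_filter (instr_of_seq [::])) has_find size_map.
case: ifP => // h; rewrite (nth_map 0) //; set i := nth 0 _ _.
rewrite /uexec /ncode !CodeSeq.codeK /= !umoveE !uwriteE //.
Qed.

End Ustep.

(** The input is the sequence coded by [l], continued by zeros; t.+1 cells of each tape suffice for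
    t steps. *)
Definition urun (e l t : nat) : nat :=
  iter t (fun y => ustep e (tape_of (fun i => nthc l i) (nthc y 1)) t.+1 y)
    (ncode t.+1 init).

Lemma urunP e l t : urun e l t = ncode t.+1 (run (tm e) (fun i => nthc l i) t).
Proof.
rewrite /urun; suff H k : k <= t ->
  iter k (fun y => ustep e (tape_of (fun i => nthc l i) (nthc y 1)) t.+1 y) (ncode t.+1 init)
  = ncode t.+1 (run (tm e) (fun i => nthc l i) k) by apply: H.
elim: k => // k IH hk; rewrite iterS IH 1?ltnW //.
have [_ h1 h2] := run_head (tm e) (fun i => nthc l i) k.
rewrite runS -(@ustepP e t.+1) //; try lia.
by rewrite /ncode !CodeSeq.codeK.
Qed.

Ltac pr_hook ::= lazymatch goal with
  | |- pr (fun r => consc (@?a r) (@?b r)) => apply (@pr_consc a b)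
  | |- pr (fun r => nthc (@?a r) (@?b r)) => apply (@pr_nthc a b)
  | |- pr (fun r => size (CodeSeq.decode (@?a r))) => apply (@pr_size a)
  | |- pr (fun r => CodeSeq.code (@?a r :: @?b r)) => apply (@pr_code_cons a b)
  | |- pr (fun r => CodeSeq.code (mkseq _ _)) => apply pr_mkseq
  end.

Lemma pr_tape_of : pr (fun r => tape_of (fun i => nthc (r 0) i) (r 1)).
Proof.
rewrite /tape_of; apply: pr_if; [|pr_solve..].
apply: (pr_ex (g := fun n r => r 1 == \sum_(i < n.+1) nthc (r 0) i + n)); pr_solve.
by apply: (pr_sum (g := fun i r => nthc (r 1) i)); pr_solve.
Qed.

Lemma pr_urun E L T : pr E -> pr L -> pr T -> pr (fun r => urun (E r) (L r) (T r)).
Proof.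
apply: pr_app3; rewrite /urun.
have htape A B : pr A -> pr B -> pr (fun r => tape_of (fun i => nthc (A r) i) (B r)).
  exact: (pr_app2 (f := fun l c => tape_of (fun i => nthc l i) c) pr_tape_of).
have hidx A B C : pr A -> pr B -> pr C -> pr (fun r => uidx (A r) (B r) (C r)).
  by apply: pr_app3; rewrite /uidx /umatch; pr_solve.
have hmove A B : pr A -> pr B -> pr (fun r => umove (A r) (B r)).
  by apply: pr_app2; rewrite /umove; pr_solve.
have hwrite A B C D : pr A -> pr B -> pr C -> pr D -> pr (fun r => uwrite (A r) (B r) (C r) (D r)).
  by move=> hA hB hC hD; rewrite /uwrite; pr_solve.
have hexec A B C : pr A -> pr B -> pr C -> pr (fun r => uexec (A r) (B r) (C r)).
  apply: pr_app3; rewrite /uexec.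
  by repeat apply: pr_code_cons; do ?[apply: hmove|apply: hwrite]; pr_solve.
apply: (pr_iter (g := fun y r =>
  ustep (r 0) (tape_of (fun i => nthc (r 1) i) (nthc y 1)) (r 2).+1 y)); first by pr_solve.
  by rewrite /ncode; pr_solve; exact: (pr_const 0).
have ht : pr (fun r => tape_of (fun i => nthc (r 2) i) (nthc (r 0) 1)) by apply: htape; pr_solve.
have hi : pr (fun r => uidx (r 1) (tape_of (fun i => nthc (r 2) i) (nthc (r 0) 1)) (r 0)).
  by apply: hidx; pr_solve.
rewrite /ustep; cbn beta; apply pr_if; [|apply: hexec|]; pr_solve.
Qed.

Definition uout (e l t c : nat) : nat := nthc (nthc (urun e l t) 4) c.

Lemma uoutP e l t c : c <= t ->
  uout e l t c = out (run (tm e) (fun i => nthc l i) t) c.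
Proof. by move=> h; rewrite /uout urunP /ncode !CodeSeq.codeK nth_mkseq. Qed.

(** The machine has halted iff the search for a matching instruction runs past the end of the
    table. *)
Lemma pr_halted E L T : pr E -> pr L -> pr T ->
  pr (fun r => halted (E r) (fun i => nthc (L r) i) (T r)).
Proof.
apply: (@pr_app3 (fun e l t => halted e (fun i => nthc l i) t)).
apply: (pr_ext (F := fun r => uidx (r 0)
  (tape_of (fun i => nthc (r 1) i) (nthc (urun (r 0) (r 1) (r 2)) 1))
  (urun (r 0) (r 1) (r 2)) == size (CodeSeq.decode (r 0)))).
  move=> r; rewrite /halted urunP; set x := run _ _ _.
  have [_ h1 h2] := run_head (tm (r 0)) (fun i => nthc (r 1) i) (r 2).
  have -> : nthc (ncode (r 2).+1 x) 1 = in_head x by rewrite /ncode CodeSeq.codeK.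
  rewrite uidxP // has_find /tm size_map -leqNgt eqn_leq -[X in _ && X]/(_ <= _).
  congr nat_of_bool; rewrite andb_idl // => _.
  by rewrite -(size_map (fun a => instr_of_seq (CodeSeq.decode a))) find_size.
have hy := pr_urun (pr_var 0) (pr_var 1) (pr_var 2).
have ht : pr (fun r => tape_of (fun i => nthc (r 1) i) (nthc (urun (r 0) (r 1) (r 2)) 1)).
  apply: (pr_app2 (f := fun l c => tape_of (fun i => nthc l i) c) pr_tape_of); pr_solve.
have hidx A B C : pr A -> pr B -> pr C -> pr (fun r => uidx (A r) (B r) (C r)).
  by apply: pr_app3; rewrite /uidx /umatch; pr_solve.
by apply: pr_eqn; [apply: hidx|]; pr_solve.
Qed.

(** * Machines reading and writing streams *)

(** The first cell of the block of entry n. *)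
Definition pos (p : baire) (n : nat) : nat := \sum_(i < n) p i + n.

Lemma posS p n : pos p n.+1 = (pos p n + p n).+1.
Proof. by rewrite /pos big_ord_recr /=; lia. Qed.

Lemma pos_lt p m n : m < n -> pos p m < pos p n.
Proof.
elim: n => // n IH; rewrite ltnS leq_eqVlt => /orP[/eqP ->|/IH h]; rewrite posS; lia.
Qed.

Lemma pos_ge p n : n <= pos p n.
Proof. by rewrite leq_addl. Qed.

Lemma tape_of_pos2 p n : tape_of p (pos p n + p n) = 2.
Proof. by apply/tape_ofP; exists n; rewrite /pos big_ord_recr /=; lia. Qed.

(** A 2 in this cell would put some [pos p n'.+1] strictly between [pos p n] and [pos p n.+1]. *)
Lemma tape_of_pos1 p n k : k < p n -> tape_of p (pos p n + k) = 1.
Proof.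
move=> kp; have := tape_of12 p (pos p n + k); rewrite !inE => /orP[/eqP //|/eqP].
move/tape_ofP => [n' e].
have e' : pos p n'.+1 = (pos p n + k).+1 by rewrite e /pos; lia.
case: (ltngtP n' n) => h.
- by have := @pos_lt p n'.+1 n.+1 h; move: (@pos_lt p n' n h); rewrite posS in e' *;
  have := leq_eqVlt n'.+1 n; rewrite h => /esym /orP[/eqP hn|/(@pos_lt p)];
  [rewrite -hn posS in e' *|rewrite posS]; lia.
- by have := @pos_lt p n.+1 n'.+1 h; rewrite e' posS; lia.
- by rewrite h posS in e'; lia.
Qed.

Definition word (n : nat) : seq bool := rcons (nseq n false) true.

Lemma size_word n : size (word n) = n.+1.
Proof. by rewrite size_rcons size_nseq. Qed.

Definition words (r : baire) (n : nat) : seq bool := flatten (mkseq (fun i => word (r i)) n).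

Lemma wordsS r n : words r n.+1 = words r n ++ word (r n).
Proof. by rewrite /words /mkseq -[n.+1]addn1 iotaD map_cat flatten_cat /= cats0. Qed.

Lemma size_words r n : size (words r n) = pos r n.
Proof.
elim: n => [|n IH]; first by rewrite /pos big_ord0.
by rewrite wordsS size_cat IH size_word posS addnS.
Qed.

Lemma otape_words r n c : c < pos r n -> otape (words r n) c = tape_of r c.
Proof.
elim: n => [|n IH]; first by rewrite /pos big_ord0.
rewrite wordsS /otape map_cat nth_cat size_map size_words => h.
case: ltnP => h'; first by rewrite -IH.
rewrite -(subnKC h') addKn in h *; move: (c - _) h => k h.
rewrite posS ltnS leq_add2l in h.
rewrite (nth_map false) ?size_word // nth_rcons size_nseq.
case: ltngtP h => // [h|h] _; first by rewrite nth_nseq h tape_of_pos1.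
by rewrite h tape_of_pos2.
Qed.

(** The latest entry comes first, so that recording one more entry is a single [consc]. *)
Definition hist (x : baire) (n : nat) : nat := CodeSeq.code (rev (mkseq x n)).

Lemma histS x n : hist x n.+1 = consc (x n) (hist x n).
Proof. by rewrite consc_code /hist mkseqS rev_rcons. Qed.

Lemma nth_hist x n i : i < n -> nthc (hist x n) i = x (n.-1 - i).
Proof.
move=> h; rewrite /hist CodeSeq.codeK nth_rev ?size_mkseq // nth_mkseq; last by lia.
by congr x; lia.
Qed.

(* Only the entries of odd index are used, so that the stages are twice as slow
   as the input. *)
Definition odds (p : baire) : baire := fun i => p i.*2.+1.

Definition readreg (j : nat) : cmd :=
  Seq (clear j) (Seq (While In1 (Seq InR (Inc j))) InR).

Lemma ev_readreg p b j s n : ipos s = pos p n ->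
  evals (tape_of p) b (readreg j) s (St (regs (upd s j (p n))) (pos p n.+1) (ow s)).
Proof.
move=> hs; apply: ev_seq; first exact: ev_clear.
suff H k : k <= p n -> evals (tape_of p) b (While In1 (Seq InR (Inc j)))
   (St (regs (upd s j (p n - k))) (pos p n + (p n - k)) (ow s))
   (St (regs (upd s j (p n))) (pos p n + p n) (ow s)).
  have := H _ (leqnn _); rewrite subnn addn0 -{1}hs posS => h.
  by apply: ev_seq h _; exact: ev_inr.
elim: k => [|k IH] hk.
  by rewrite subn0; apply: ev_wf; rewrite /= tape_of_pos2.
apply: ev_wt; first by rewrite /= tape_of_pos1 //; lia.
  by apply: ev_seq; [exact: ev_inr|exact: ev_inc].
have -> : upd (St (regs (upd s j (p n - k.+1))) (pos p n + (p n - k.+1)).+1 (ow s)) j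
  (regs (upd s j (p n - k.+1)) j).+1 =
  St (regs (upd s j (p n - k))) (pos p n + (p n - k)) (ow s).
  apply: st_eq => //=; last by lia.
  by move=> i; rewrite eqxx; case: eqP => // _; lia.
by apply: IH; apply: ltnW.
Qed.

Section Stream.
Variables (ob : bool) (V D : nat -> nat -> nat).
Hypotheses (hV : pr (fun r => V (r 0) (r 1))) (hD : pr (fun r => D (r 0) (r 1)))
  (hob : ob -> forall i a, D i a = 0).

(** Pass i writes one block with the value of [V], after erasing all earlier output if [D] is
    nonzero. *)
Definition stream_word (p : baire) (i : nat) : seq bool :=
  nat_rect (fun=> seq bool) [::] (fun i w =>
    (if D i (hist (odds p) i.+1) == 0 then w else [::]) ++
     word (V i (hist (odds p) i.+1))) i.

(** Register 4 tells [reset] how many cells to erase; the registers 3 and 5 are scratch. *)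
Definition sinv (p : baire) (i : nat) (w : seq bool) (s : st) : Prop :=
  [/\ regs s 0 = 1, regs s 1 = i, regs s 2 = hist (odds p) i, regs s 4 = size w
    & ipos s = pos p i.*2 /\ ow s = w].

Definition emit : cmd :=
  Seq (While (Reg 5) (Seq (Dec 5) (Seq (Put false) (Inc 4)))) (Seq (Put true) (Inc 4)).

Definition reset : cmd :=
  While (Reg 5) (Seq (clear 5) (While (Reg 4) (Seq (Dec 4) Back))).

Lemma ev_emit inp b s : exists s', evals inp b emit s s' /\
  [/\ forall j, j < 4 -> regs s' j = regs s j, regs s' 4 = regs s 4 + (regs s 5).+1,
      ipos s' = ipos s & ow s' = ow s ++ word (regs s 5)].
Proof.
have [|n s1||s1 [e1 [_ r0 r1 r2 [i1 o1]]]] := @ev_while_ind inp b 5 (Seq (Dec 5) (Seq (Put false) (Inc 4)))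
  (fun n s1 => [/\ n <= regs s 5, regs s1 5 = n, forall j, j < 4 -> regs s1 j = regs s j,
     regs s1 4 = regs s 4 + (regs s 5 - n) & ipos s1 = ipos s /\
     ow s1 = ow s ++ nseq (regs s 5 - n) false]) (regs s 5) s.
- by move=> n s1 [].
- move=> [hn r0 r1 r2 [i1 o1]]; eexists; split.
    by apply: ev_seq; [exact: ev_dec|apply: ev_seq; [exact: ev_put|exact: ev_inc]].
  split=> /=; [by lia|by rewrite r0| |by rewrite r2; lia|].
    by move=> j hj; rewrite -r1 //; do 2 (case: eqP => [?|_]; first by lia).
  split=> //; rewrite o1 -cats1 -catA; congr cat.
  have -> : regs s 5 - n = (regs s 5 - n.+1) + 1 by lia.
  by rewrite nseqD.
- by split; rewrite ?subnn ?addn0 ?cats0.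
eexists; split; first by apply: ev_seq e1 _; apply: ev_seq; [exact: ev_put|exact: ev_inc].
split=> //=.
- by move=> j hj; rewrite -r1 //; case: eqP => // ?; lia.
- by rewrite r2; lia.
- by rewrite o1 subn0 /word rcons_cat.
Qed.

Lemma ev_reset inp s : regs s 4 = size (ow s) ->
  exists s', evals inp (regs s 5 == 0) reset s s' /\
  [/\ forall j, j < 4 -> regs s' j = regs s j, regs s' 4 = size (ow s'),
      ipos s' = ipos s & ow s' = if regs s 5 == 0 then ow s else [::]].
Proof.
move=> h; case: eqP => [h5|/eqP h5].
  by exists s; split=> //; apply: ev_wf; rewrite /= h5.
have [|n s1||s1 [e1 [r0 r1 r2 i1 o1]]] := @ev_while_ind inp false 4 (Seq (Dec 4) Back)
  (fun n s1 => [/\ regs s1 4 = n, forall j, j < 4 -> regs s1 j = regs s j, regs s1 5 = 0,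
     ipos s1 = ipos s & size (ow s1) = n]) (regs s 4) (upd s 5 0).
- by move=> n s1 [].
- move=> [r0 r1 r2 i1 o1]; eexists; split.
    by apply: ev_seq; [exact: ev_dec|exact: ev_back].
  split=> //=; [by rewrite r0| |by rewrite size_take o1 ltnSn].
  by move=> j hj; rewrite -r1 //; case: eqP => // ?; lia.
- by split=> //= j hj; case: eqP => // ?; lia.
exists s1; split.
  apply: ev_wt; first by rewrite /= lt0n.
    by apply: ev_seq; [exact: ev_clear|exact: e1].
  by apply: ev_wf; rewrite /= r2.
by split=> //; [rewrite r0 o1|apply/eqP; rewrite -size_eq0 o1].
Qed.

Lemma stream_body : exists body m, wf_cmd ob m body /\ forall p i w s, sinv p i w s ->
  exists s', evals (tape_of p) (D i (hist (odds p) i.+1) == 0) body s s' /\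
    sinv p i.+1 ((if D i (hist (odds p) i.+1) == 0 then w else [::]) ++
                 word (V i (hist (odds p) i.+1))) s'.
Proof.
have [|cA [mA [wA hA]]] := pr_consc (pr_var 0) (pr_var 1) (r := fun i => if i is 0 then 3 else 2) (d := 5).
  by case.
have rr i : 0 < (if i is 0 then 1 else 2) < 5 by case: i.
have [cV [mV [wV hV']]] := hV rr.
have [cD [mD [wD hD']]] := hD rr.
(* A one-way program may not even contain [Back]; there [D] vanishes by [hob], so the test is
   dropped. *)
pose r2 := if ob then Skip else Seq cD reset.
(* Two reads into the same register: only the entry of odd index survives. *)
exists (Seq (readreg 3) (Seq (readreg 3) (Seq cA (Seq (moveto 5 2) (Seq r2
  (Seq cV (Seq emit (Inc 1)))))))), (maxn mA (maxn mV (maxn mD 5))); split.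
  rewrite /=; repeat (apply/andP; split); try lia.
  - by apply: (wf_mono _ _ wA) => //; lia.
  - rewrite /r2; case: ifP => // eob; rewrite /=.
    by repeat (apply/andP; split); try lia; apply: (wf_mono _ _ wD) => //; lia.
  - by apply: (wf_mono _ _ wV) => //; lia.
move=> p i w s [s0 s1 s2 s4 [ip so]].
set a := hist _ i.+1; set b := D i a == 0.
have e1 := @ev_readreg p b 3 s _ ip; set t1 := St _ _ _ in e1.
have e2 := @ev_readreg p b 3 t1 i.*2.+1 erefl; set t2 := St _ _ _ in e2.
have [t3 [e3 r3 [a3 i3 o3]]] := hA (tape_of p) b t2.
have e4 := @ev_moveto (tape_of p) b 5 2 t3 isT; set t4 := upd _ _ _ in e4.
have q5 : regs t3 5 = a by rewrite r3 /= s2 /a histS.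
have [q0 q1 q2 q4] : [/\ regs t4 0 = 1, regs t4 1 = i, regs t4 2 = a & regs t4 4 = size w].
  by split; rewrite /= ?q5 ?a3 //=.
have [qi qo] : ipos t4 = pos p i.+1.*2 /\ ow t4 = w by rewrite /= i3 o3.
have [t5 [e5 [z5 l5 i5 o5]]] : exists s', evals (tape_of p) b r2 t4 s' /\
  [/\ forall j, j < 4 -> regs s' j = regs t4 j, regs s' 4 = size (ow s'),
      ipos s' = ipos t4 & ow s' = if b then w else [::]].
  rewrite /r2; case: (boolP ob) => hb.
    exists t4; split; first exact: ev_skip.
    by rewrite /b hob // eqxx; split=> //; rewrite q4 qo.
  have [u [eu ru [au iu ou]]] := hD' (tape_of p) b t4.
  rewrite q1 q2 in ru.
  have [|u' [eu' [zu lu iu' ou']]] := @ev_reset (tape_of p) u.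
    by rewrite au // q4 ou qo.
  exists u'; split; first by apply: ev_seq eu _; rewrite ru in eu'.
  split=> //; first by move=> j hj; rewrite zu // au //; apply: ltnW.
    by rewrite iu' iu.
  by rewrite ou' ru ou qo.
have [t6 [e6 r6 [a6 i6 o6]]] := hV' (tape_of p) b t5.
have [t7 [e7 [z7 l7 i7 o7]]] := @ev_emit (tape_of p) b t6.
rewrite !z5 // q1 q2 in r6.
eexists; split.
  apply: ev_seq e1 _; apply: ev_seq e2 _; apply: ev_seq e3 _; apply: ev_seq e4 _.
  apply: ev_seq e5 _; apply: ev_seq e6 _; apply: ev_seq e7 _; exact: ev_inc.
split; rewrite /=.
- by rewrite z7 // a6 // z5.
- by rewrite z7 // a6 // z5 // q1.
- by rewrite z7 // a6 // z5.
- by rewrite l7 a6 // r6 l5 o5 size_cat size_word.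
- by rewrite i7 i6 i5 qi o7 o6 o5 r6.
Qed.

Theorem stream_machine : exists M, (ob -> one_way M) /\ forall p,
  exists t : nat -> nat, forall i,
    [/\ t i < t i.+1, out (run M p (t i)) = otape (stream_word p i) &
        D i (hist (odds p) i.+1) = 0 -> forall k, t i <= k < t i.+1 ->
          keeps (run M p k) (run M p k.+1)].
Proof.
have [body [m [w h]]] := stream_body.
exists (loop_machine m body); split; first exact: one_way_loop w.
move=> p; have nx i s : exists s', sinv p i (stream_word p i) s ->
    evals (tape_of p) (D i (hist (odds p) i.+1) == 0) body s s' /\
    sinv p i.+1 (stream_word p i.+1) s'.
  case: (pselect (sinv p i (stream_word p i) s)) => [/h [s' H]|H]; first by exists s'.
  by exists s.
have {}nx i : exists f : st -> st, forall s, sinv p i (stream_word p i) s ->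
    evals (tape_of p) (D i (hist (odds p) i.+1) == 0) body s (f s) /\
    sinv p i.+1 (stream_word p i.+1) (f s).
  by have [f hf] := choice (nx i); exists f.
have [f hf] := choice nx.
pose S i := nat_rect (fun=> st) st0 f i.
have hS i : sinv p i (stream_word p i) (S i).
  elim: i => [|i IH]; last by have [] := hf i _ IH.
  by split=> //; rewrite /pos big_ord0.
have [t ht] := loop_run w (p := p) (S := S) (b := fun i => D i (hist (odds p) i.+1) == 0)
  (tape_of12 p) erefl (fun i => (hf i _ (hS i)).1).
exists t => i; have [h1 h2 h3] := ht i; split=> //.
  by rewrite h2; have [_ _ _ _ [_ ->]] := hS i.
by move=> /eqP; apply: h3.
Qed.

End Stream.

(** * Stabilisation of the output *)

Section Corollaries.
Variables (M : machine) (p : baire) (t : nat -> nat) (n0 : nat).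
Hypothesis tlt : forall i, t i < t i.+1.
Hypothesis tkeeps : forall i, n0 <= i -> forall k, t i <= k < t i.+1 ->
  keeps (run M p k) (run M p k.+1).

Lemma keeps_from k : t n0 <= k -> keeps (run M p k) (run M p k.+1).
Proof.
move=> hk; suff [i /andP[hi hki]] : exists i, (n0 <= i) && (t i <= k < t i.+1).
  exact: tkeeps hki.
elim: k hk => [|k IH] hk; first by exists n0; rewrite leqnn hk; have := tlt n0; lia.
move: hk; rewrite leq_eqVlt => /orP[/eqP <-|/IH [i /and3P[h1 h2 h3]]].
  by exists n0; rewrite leqnn /= leqnn tlt.
case: (ltnP k.+1 (t i.+1)) => h; first by exists i; rewrite h1 h andbT /= ltnW.
by exists i.+1; rewrite h (leq_trans h1) //=; have := tlt i.+1; lia.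
Qed.

Lemma keeps_out k k' c : t n0 <= k -> k <= k' -> out (run M p k) c <> 0 ->
  out (run M p k') c = out (run M p k) c.
Proof.
move=> hk /subnK <- h; elim: (k' - k) => // d IH.
by rewrite addSn keeps_from ?IH //; apply: leq_trans hk (leq_addl _ _).
Qed.

Lemma finitely_many_revisions_from : finitely_many_revisions M p.
Proof. by exists (t n0) => k c hk; apply: keeps_from. Qed.

(** From pass n0 on a filled cell is final, and cell c is filled once c.+1 blocks have been
    written. *)
Lemma outputs_from r :
  (forall j, exists2 m, j <= m & out (run M p (t (n0 + j))) = otape (words r m)) ->
  outputs M p r.
Proof.
move=> h c; exists (t (n0 + c.+1)) => k hk.
have tm i : t n0 <= t (n0 + i).
  by elim: i => [|i IH]; rewrite ?addn0 ?addnS // (leq_trans IH) // ltnW.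
have e : out (run M p (t (n0 + c.+1))) c = tape_of r c.
  have [m jm ->] := h c.+1.
  by rewrite otape_words //; apply: leq_trans jm (pos_ge _ _).
rewrite (keeps_out (tm _) hk) e //.
by have := tape_of12 r c; rewrite !inE => /orP[] /eqP ->.
Qed.

End Corollaries.

Lemma stream_one_way V : pr (fun r => V (r 0) (r 1)) ->
  exists M, one_way M /\ forall p, outputs M p (fun i => V i (hist (odds p) i.+1)).
Proof.
move=> hV; have [//|M [h1 h2]] := @stream_machine true V (fun _ _ => 0) hV (pr_const 0).
exists M; split; first exact: h1.
move=> p; have [t ht] := h2 p.
apply: (@outputs_from M p t 0).
- by move=> i; have [] := ht i.
- by move=> i _; have [_ _] := ht i; apply.
move=> j; exists j => //; rewrite add0n; have [_ -> _] := ht j; congr otape.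
by elim: j => [//|j IH]; rewrite wordsS -IH.
Qed.

(** T is the last pass that erases, or 0, where there is nothing to erase; the final output is what
    is written from pass T on. *)
Lemma stream_mind_change V D : pr (fun r => V (r 0) (r 1)) -> pr (fun r => D (r 0) (r 1)) ->
  exists M, forall p T, (T = 0 \/ D T (hist (odds p) T.+1) <> 0) ->
    (forall i, T < i -> D i (hist (odds p) i.+1) = 0) ->
    outputs M p (fun j => V (T + j) (hist (odds p) (T + j).+1)) /\
    finitely_many_revisions M p.
Proof.
move=> hV hD; have [//|M [_ h2]] := @stream_machine false V D hV hD.
exists M => p T hT0 hT; have [t ht] := h2 p.
have tlt i : t i < t i.+1 by have [] := ht i.
have tk i : T.+1 <= i -> forall k, t i <= k < t i.+1 -> keeps (run M p k) (run M p k.+1).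
  by move=> /hT hi; have [_ _] := ht i; apply.
split; last exact: finitely_many_revisions_from tlt tk.
have W j : stream_word V D p (T + j).+1 =
    words (fun j => V (T + j) (hist (odds p) (T + j).+1)) j.+1.
  elim: j => [|j IH].
    rewrite addn0 wordsS /= addn0.
    by case: hT0 => [->|/eqP/negbTE ->] /=; rewrite ?if_same.
  by rewrite wordsS -IH addnS /= hT ?eqxx //; lia.
apply: (outputs_from tlt tk) => j; exists j.+1 => //.
by have [_ -> _] := ht (T.+1 + j); rewrite addSn W.
Qed.

(** Induction on a strict bound B.+1: if B is attained, f is constant from there on; otherwise the
    bound can be lowered. *)
Lemma mono_stable_or_unbounded (f : nat -> nat) : {homo f : m n / m <= n} ->
  (exists K S, forall s, S <= s -> f s = K) \/ (forall B, exists S, forall s, S <= s -> B <= f s).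
Proof.
move=> hf; case: (pselect (exists B, forall s, f s < B)) => [[B hB]|H]; last first.
  right=> B; apply: contrapT => hB; apply: H; exists B => s; rewrite ltnNge; apply/negP => h.
  by apply: hB; exists s => s' /hf; apply: leq_trans.
left; elim: B hB => [|B IH] hB; first by have := hB 0.
case: (pselect (exists s, f s = B)) => [[S hS]|H].
  exists B, S => s /hf; rewrite hS => h; have := hB s; lia.
apply: IH => s; have := hB s; rewrite ltnS leq_eqVlt => /orP[/eqP e|//].
by case: H; exists s.
Qed.

Lemma find_iota (P : pred nat) m T : T < m -> P T -> (forall t, t < T -> ~~ P t) -> find P (iota 0 m) = T.
Proof.
move=> Tm PT hT; have -> : m = T + (m - T).-1.+1 by lia.
rewrite iotaD find_cat has_find size_iota add0n /= PT addn0.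
suff -> : find P (iota 0 T) = T by rewrite ltnn.
rewrite -{2}(size_iota 0 T); apply/eqP; rewrite eqn_leq find_size /= leqNgt -has_find.
by rewrite -all_predC; apply/allP => t; rewrite mem_iota /=; apply: hT.
Qed.

(** * One-way machines *)

Lemma one_way_step M inp x : one_way M ->
  (out_head (nextc M inp x) = out_head x /\ out (nextc M inp x) = out x) \/
  (out_head (nextc M inp x) = (out_head x).+1 /\
   forall c, c != out_head x -> out (nextc M inp x) c = out x c).
Proof.
move=> hM; rewrite /nextc /step.
case E : (ohead _) => [i|] /=; last by left.
have : one_way [:: i] && matches inp x i.
  move: hM E; rewrite /one_way; elim: M => //= j M IH /andP[hj hM].
  by case: ifP => [mj [<-]|_]; [rewrite hj mj|exact: IH].
rewrite /one_way /matches /= andbT => /andP[hi /and4P[_ _ _ /eqP hr]].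
case: (mv_out i) hi => //= h.
  by left; rewrite (eqP h) hr write_id.
by right; split=> // c; rewrite /write => /negbTE ->.
Qed.

Lemma one_way_keep M p t t' c : one_way M -> t <= t' -> c < out_head (run M p t) ->
  c < out_head (run M p t') /\ out (run M p t') c = out (run M p t) c.
Proof.
move=> hM /subnK <- hc; elim: (t' - t) => // d [h1 h2]; rewrite addSn runS.
case: (one_way_step (tape_of p) (run M p (d + t)) hM) => [[-> ->]|[-> h]] //.
by rewrite h ?h2; [split=> //; exact: ltnW|rewrite ltn_eqF].
Qed.

Lemma one_way_blank M p t c : one_way M -> out_head (run M p t) <= c -> out (run M p t) c = 0.
Proof.
move=> hM; elim: t => // t IH; rewrite runS.
case: (one_way_step (tape_of p) (run M p t) hM) => [[-> ->]|[-> h]] // hc.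
by rewrite h ?IH //; [exact: ltnW|rewrite gtn_eqF].
Qed.

(** The first entry is the position of the first 2, which is at most c on the tape of r. *)
Lemma tape_of_first r r' c : tape_of r c = 2 ->
  (forall c', c' <= c -> tape_of r c' = tape_of r' c') -> r 0 = r' 0.
Proof.
have F q : tape_of q (q 0) = 2 by have := tape_of_pos2 q 0; rewrite /pos big_ord0.
have L q k : tape_of q k = 2 -> q 0 <= k.
  rewrite leqNgt => h; apply/negP => /(@tape_of_pos1 q 0).
  by rewrite /pos big_ord0 !add0n h.
move=> hc h; have rc := L _ _ hc; have h1 := L r' (r 0); rewrite -h // F in h1.
by apply/eqP; rewrite eqn_leq h1 // L // h ?F //; apply: leq_trans rc; apply: h1.
Qed.

(** A cell holding 2 lies to the left of the output head, where everything is final. At time T both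
    runs are in the same configuration, so both outputs are settled up to c and agree there. *)
Lemma one_way_first M p p' r r' T c : one_way M -> outputs M p r -> outputs M p' r' ->
  (forall i, i < T -> p i = p' i) -> out (run M p T) c = 2 -> r 0 = r' 0.
Proof.
move=> hM hr hr' hp hc.
have ch : c < out_head (run M p T).
  by rewrite ltnNge; apply/negP => /(one_way_blank hM); rewrite hc.
have E q s c' : outputs M q s -> c' < out_head (run M q T) -> tape_of s c' = out (run M q T) c'.
  move=> /(_ c')[t0 h] /(one_way_keep hM (leq_maxl T t0))[_ <-].
  by rewrite (h _ (leq_maxr _ _)).
apply: (@tape_of_first _ _ c) => [|c' hc']; first by rewrite (E p).
by rewrite (E p) // ?(E p') // -?(run_eq _ hp) // (leq_ltn_trans hc' ch).
Qed.

(** * The diagonal scale *)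

Definition zero_jump_at (s : nat) : baire := fun i => halted i (fun=> 0) s.

(** As 0 codes the pair of 0 and 0, each entry denotes (n - 0) / 1. *)
Definition const_name (n : nat) : baire := fun=> cpair n 0.

(** On a one-way tape, a 2 means that the first output entry is complete; after t steps it can only
    be in a cell up to t. *)
Definition hit (n t : nat) (p : baire) : bool := [exists c : 'I_t.+1, out (run (tm n) p t) c == 2].

(** Without a hit by time s the value is s.+1, so the scale is unbounded if no stage ever finds a
    hit. *)
Definition use (n s : nat) : nat :=
  find (fun t => hit n t (join (zero_jump_at s) (const_name n))) (iota 0 s.+1).

(* The second argument of minn slows the growth down. *)
Definition scale (n s : nat) : nat := \max_(t < s.+1) minn (2 ^ (use n t + 2)) (t + 4).

Lemma scale_mono n : {homo scale n : s s' / s <= s'}.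
Proof.
move=> s s' h; apply/bigmax_leqP => t _.
have ht : t < s'.+1 by apply: leq_trans (ltn_ord t) _.
exact: (bigmax_sup (Ordinal ht)).
Qed.

(** The summands 2 and 4 in [scale] serve this bound; by it a bump ends at n + 2/K, that is, at n +
    1/2 or before. *)
Lemma scale_ge4 n s : 4 <= scale n s.
Proof.
apply: (bigmax_sup ord0) => //; rewrite leq_min leq_addl andbT expnD.
by rewrite leq_pmull // expn_gt0.
Qed.

Lemma scale_le n s : scale n s <= s + 4.
Proof.
by apply/bigmax_leqP => t _; rewrite geq_min; apply/orP; right; have := ltn_ord t; lia.
Qed.

Lemma hit_eq n t p p' : (forall i, i < t -> p i = p' i) -> hit n t p = hit n t p'.
Proof. by move=> h; rewrite /hit (run_eq _ h). Qed.

Lemma zero_jump_cvg T : exists S, forall s i, S <= s -> i < T -> zero_jump_at s i = halting_problem i.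
Proof.
elim: T => [|T [S hS]]; first by exists 0.
have [S' hS'] := jump_halted T (fun=> 0).
exists (maxn S S') => s i; rewrite geq_max ltnS => /andP[h1 h2].
rewrite leq_eqVlt => /orP[/eqP ->|]; last exact: hS.
by rewrite /halting_problem (hS' _ h2).
Qed.

(** Let T be the least hit time with the true oracle. By the use principle, from some stage on the
    approximations also hit at T and not before, so [use] settles on T. Stages before that can only
    have made the limit of the scale larger. *)
Lemma scale_hit n t : hit n t (join halting_problem (const_name n)) ->
  exists T K S, [/\ hit n T (join halting_problem (const_name n)), 2 ^ (T + 2) <= K
    & forall s, S <= s -> scale n s = K].
Proof.
set q := join _ _ => ht; have ex : exists t, hit n t q by exists t.
case: (ex_minnP ex) => T hT minT; exists T.
have [S hS] := zero_jump_cvg T.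
have hq s i : S <= s -> i < T -> join (zero_jump_at s) (const_name n) i = q i.
  by move=> h1 h2; rewrite /q /join; case: odd => //; apply: hS => //; lia.
have hu s : maxn S T <= s -> use n s = T.
  rewrite geq_max => /andP[h1 h2]; apply: find_iota => //.
    by rewrite (@hit_eq _ _ _ q) // => i hi; apply: hq.
  move=> k kT; rewrite (@hit_eq _ _ _ q); last by move=> i hi; apply: hq => //; lia.
  by apply/negP => /minT; lia.
have [[K [S' hK]]|H] := mono_stable_or_unbounded (scale_mono n).
  (* At this stage the cutoff [s + 4] exceeds 2 ^ (T + 2), so the minimum is the power. *)
  exists K, S'; split=> //; pose s := maxn S' (maxn (maxn S T) (2 ^ (T + 2))).
  rewrite -(hK s); last by rewrite /s; lia.
  apply: (bigmax_sup ord_max) => //=; rewrite hu; last by rewrite /s; lia.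
  by rewrite leq_min leqnn /= /s; lia.
(* The scale cannot be unbounded: from the stage [maxn S T] on, every term of the maximum is at most
   2 ^ (T + 2). *)
have [S' /(_ (maxn S' (maxn S T)) (leq_maxl _ _))] :=
  H (maxn (scale n (maxn S T)) (2 ^ (T + 2))).+1.
rewrite ltnNge => /negP[]; apply/bigmax_leqP => k _.
case: (ltnP k (maxn S T)) => hk; last first.
  by rewrite hu // geq_min; apply/orP; left; exact: leq_maxr.
have hk' : k < (maxn S T).+1 by apply: ltnW.
by rewrite leq_max; apply/orP; left; apply: (bigmax_sup (Ordinal hk')).
Qed.

Definition hitc (n l t : nat) : bool := [exists c : 'I_t.+1, uout n l t c == 2].

Definition oracle_code (n s : nat) : nat :=
  CodeSeq.code (mkseq (join (zero_jump_at s) (const_name n)) s.+1).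

(** Runs at stage s last at most s steps, so a finite piece of the oracle input can be passed to the
    interpreter. *)
Lemma pr_scale N S : pr N -> pr S -> pr (fun r => scale (N r) (S r)).
Proof.
have hz : pr (fun r => zero_jump_at (r 1) (r 0)).
  apply: (pr_ext (F := fun r => halted (r 0) (fun i => nthc 0 i) (r 1))).
    move=> r; rewrite /zero_jump_at; congr (nat_of_bool (halted _ _ _)).
    by apply/funext => i; rewrite nth_nil.
  by apply: pr_halted; pr_solve.
have ho A B : pr A -> pr B -> pr (fun r => oracle_code (A r) (B r)).
  apply: (pr_app2 (f := oracle_code)); rewrite /oracle_code /join /const_name.
  apply: (pr_mkseq (g := fun i r => if odd i then cpair (r 0) 0 else zero_jump_at (r 1) i./2)).
    by pr_solve.
  apply pr_if; [pr_solve|pr_solve|]; apply: (@pr_app2 (fun i s => zero_jump_at s i)) => //; pr_solve.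
have hh A B C : pr A -> pr B -> pr C -> pr (fun r => hitc (A r) (B r) (C r)).
  apply: (pr_app3 (f := fun n l t => hitc n l t)); apply: (pr_ex (g := fun c r => uout (r 0) (r 1) (r 2) c == 2)); first by pr_solve.
  rewrite /uout; apply: pr_eqn; last by pr_solve.
  apply: pr_nthc; last by pr_solve.
  by apply: pr_nthc; [apply: pr_urun|]; pr_solve.
have hu A B : pr A -> pr B -> pr (fun r => use (A r) (B r)).
  apply: (pr_app2 (f := use)); apply: (pr_ext (F := fun r =>
     find (fun t => hitc (r 0) (oracle_code (r 0) (r 1)) t) (iota 0 (r 1).+1))).
    move=> r; apply: eq_in_find => t; rewrite mem_iota add0n ltnS => /= ht.
    rewrite /hitc /hit; apply: eq_existsb => c.
    rewrite uoutP -1?ltnS // (@run_eq _ _ (join (zero_jump_at (r 1)) (const_name (r 0)))) //.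
    by move=> i hi; rewrite /oracle_code CodeSeq.codeK nth_mkseq //; lia.
  apply: pr_find; first by pr_solve.
  by apply: hh; [|apply: ho|]; pr_solve.
apply: (pr_app2 (f := scale)); apply: (pr_max (g := fun t r => minn (2 ^ (use (r 0) t + 2)) (t + 4))); first by pr_solve.
have hu' : pr (fun r => use (r 1) (r 0)) by apply: hu; pr_solve.
by pr_solve.
Qed.

(** * Injectivity of the jump *)

(** After c moves to the right, state c loops on a 1 and otherwise leaves for state c.+1, which has
    no row. *)
Definition probe_rows (c : nat) : seq trow :=
  mkseq (fun q a b o =>
    if q < c then Action q.+1 b o Right Stay Stay
    else Action (if a == 1 then c else c.+1) b o Stay Stay Stay) c.+1.

(* Halts iff cell c of the input tape contains 2. *)
Definition probe (c : nat) : machine := machine_of 1 (probe_rows c).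

Lemma probe_step c p q h : q <= c ->
  step (probe c) (tape_of p) (Config q h (fun=> 0) 0 (fun=> 0) 0) =
  Some (if q < c then Config q.+1 h.+1 (fun=> 0) 0 (fun=> 0) 0
        else Config (if tape_of p h == 1 then c else c.+1) h (fun=> 0) 0 (fun=> 0) 0).
Proof.
move=> qc; have w0 : write (fun=> 0) 0 0 = (fun=> 0) by exact: (write_id (fun=> 0) 0).
rewrite step_machine_of /=; last 4 first.
- by rewrite size_map size_iota.
- exact: tape_of12.
- by [].
- by [].
rewrite nth_mkseq //; case: ifP => _; by rewrite /apply_action /= w0.
Qed.

Lemma probe_run c p t : t <= c -> run (probe c) p t = Config t t (fun=> 0) 0 (fun=> 0) 0.
Proof.
elim: t => [//|t IH] h; have tc := ltnW h.
by rewrite runS IH // /nextc probe_step // h.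
Qed.

Lemma probe_halts c p : halts (probe c) p <-> tape_of p c = 2.
Proof.
have := tape_of12 p c; rewrite !inE => /orP[/eqP e|/eqP e]; rewrite e; split=> //.
  move=> [t]; suff [q [h [qc ->]]] : exists q h, q <= c /\
      run (probe c) p t = Config q h (fun=> 0) 0 (fun=> 0) 0 by rewrite probe_step.
  case: (leqP t c) => tc; first by exists t, t; rewrite probe_run.
  exists c, c; split=> //; rewrite -(subnK (ltnW tc)).
  elim: (t - c) => [|d IH]; first by rewrite probe_run.
  by rewrite addSn runS IH /nextc probe_step //= ltnn e.
move=> _; exists c.+1; rewrite runS probe_run // /nextc probe_step // ltnn e /=.
rewrite /step; set P := matches _ _.
have : all (fun i => ~~ P i) (probe c).
  rewrite /probe /machine_of all_map; apply/allP => -[[q a] [b o]].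
  move=> /allpairsP[[qa bo] [hqa _ [eq _]]]; move: hqa; rewrite -[(qa, bo).1]eq.
  move=> /allpairsP[[q2 a2] [h _ [eq' _]]]; move: h; rewrite -[(q2, a2).1]eq' => h.
  rewrite /P /matches /=; move: h; rewrite mem_iota size_map size_iota.
  by case: eqP => // ->; rewrite ltnn.
by elim: (probe c) => //= i s IH /andP[/negbTE -> /IH].
Qed.

Lemma tape_of_inj : injective tape_of.
Proof.
move=> r r' e; apply/funext => n; elim/ltn_ind: n => n IH.
have pe : pos r n = pos r' n.
  by rewrite /pos; congr (_ + _); apply: eq_bigr => i _; apply: IH.
have L q q' : tape_of q = tape_of q' -> pos q n = pos q' n -> q n <= q' n.
  move=> eq ep; rewrite leqNgt; apply/negP => /tape_of_pos1.
  by rewrite eq ep tape_of_pos2.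
by apply/eqP; rewrite eqn_leq !L.
Qed.

(** Halting of [probe c] reveals cell c, so the jump determines the tape. *)
Lemma jump_inj : injective jump.
Proof.
move=> r r' e; apply: tape_of_inj; apply/funext => c.
have [i ti] := tm_surj (probe c).
have h : halts (probe c) r <-> halts (probe c) r'.
  have aux (A B : Prop) : `[< A >] = `[< B >] :> nat -> (A <-> B) by do 2 case: asboolP.
  by apply: aux; have := congr1 (fun q => q i) e; rewrite /jump ti.
have := tape_of12 r c; have := tape_of12 r' c.
rewrite !probe_halts in h; rewrite !inE => /orP[] /eqP h1 /orP[] /eqP h2.
- by rewrite h1 h2.
- by rewrite h2 (h.1 h2).
- by rewrite h1 (h.2 h1).
- by rewrite h1 h2.
Qed.

Import Order.TTheory GRing.Theory Num.Theory.
Import numFieldNormedType.Exports.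

(** * The flat function exp(-1/x) *)

Section Psi.
Local Open Scope classical_set_scope.
Local Open Scope ring_scope.
Variable R : realType.
Implicit Types x y : R.

(** [psi 0] is the flat function; the powers of 1/x are those that arise in its derivatives. *)
Definition psi (j : nat) x : R := if 0 < x then x^-1 ^+ j * expR (- x^-1) else 0.

Lemma psi_le0 j x : x <= 0 -> psi j x = 0.
Proof. by rewrite /psi ltNge => ->. Qed.

Lemma psi_ge0 j x : 0 <= psi j x.
Proof.
rewrite /psi; case: ifP => // x0.
by rewrite mulr_ge0 ?expR_ge0 // exprn_ge0 // invr_ge0 ltW.
Qed.

(** With z = 1 / (m.+1 x), exp(1/x) is the power m.+1 of exp(z), and exp(z) >= 1 + z >= z. *)
Lemma expRN_inv_le m x : 0 < x -> expR (- x^-1) <= (m.+1%:R * x) ^+ m.+1.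
Proof.
move=> x0; have y0 : 0 < (m.+1%:R * x)^-1 by rewrite invr_gt0 mulr_gt0.
rewrite expRN -[leRHS]invrK lef_pV2 ?posrE ?expR_gt0 ?invr_gt0 ?exprn_gt0 ?mulr_gt0 //.
have -> : x^-1 = m.+1%:R * (m.+1%:R * x)^-1.
  by rewrite invfM mulrA divff ?mul1r // pnatr_eq0.
rewrite expRM_natl -exprVn ler_pXn2r ?nnegrE ?expR_ge0 ?(ltW y0) //.
by apply: le_trans (expR_ge1Dx _); rewrite lerDr.
Qed.

Lemma psi_le j x : 0 < x -> psi j x <= j.+2%:R ^+ j.+2 * x ^+ 2.
Proof.
move=> x0; rewrite /psi x0.
have -> : j.+2%:R ^+ j.+2 * x ^+ 2 = x^-1 ^+ j * (j.+2%:R * x) ^+ j.+2.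
  have E : x^-1 ^+ j * x ^+ j.+2 = x ^+ 2.
    by rewrite -addn2 exprD mulrA -exprMn mulVf ?expr1n ?mul1r // gt_eqF.
  by rewrite exprMn [RHS]mulrCA E.
by rewrite ler_wpM2l ?expRN_inv_le // exprn_ge0 // invr_ge0 ltW.
Qed.

Lemma psi_norm_le j x : `|psi j x| <= j.+2%:R ^+ j.+2 * x ^+ 2.
Proof.
rewrite ger0_norm ?psi_ge0 //; case: (ltP 0 x) => x0; first exact: psi_le.
by rewrite psi_le0 // mulr_ge0 ?sqr_ge0 ?exprn_ge0 ?ler0n.
Qed.

Lemma psi_cont0 j : {for 0, continuous (psi j)}.
Proof.
rewrite /prop_for /continuous_at psi_le0 //.
have h : (j.+2%:R ^+ j.+2 * x ^+ 2 : R) @[x --> (0 : R)] --> (0 : R).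
  rewrite -[X in _ --> X](mulr0 (j.+2%:R ^+ j.+2)); apply: cvgMr.
  rewrite -[X in _ --> X](expr0n _ 2); exact: exprn_continuous.
apply: norm_cvg0; apply: (squeeze_cvgr _ (cvg_cst 0) h).
by near=> x; rewrite normr_ge0 psi_norm_le.
Unshelve. all: by end_near. Qed.

Definition dpsi (j : nat) x : R := - (j%:R * psi j.+1 x) + psi j.+2 x.

Lemma is_derive_psi j x : is_derive x 1 (psi j) (dpsi j x).
Proof.
case: (ltrgtP 0 x) => x0; last first.
- rewrite -x0 /dpsi !psi_le0 // mulr0 oppr0 addr0.
  (* The difference quotient of [psi j] at 0 is [psi j.+1], on both sides of 0. *)
  apply/is_derive1_caratheodory; exists (psi j.+1); split.
  + move=> z; rewrite (psi_le0 _ (lexx 0)) !subr0 /psi; case: ifP => z0; last by rewrite mul0r.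
    by rewrite exprSr -!mulrA (mulrCA z^-1) mulVf ?mulr1 // gt_eqF.
  + exact: psi_cont0.
  + exact: psi_le0.
- rewrite /dpsi !psi_le0 ?ltW // mulr0 oppr0 addr0.
  apply: (near_eq_is_derive (f := cst 0)).
  by near=> y; rewrite psi_le0 //; apply/ltW; near: y; exact: lt_nbhsl.
have xn0 : x != 0 by rewrite gt_eqF.
apply: (near_eq_is_derive (f := fun y : R => y^-1 ^+ j * expR (- y^-1))).
  near=> y; rewrite /psi ifT //; near: y; exact: lt_nbhsr.
have dV : is_derive x 1 (fun y : R => y^-1) (- x ^- 2 *: 1) by exact: is_deriveV.
have dE : is_derive x 1 (fun y : R => expR (- y^-1)) (x ^- 2 * expR (- x^-1)).
  have dN := is_deriveN dV.
  have h := is_derive1_comp (f := expR) (g := fun y : R => - y^-1) (is_derive_expR _) dN.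
  by apply: (is_derive_eq h); rewrite [_%:A]mulr1 opprK mulrC.
have dX := @is_deriveX _ _ (fun y : R => y^-1) j x 1 _ dV.
have dM := is_deriveM dX dE.
have -> : (fun y : R => y^-1 ^+ j * expR (- y^-1)) =
   (fun y => y^-1) ^+ j * (fun y => expR (- y^-1)).
  by apply/funext => y; rewrite [RHS]/GRing.mul /= exprfctE.
apply: (is_derive_eq dM); rewrite /dpsi /psi x0 exprfctE -[_ ^- 2]exprVn.
rewrite -![_ *: _]/(_ * _) mulr1.
by case: j {dX dM} => [|j] /=; rewrite ?expr0 !exprS; ring.
Unshelve. all: by end_near. Qed.

Lemma continuous_psi j : continuous (psi j).
Proof.
move=> x; apply/differentiable_continuous/derivable1_diffP.
by have [] := is_derive_psi j x.
Qed.

(** Mean value theorem: the derivative is [psi 2], which is at most 4 because exp(-1/c) <= (2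
    c)^2. *)
Lemma psi_lipschitz x y : `|psi 0 x - psi 0 y| <= 4 * `|x - y|.
Proof.
wlog xy : x y / y <= x.
  by move=> H; case: (leP y x) => [/H//|/ltW/H]; rewrite distrC (distrC x).
have [|c _ ->] := @MVT_segment R (psi 0) (dpsi 0) y x xy (fun z _ => is_derive_psi 0 z).
  exact/continuous_subspaceT/continuous_psi.
rewrite normrM ler_wpM2r // /dpsi mul0r oppr0 add0r ger0_norm ?psi_ge0 //.
rewrite /psi; case: ifP => // c0.
have ic : 0 <= c^-1 by rewrite invr_ge0 ltW.
apply: le_trans (ler_wpM2l (exprn_ge0 2 ic) (expRN_inv_le 1 c0)) _.
by rewrite -exprMn mulrCA mulVf ?gt_eqF // mulr1 -natrX.
Qed.

(* Stable under differentiation; u is fixed. *)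
Inductive psi_poly (u : {poly R}) : (R -> R) -> Prop :=
  | psi_poly1 (p : {poly R}) j : psi_poly u (fun x => p.[x] * psi j u.[x])
  | psi_polyD f g : psi_poly u f -> psi_poly u g -> psi_poly u (fun x => f x + g x).

Lemma psi_poly_derive u f : psi_poly u f ->
  exists2 g, psi_poly u g & forall x, is_derive x 1 f (g x).
Proof.
elim=> [p j|{}f g _ [f' hf' df] _ [g' hg' dg]]; last first.
  exists (fun x => f' x + g' x); first exact: psi_polyD.
  by move=> x; exact: (is_deriveD (df x) (dg x)).
exists (fun x => p^`().[x] * psi j u.[x] +
   ((- (p * u^`() *+ j)).[x] * psi j.+1 u.[x] + (p * u^`()).[x] * psi j.+2 u.[x])).
  by do !apply: psi_polyD; apply: psi_poly1.
move=> x; have dc := is_derive1_comp (is_derive_psi j u.[x]) (is_derive_poly u x).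
apply: (is_derive_eq (is_deriveM (is_derive_poly p x) dc)).
rewrite -![_ *: _]/(_ * _) /dpsi hornerN hornerMn hornerM /= -[_ *+ j]mulr_natl; ring.
Qed.

Lemma psi_poly_smooth u f : psi_poly u f -> smooth f.
Proof.
move=> hf n; suff [g hg ->] : exists2 g, psi_poly u g & derive1n n f = g.
  by move=> x; have [g' _ /(_ x)[]] := psi_poly_derive hg.
elim: n => [|n [g hg e]]; first by exists f.
have [g' hg' dg] := psi_poly_derive hg; exists g' => //.
rewrite derive1nS e; apply/funext => x; rewrite derive1E.
by have [_ ->] := dg x.
Qed.

Lemma derive1n_local (U : set R) (f g : R -> R) n : open U -> (forall x, U x -> f x = g x) ->
  forall x, U x -> derive1n n f x = derive1n n g x.
Proof.
move=> oU; elim: n => [//|n IH] h x Ux; rewrite !derive1nS !derive1E.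
apply: near_eq_derive; have : nbhs x U by apply: open_nbhs_nbhs.
by apply: filterS => y; apply: IH.
Qed.

Lemma smooth_local (f : R -> R) :
  (forall x, exists U g, [/\ open U, U x, smooth g & forall y, U y -> f y = g y]) -> smooth f.
Proof.
move=> h n x; have [U [g [oU Ux sg fg]]] := h x.
apply: (near_eq_derivable (f := derive1n n g)); last exact: sg.
have : nbhs x U by apply: open_nbhs_nbhs.
by apply: filterS => y Uy; rewrite (derive1n_local n oU fg Uy).
Qed.

(** * Rational approximation of exp(-1/x) *)

(** The binomial expansion cut after its quadratic term, doubled to avoid fractions. *)
Lemma bernoulli2 (t : R) n : 0 <= t ->
  2 + 2 * n.+1%:R * t + n.+1%:R * n%:R * t ^+ 2 <= 2 * (1 + t) ^+ n.+1.
Proof.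
move=> t0; elim: n => [|n IH]; first by rewrite expr1; lra.
have n0 : 0 <= n%:R :> R by [].
rewrite exprS; set A := (1 + t) ^+ n.+1 in IH *.
have e1 : n.+1%:R = 1 + n%:R :> R by rewrite mulrS.
have e2 : n.+2%:R = 2 + n%:R :> R by rewrite -addn2 natrD addrC.
rewrite e2 e1 in IH *; move: (n%:R : R) n0 IH => m m0 IH.
have h1 : 0 <= m * t ^+ 3 by rewrite mulr_ge0 // exprn_ge0.
have h2 : 0 <= m * m * t ^+ 3 by rewrite !mulr_ge0 // exprn_ge0.
have -> : 2 * ((1 + t) * A) = 2 * A + t * (2 * A) by ring.
apply: le_trans (lerD IH (ler_wpM2l t0 IH)); rewrite -subr_ge0.
by apply: le_trans (addr_ge0 h1 h2) _; rewrite le_eqVlt; apply/orP; left; apply/eqP; ring.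
Qed.

Lemma expr_diff_le (u v : R) n : 0 <= v -> v <= u ->
  u ^+ n.+1 - v ^+ n.+1 <= n.+1%:R * (u - v) * u ^+ n.
Proof.
move=> v0 vu; have u0 : 0 <= u by apply: le_trans vu.
elim: n => [|n IH]; first by rewrite !expr1 expr0 mulr1 mul1r.
have -> : u ^+ n.+2 - v ^+ n.+2 = u * (u ^+ n.+1 - v ^+ n.+1) + (u - v) * v ^+ n.+1.
  by rewrite !(exprS _ n.+1); ring.
have h1 : v ^+ n.+1 <= u ^+ n.+1 by apply: lerXn2r.
have h2 := ler_wpM2l u0 IH.
have h3 : (u - v) * v ^+ n.+1 <= (u - v) * u ^+ n.+1 by apply: ler_wpM2l => //; rewrite subr_ge0.
apply: le_trans (lerD h2 h3) _; rewrite [n.+2%:R]mulrS exprS.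
by rewrite le_eqVlt; apply/orP; left; apply/eqP; ring.
Qed.

(** Put m = n.+2, t = 1/(q m), u = 1/(1 + t) and v = exp(-t). Then u^m - v^m <= m (u - v) u^(m-1) <=
    m t^2 u^m, while m (m - 1) t^2 <= 2 (1 + t)^m. Uniformity in q matters: q may be arbitrarily
    small, and the algorithm fixes m by the stage alone. *)
Lemma psi_approx (q : R) n : 0 < q ->
  `|(q * n.+2%:R / (q * n.+2%:R + 1)) ^+ n.+2 - psi 0 q| <= 2 / n.+1%:R.
Proof.
move=> q0; have m0 : 0 < n.+2%:R :> R by [].
pose t := (q * n.+2%:R)^-1; have t0 : 0 < t by rewrite invr_gt0 mulr_gt0.
have -> : q * n.+2%:R / (q * n.+2%:R + 1) = (1 + t)^-1.
  rewrite /t; field; rewrite !gt_eqF //; nra.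
set u := (1 + t)^-1; pose v := expR (- t).
have -> : psi 0 q = v ^+ n.+2.
  rewrite /psi q0 expr0 mul1r /v -expRM_natl; congr expR.
  rewrite /t; field; by rewrite !gt_eqF.
have tp : 0 < 1 + t by lra.
have vu : v <= u.
  by rewrite /v /u expRN lef_pV2 ?posrE ?expR_gt0 // expR_ge1Dx.
have v0 : 0 <= v by apply: expR_ge0.
have u0 : 0 < u by rewrite invr_gt0.
rewrite ger0_norm ?subr_ge0; last by apply: lerXn2r => //; rewrite nnegrE // ltW.
apply: le_trans (expr_diff_le n.+1 v0 vu) _.
(* From 1 - t <= v and u (1 + t) = 1: u - v <= u - (1 - t) = t^2 u. *)
have h : u - v <= t ^+ 2 * u.
  have : 1 - t <= v by apply: le_trans (expR_ge1Dx _).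
  have : u * (1 + t) = 1 by rewrite /u mulVf // gt_eqF.
  nra.
apply: (@le_trans _ _ (n.+2%:R * (t ^+ 2 * u) * u ^+ n.+1)).
  by rewrite ler_wpM2r ?exprn_ge0 ?(ltW u0) // ler_wpM2l.
rewrite ler_pdivlMr //.
have -> : n.+2%:R * (t ^+ 2 * u) * u ^+ n.+1 * n.+1%:R =
   (n.+2%:R * n.+1%:R * t ^+ 2) * u ^+ n.+2 by rewrite (exprS _ n.+1); ring.
rewrite /u exprVn ler_pdivrMr ?exprn_gt0 //.
apply: le_trans (bernoulli2 n.+1 (ltW t0)).
by rewrite lerDr addr_ge0 // !mulr_ge0 // ltW.
Qed.

End Psi.

(** * The function and its approximation *)

(* The rational denoted by c, cut off below at 0, is rnum c / rden c. *)
Definition rnum (c : nat) : nat := (cunpair c).1 - (cunpair (cunpair c).2).1.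
Definition rden (c : nat) : nat := (cunpair (cunpair c).2).2.+1.

(** With z the fractional part and K the scale at stage i, this is max(0, K z - 1) max(0, 2 - K z)
    times the square of [rden c]; truncated subtraction supplies the maxima. *)
Definition bump_num (i c : nat) : nat :=
  let t := scale (rnum c %/ rden c) i * (rnum c %% rden c) in
  (t - rden c) * (2 * rden c - t).

(** Chosen so that [psi_approx] applies with n = 4^i. *)
Definition prec_exp (i : nat) : nat := 4 ^ i + 2.

(* With q = bump_num / rden ^ 2 and N = prec_exp, this is 256 (q N / (q N + 1)) ^ N,
   which tends to 256 exp (-1/q). *)
Definition approx_num (i c : nat) : nat := 256 * (bump_num i c * prec_exp i) ^ prec_exp i.
Definition approx_den (i c : nat) : nat :=
  (bump_num i c * prec_exp i + rden c * rden c) ^ prec_exp i.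

Definition approx_code (i c : nat) : nat := cpair (approx_num i c) (cpair 0 (approx_den i c).-1).

Lemma approx_den_gt0 i c : 0 < approx_den i c.
Proof. by rewrite expn_gt0 addn_gt0 muln_gt0 orbT. Qed.

(** * Error of the approximations *)

Section Function.
Local Open Scope classical_set_scope.
Local Open Scope ring_scope.
Variable R : realType.

Definition phi (k : nat) (X : R) : R :=
  let z := X - (Num.truncn X)%:R in Num.max 0 (k%:R * z - 1) * Num.max 0 (2 - k%:R * z).

Lemma phi_eq0l k X : k%:R * (X - (Num.truncn X)%:R) <= 1 -> phi k X = 0.
Proof. by move=> h; rewrite /phi max_l ?mul0r //; lra. Qed.

Lemma phi_eq0r k X : 2 <= k%:R * (X - (Num.truncn X)%:R) -> phi k X = 0.
Proof. by move=> h; rewrite /phi mulrC max_l ?mul0r //; lra. Qed.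

(** The factors add up to 1, so they are never negative together: when one is cut off, the uncut
    product is at most 0 too, and [psi 0] does not see the difference. The cut form is Lipschitz on
    the whole line, the uncut one is polynomial. *)
Lemma psi_phi k X : let z := X - (Num.truncn X)%:R in
  psi 0 (phi k X) = psi 0 ((k%:R * z - 1) * (2 - k%:R * z)).
Proof.
rewrite /phi /=; set s := k%:R * _.
case: (leP (s - 1) 0) => h1; first by rewrite mul0r !psi_le0 //; nra.
case: (leP (2 - s) 0) => h2; first by rewrite mulr0 !psi_le0 //; nra.
by [].
Qed.

Lemma natr_sub (a b : nat) : (a - b)%:R = Num.max 0 (a%:R - b%:R) :> R.
Proof.
case: (leqP b a) => h; first by rewrite natrB // max_r // subr_ge0 ler_nat.
by rewrite (eqP (ltnW h)) max_l // subr_le0 ler_nat ltnW.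
Qed.

Lemma max_mulr (x w : R) : 0 < w -> Num.max 0 (x / w) = Num.max 0 x / w.
Proof. by move=> w0; rewrite maxr_pMl ?invr_ge0 ?ltW // mul0r. Qed.

Definition cut (c : nat) : R := (rnum c)%:R / (rden c)%:R.

Lemma alphaE c : ratr (alpha c) = (((cunpair c).1)%:R - ((cunpair (cunpair c).2).1)%:R) / (rden c)%:R :> R.
Proof.
rewrite /alpha /rden; case: (cunpair c) => i m /=; case: (cunpair m) => j k /=.
by rewrite fmorph_div rmorphB /= !ratr_nat.
Qed.

Lemma cutE c : cut c = Num.max 0 (ratr (alpha c)).
Proof. by rewrite alphaE max_mulr ?ltr0n // /cut natr_sub. Qed.

Lemma truncn_cut c : Num.truncn (cut c) = (rnum c %/ rden c)%N.
Proof.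
apply: truncn_def; rewrite /cut ler_pdivlMr ?ltr0n // ltr_pdivrMr ?ltr0n //.
rewrite -!natrM ler_nat ltr_nat leq_trunc_div /= mulnC.
by rewrite {1}(divn_eq (rnum c) (rden c)) mulnS mulnC addnC ltn_add2r ltn_mod.
Qed.

Lemma frac_cut c : cut c - (Num.truncn (cut c))%:R = (rnum c %% rden c)%:R / (rden c)%:R.
Proof.
rewrite truncn_cut /cut {1}(divn_eq (rnum c) (rden c)) natrD natrM; field.
by rewrite pnatr_eq0.
Qed.

Lemma bump_phi i c : (bump_num i c)%:R / ((rden c)%:R * (rden c)%:R) =
  phi (scale (Num.truncn (cut c)) i) (cut c).
Proof.
rewrite /phi frac_cut truncn_cut /bump_num; set k := scale _ _; set u := (_ %% _)%N.
have w0 : 0 < (rden c)%:R :> R by rewrite ltr0n.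
have -> : k%:R * (u%:R / (rden c)%:R) - 1 = ((k * u)%:R - (rden c)%:R) / (rden c)%:R :> R.
  by rewrite natrM; field; rewrite gt_eqF.
have -> : 2 - k%:R * (u%:R / (rden c)%:R) = ((2 * rden c)%:R - (k * u)%:R) / (rden c)%:R :> R.
  by rewrite !natrM; field; rewrite gt_eqF.
rewrite !max_mulr // -!natr_sub natrM; field.
by rewrite gt_eqF.
Qed.

Lemma alpha_approx_code i c : ratr (alpha (approx_code i c)) = (approx_num i c)%:R / (approx_den i c)%:R :> R.
Proof. by rewrite alphaE /rden /approx_code !cpairK /= subr0 prednK // approx_den_gt0. Qed.

Lemma approx_code_error i c : `|ratr (alpha (approx_code i c)) -
  256 * psi 0 (phi (scale (Num.truncn (cut c)) i) (cut c))| <= 512 / 4 ^+ i.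
Proof.
rewrite alpha_approx_code -bump_phi; set q := (bump_num i c)%:R / _.
have w0 : 0 < (rden c)%:R :> R by rewrite ltr0n.
have q0 : 0 <= q by rewrite divr_ge0 // mulr_ge0.
have N0 : 0 < (prec_exp i)%:R :> R by rewrite ltr0n addn_gt0 orbT.
have -> : (approx_num i c)%:R / (approx_den i c)%:R =
    256 * (q * (prec_exp i)%:R / (q * (prec_exp i)%:R + 1)) ^+ prec_exp i :> R.
  rewrite /approx_num /approx_den /q {q q0}; move: (bump_num i c) (prec_exp i) N0 => b N N0.
  rewrite natrM !natrX natrD !natrM -mulrA -expr_div_n.
  congr (_ * _ ^+ _); field; rewrite gt_eqF //= gt_eqF //.
  by rewrite ltr_wpDl ?mulr_gt0 ?mulr_ge0.
rewrite -mulrBr normrM ger0_norm ?ler0n //.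
have p0 : 0 < 4 ^+ i :> R by rewrite exprn_gt0.
suff h : `|(q * (prec_exp i)%:R / (q * (prec_exp i)%:R + 1)) ^+ prec_exp i - psi 0 q| <= 2 / 4 ^+ i.
  apply: le_trans (ler_wpM2l (ler0n _ _) h) _; rewrite le_eqVlt; apply/orP; left.
  by apply/eqP; field; rewrite gt_eqF.
move: q0; rewrite le_eqVlt => /orP[/eqP <-|q0].
  rewrite !mul0r psi_le0 // subr0 expr0n /prec_exp addn2 /= normr0 divr_ge0 // ltW //.
rewrite /prec_exp addn2; apply: le_trans (psi_approx _ q0) _.
rewrite ler_pM2l // lef_pV2 ?posrE ?ltr0n // -natrX ler_nat //.
Qed.

(** On [1, 2] the product has slope 3 - 2 s, between -1 and 1; elsewhere it is 0. *)
Lemma tent_lipschitz (s t : R) :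
  `|Num.max 0 (s - 1) * Num.max 0 (2 - s) - Num.max 0 (t - 1) * Num.max 0 (2 - t)| <= `|s - t|.
Proof.
wlog st : s t / t <= s.
  by move=> H; case: (leP t s) => [/H//|/ltW/H]; rewrite distrC (distrC t).
rewrite (ger0_norm (x := s - t)) ?subr_ge0 // ler_norml.
case: (leP (s - 1) 0) => h1; case: (leP (2 - s) 0) => h2;
case: (leP (t - 1) 0) => h3; case: (leP (2 - t) 0) => h4;
rewrite ?mul0r ?mulr0; apply/andP; split; nra.
Qed.

Lemma pow4_large (B : R) : exists T : nat, forall i, (T <= i)%N -> B <= 4 ^+ i.
Proof.
exists (Num.truncn `|B|).+1 => i hi; apply: le_trans (ler_norm B) _.
have h := truncnS_gt `|B|; apply: le_trans (ltW h) _.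
rewrite -natrX ler_nat (leq_trans hi) // ltnW // ltn_expl //.
Qed.

(** The limit of the scale; the value 0 stands for an infinite limit and makes [phi] vanish. *)
Variable l : nat -> nat.
Hypothesis l_lim : forall n, (exists S, forall s, (S <= s)%N -> scale n s = l n) \/
  (l n = 0 /\ forall B, exists S, forall s, (S <= s)%N -> (B <= scale n s)%N).

Definition bumps (x : R) : R :=
  let X := Num.max 0 x in 256 * psi 0 (phi (l (Num.truncn X)) X).

(** An error of order 4^-i eventually stays below the threshold 2^-i of a mind change, whatever C
    is. C and T depend on x and serve the analysis only; the machine never computes them. *)
Lemma approx_code_rate p x : (forall k : nat, `|ratr (alpha (p k)) - x| <= 2 ^- k) ->
  exists (C : R) (T : nat), forall i, (T <= i)%N ->
    `|ratr (alpha (approx_code i (odds p i))) - bumps x| <= C / 4 ^+ i.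
Proof.
move=> hp; set X := Num.max 0 x; pose Xi i := cut (odds p i).
have p4 i : 0 < 4 ^+ i :> R by rewrite exprn_gt0.
have hX i : `|Xi i - X| <= (4 ^+ i)^-1.
  rewrite /Xi cutE /X /odds; apply: le_trans (_ : `|ratr (alpha (p i.*2.+1)) - x| <= _).
    set a := ratr _; case: (leP 0 a) => h1; case: (leP 0 x) => h2 //; rewrite ?subrr ?normr0 //.
    - by rewrite subr0 !ger0_norm //; lra.
    - by rewrite sub0r normrN (ger0_norm h2) ltr0_norm //; lra.
  apply: le_trans (hp _) _; rewrite lef_pV2 ?posrE ?exprn_gt0 //.
  have -> : 4 = 2 ^+ 2 :> R by rewrite expr2; lra.
  by rewrite -exprM -mul2n ler_eXn2l // ?ltr1n //; lia.
have X0 : 0 <= X by rewrite /X le_max lexx.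
have Xi0 i : 0 <= Xi i by rewrite /Xi cutE le_max lexx.
set n := Num.truncn X; have /andP[nX Xn] : n%:R <= X < n.+1%:R by apply: truncn_itv.
have hv i := approx_code_error i (odds p i).
suff [C [T H]] : exists (C : R) (T : nat), forall i, (T <= i)%N ->
    `|psi 0 (phi (scale (Num.truncn (Xi i)) i) (Xi i)) - psi 0 (phi (l n) X)| <= C / 4 ^+ i.
  exists (512 + 256 * C), T => i /H h; apply: le_trans
    (ler_distD (256 * psi 0 (phi (scale (Num.truncn (Xi i)) i) (Xi i))) _ _) _.
  rewrite [leRHS]mulrDl; apply: lerD; first exact: hv.
  by rewrite /bumps -/X -/n -mulrBr normrM ger0_norm ?ler0n // -mulrA ler_pM2l ?ltr0n //; exact: h.
have Sn : n.+1%:R = n%:R + 1 :> R by rewrite -natr1.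
move: nX; rewrite le_eqVlt => /orP[/eqP Xe|nX].
(* At an integer the bump is missed from i = 2 on. To the right, K z <= (i + 4) / 4^i <= 1; to the
   left, z >= 1/2 and K >= 4. Negative x belong here, with X = 0. *)
- have -> : phi (l n) X = 0 by apply: phi_eq0l; rewrite -/n Xe subrr mulr0.
  exists 0, 2%N => i hi; rewrite mul0r.
  suff -> : phi (scale (Num.truncn (Xi i)) i) (Xi i) = 0 by rewrite subrr normr0.
  have := hX i; rewrite ler_distl -Xe => /andP[b1 b2].
  have q : (4 ^+ i)^-1 <= 2^-1 :> R.
    rewrite lef_pV2 ?posrE //; case: i hi {b1 b2} => // i _.
    by rewrite exprS; have := @exprn_ege1 R i 4 _; rewrite ler1n => /(_ isT); lra.
  have hc : (i + 4)%:R * (4 ^+ i)^-1 <= 1 :> R.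
    rewrite ler_pdivrMr // mul1r -natrX ler_nat.
    elim: i hi {b1 b2 q} => // i IH; rewrite leq_eqVlt => /orP[/eqP <- //|/IH]; rewrite expnS; lia.
  case: (leP n%:R (Xi i)) => h.
    have tn : Num.truncn (Xi i) = n by apply: truncn_def; rewrite h Sn; lra.
    apply: phi_eq0l; rewrite tn; apply: le_trans hc; apply: ler_pM => //.
    + by rewrite subr_ge0.
    + by rewrite ler_nat scale_le.
    + by lra.
  case: n h Xe Xn Sn b1 b2 => [|m] h Xe Xn Sn b1 b2; first by have := Xi0 i; lra.
  have Sm : m.+1%:R = m%:R + 1 :> R by rewrite -natr1.
  have tn : Num.truncn (Xi i) = m by apply: truncn_def; rewrite h andbT; lra.
  apply: phi_eq0r; rewrite tn.
  have : 4 <= (scale m i)%:R :> R by rewrite ler_nat scale_ge4.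
  move: (scale m i)%:R => k hk; nra.
(* From these stages on, the error of the input is at most half the distance to either neighbouring
   integer. *)
have [T0 hT0] := pow4_large ((X - n%:R)^-1 * 2).
have [T1 hT1] := pow4_large ((n.+1%:R - X)^-1 * 2).
have z0 : 0 < X - n%:R by rewrite subr_gt0.
have z1 : 0 < n.+1%:R - X by rewrite subr_gt0.
have inv2 (a : R) i : 0 < a -> a^-1 * 2 <= 4 ^+ i -> (4 ^+ i)^-1 <= a / 2.
  move=> a0 h; rewrite -[leRHS]invrK lef_pV2 ?posrE ?invr_gt0 ?divr_gt0 //.
  by rewrite invf_div mulrC.
have tn i : (maxn T0 T1 <= i)%N -> Num.truncn (Xi i) = n /\ (X - n%:R) / 2 <= Xi i - n%:R.
  rewrite geq_max => /andP[/hT0/(inv2 _ _ z0) g0 /hT1/(inv2 _ _ z1) g1].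
  have := hX i; rewrite ler_distl => /andP[b1 b2].
  split; last by lra.
  by apply: truncn_def; apply/andP; split; lra.
case: (l_lim n) => [[S hS]|[l0 hS]].
(* Lipschitz constants: 4 for [psi 0], 1 for the tent, [l n] for the scaling. *)
- exists (4 * (l n)%:R), (maxn S (maxn T0 T1)) => i; rewrite geq_max => /andP[h1 /tn[t2 _]].
  rewrite t2 (hS _ h1); apply: le_trans (psi_lipschitz _ _) _.
  rewrite -mulrA ler_pM2l //; apply: le_trans (tent_lipschitz _ _) _.
  rewrite -/n t2 -mulrBr normrM ger0_norm //; apply: ler_wpM2l => //.
  by apply: le_trans (hX i); rewrite le_eqVlt; apply/orP; left; apply/eqP; congr (`|_|); ring.
(* Once K >= 4 / (X - n), the bound z >= (X - n) / 2 gives K z >= 2: the bump has moved past the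
   input. *)
- have [S hS'] := hS (Num.truncn (4 / (X - n%:R))).+1.
  exists 0, (maxn S (maxn T0 T1)) => i; rewrite geq_max => /andP[h1 /tn[t2 hz]].
  rewrite l0 t2 phi_eq0r; last first.
    rewrite t2; have := hS' _ h1; rewrite -(ler_nat R) => hk.
    have := truncnS_gt (4 / (X - n%:R)); move: (scale n i)%:R hk => k hk hk'.
    have {hk hk'} : 4 / (X - n%:R) <= k by apply: le_trans hk; apply: ltW.
    by rewrite ler_pdivrMr // => ?; nra.
  by rewrite phi_eq0l ?mul0r ?ler01 // subrr normr0.
Qed.

End Function.

(** * Smoothness *)

Section Smooth.
Local Open Scope classical_set_scope.
Local Open Scope ring_scope.
Variable R : realType.
Variable l : nat -> nat.
Hypothesis l_or : forall n, l n = 0%N \/ (4 <= l n)%N.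

Definition bump_at (n : nat) (x : R) : R :=
  256 * psi 0 (((l n)%:R * (x - n%:R) - 1) * (2 - (l n)%:R * (x - n%:R))).

Lemma smooth_bump_at n : smooth (bump_at n).
Proof.
pose z := 'X - (n%:R)%:P : {poly R}.
pose u := (((l n)%:R)%:P * z - 1) * (2%:P - ((l n)%:R)%:P * z).
have -> : bump_at n = (fun x => (256%:P).[x] * psi 0 u.[x]).
  apply/funext => x; rewrite /bump_at /u /z !hornerE //.
exact/psi_poly_smooth/psi_poly1.
Qed.

Lemma bump_at_le n x : x <= n%:R -> bump_at n x = 0.
Proof.
move=> h; have h' : (l n)%:R * (x - n%:R) <= 0 by rewrite mulr_ge0_le0 // subr_le0.
by rewrite /bump_at psi_le0 ?mulr0 //; nra.
Qed.

Lemma bumps_le0 (x : R) : x <= 0 -> bumps l x = 0.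
Proof.
by move=> h; rewrite /bumps max_l // phi_eq0l ?psi_le0 ?mulr0.
Qed.

Lemma bumps_bump_at n (x : R) : n%:R <= x -> x < n.+1%:R -> bumps l x = bump_at n x.
Proof.
move=> h1 h2; have x0 : 0 <= x by apply: le_trans h1.
by rewrite /bumps max_r // psi_phi (@truncn_def _ x n) ?h1.
Qed.

Lemma bumps_before n (x : R) : n%:R - 2^-1 < x -> x <= n%:R -> bumps l x = 0.
Proof.
move=> h1; rewrite le_eqVlt => /orP[/eqP ->|h2].
  by rewrite (@bumps_bump_at n) // ?ltr_nat // bump_at_le.
case: n h1 h2 => [|m] h1 h2; first by apply/bumps_le0/ltW.
have e : m.+1%:R = m%:R + 1 :> R by rewrite -natr1.
have m0 : 0 <= m%:R :> R by [].
have x0 : 0 <= x by lra.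
have tn : Num.truncn x = m by apply: truncn_def; apply/andP; split; lra.
rewrite /bumps max_r // tn; case: (l_or m) => [->|h].
  by rewrite phi_eq0l ?psi_le0 ?mulr0 // mul0r ler01.
rewrite phi_eq0r ?psi_le0 ?mulr0 // tn.
have : 4 <= (l m)%:R :> R by rewrite ler_nat.
by move: (l m)%:R => k hk; nra.
Qed.

(** On (n - 1/2, n.+1) only bump n is present, as the previous one ends by n - 1/2. For n = 0 the
    interval extends to minus infinity and covers negative x, whose truncation is 0. *)
Lemma smooth_bumps : smooth (bumps l : R -> R).
Proof.
apply: smooth_local => x; pose n := Num.truncn x.
have eq y : (if n == 0%N then true else n%:R - 2^-1 < y) -> y < n.+1%:R -> bumps l y = bump_at n y.
  move=> h1 h2; case: (leP n%:R y) => h3; first exact: bumps_bump_at.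
  rewrite bump_at_le ?(ltW h3) //; case: eqP h1 => [n0 _|_ h1]; last exact: bumps_before (ltW h3).
  by apply: bumps_le0; rewrite n0 in h3; apply: ltW.
have nx : x < n.+1%:R by rewrite truncnS_gt.
case: (eqVneq n 0%N) => [n0|n0].
  exists (`]-oo, n.+1%:R[%classic), (bump_at n); split.
  - exact: interval_open.
  - by rewrite /= in_itv.
  - exact: smooth_bump_at.
  - by move=> y; rewrite /= in_itv /= => h; apply: eq => //; rewrite n0.
exists (`]n%:R - 2^-1, n.+1%:R[%classic), (bump_at n); split.
- exact: interval_open.
- rewrite /= in_itv /= nx andbT; have : n%:R <= x; last by move=> ?; lra.
  rewrite truncn_le; case: (leP 0 x) => // x0.
  by move: n0; rewrite /n truncn_floor leNgt x0 eqxx.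
- exact: smooth_bump_at.
- by move=> y; rewrite /= in_itv /= => /andP[h1 h2]; apply: eq => //; rewrite (negbTE n0).
Qed.

End Smooth.

(** * Mind changes *)

(* Consecutive approximations differ by at least 2^-j. *)
Definition mind_change (j c c' : nat) : bool :=
  (0 < j) && (approx_den j c * approx_den j.-1 c' <=
    2 ^ j * ((approx_num j c * approx_den j.-1 c' - approx_num j.-1 c' * approx_den j c) +
             (approx_num j.-1 c' * approx_den j c - approx_num j c * approx_den j.-1 c'))).

(** [a] is a history with the latest entry first, so index i - j holds entry j. *)
Definition last_change (i a : nat) : nat :=
  \max_(j < i.+1) (if mind_change j (nthc a (i - j)) (nthc a (i - j.-1)) then j : nat else 0).

Definition partial_output (i a : nat) : nat :=
  CodeSeq.code (mkseq (fun j => approx_code (last_change i a + j) (nthc a (i - (last_change i a + j)))) i.+1).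

(** The second component of i is the number of the machine; the limit is taken along the first. With
    T the last change so far, stage i knows the output exactly up to index i - T, which is what i -
    T steps can inspect. *)
Definition jump_approx (i a : nat) : nat :=
  halted (cunpair i).2 (fun j => nthc (partial_output i a) j) (i - last_change i a).

Lemma pr_approx_num A B : pr A -> pr B -> pr (fun r => approx_num (A r) (B r)).
Proof.
apply: (pr_app2 (f := approx_num)); rewrite /approx_num /bump_num /prec_exp /rden /rnum; cbn zeta.
by pr_solve; apply: pr_scale; pr_solve.
Qed.

Lemma pr_approx_den A B : pr A -> pr B -> pr (fun r => approx_den (A r) (B r)).
Proof.
apply: (pr_app2 (f := approx_den)); rewrite /approx_den /bump_num /prec_exp /rden /rnum; cbn zeta.
by pr_solve; apply: pr_scale; pr_solve.
Qed.

Ltac pr_hook ::= lazymatch goal with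
  | |- pr (fun r => consc (@?a r) (@?b r)) => apply (@pr_consc a b)
  | |- pr (fun r => nthc (@?a r) (@?b r)) => apply (@pr_nthc a b)
  | |- pr (fun r => approx_num (@?a r) (@?b r)) => apply (@pr_approx_num a b)
  | |- pr (fun r => approx_den (@?a r) (@?b r)) => apply (@pr_approx_den a b)
  end.

Lemma pr_approx_code A B : pr A -> pr B -> pr (fun r => approx_code (A r) (B r)).
Proof. by apply: (pr_app2 (f := approx_code)); rewrite /approx_code; pr_solve. Qed.

Lemma pr_mind_change A B C : pr A -> pr B -> pr C -> pr (fun r => mind_change (A r) (B r) (C r)).
Proof. by apply: (pr_app3 (f := fun a b c => mind_change a b c)); rewrite /mind_change; pr_solve. Qed.

Lemma pr_last_change A B : pr A -> pr B -> pr (fun r => last_change (A r) (B r)).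
Proof.
apply: (pr_app2 (f := last_change)); rewrite /last_change.
apply: (pr_max (g := fun j r =>
  if mind_change j (nthc (r 1) (r 0 - j)) (nthc (r 1) (r 0 - j.-1)) then j else 0)); first by pr_solve.
by apply pr_if; [apply: pr_mind_change|..]; pr_solve.
Qed.

Lemma pr_jump_approx A B : pr A -> pr B -> pr (fun r => jump_approx (A r) (B r)).
Proof.
apply: (pr_app2 (f := jump_approx)); rewrite /jump_approx.
have hl : pr (fun r => last_change (r 0) (r 1)) by apply: pr_last_change; pr_solve.
apply: (pr_halted (L := fun r => partial_output (r 0) (r 1))); [by pr_solve| |by pr_solve].
rewrite /partial_output; apply: (pr_mkseq (g := fun j r =>
   approx_code (last_change (r 0) (r 1) + j) (nthc (r 1) (r 0 - (last_change (r 0) (r 1) + j))))); first by pr_solve.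
have hl' : pr (fun r => last_change (r 1) (r 2)) by apply: pr_last_change; pr_solve.
by apply: pr_approx_code; pr_solve.
Qed.

Definition output (p : baire) (T : nat) : baire := fun j => approx_code (T + j) (odds p (T + j)).

Definition last_change_at (p : baire) (T : nat) : Prop :=
  (T = 0 \/ mind_change T (odds p T) (odds p T.-1)) /\
  forall i, T < i -> ~~ mind_change i (odds p i) (odds p i.-1).

Lemma mind_change_machine : exists M, forall p T, last_change_at p T ->
  outputs M p (output p T) /\ finitely_many_revisions M p.
Proof.
have [||M hM] := @stream_mind_change (fun i a => approx_code i (nthc a 0))
   (fun i a => mind_change i (nthc a 0) (nthc a 1)).
- by apply: pr_approx_code; pr_solve.
- by apply: pr_mind_change; pr_solve.
have nh p i : mind_change i (nthc (hist (odds p) i.+1) 0) (nthc (hist (odds p) i.+1) 1) =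
    mind_change i (odds p i) (odds p i.-1).
  by case: i => [//|i]; rewrite !nth_hist // subn0 subn1.
exists M => p T [h1 h2]; have [||g1 g2] := hM p T.
- by case: h1 => [->|h1]; [left|right; rewrite nh h1].
- by move=> i /h2; rewrite nh => /negbTE ->.
split=> //; suff -> : output p T =
  (fun j => approx_code (T + j) (nthc (hist (odds p) (T + j).+1) 0)) by [].
by apply/funext => j; rewrite nth_hist // subn0.
Qed.

Lemma last_changeE p T i : last_change_at p T -> T <= i ->
  last_change i (hist (odds p) i.+1) = T.
Proof.
move=> [h1 h2] Ti.
have E (j : 'I_i.+1) : (if mind_change j (nthc (hist (odds p) i.+1) (i - j))
     (nthc (hist (odds p) i.+1) (i - j.-1)) then j : nat else 0) =
   if mind_change j (odds p j) (odds p j.-1) then j : nat else 0.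
  have hj := ltn_ord j; rewrite !nth_hist /=; try lia.
  by rewrite !subKn //; lia.
rewrite /last_change (eq_bigr _ (fun j _ => E j)); apply/eqP; rewrite eqn_leq; apply/andP; split.
  apply/bigmax_leqP => j _; case: ifP => // hj; rewrite leqNgt; apply/negP => /h2.
  by rewrite hj.
case: h1 => [->//|h1]; have hT : T < i.+1 by [].
by apply: (bigop.bigmax_sup (Ordinal hT)) => //=; rewrite h1.
Qed.

Lemma low_machine : exists M, one_way M /\ forall p T, last_change_at p T ->
  exists g, outputs M p g /\ baire_lim g (jump (output p T)).
Proof.
have [|M [h1 h2]] := @stream_one_way jump_approx; first by apply: pr_jump_approx; pr_solve.
exists M; split=> // p T hT; eexists; split; first exact: h2.
move=> k; have [t0 ht0] := jump_halted k (output p T).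
(* As [cpair n k] is at least n, there are at least t0 steps available after T, and the halting
   value is final. *)
exists (T + t0) => n hn; set i := cpair n k.
have [ni _] := cpair_bound n k; rewrite -/i in ni.
have Ti : T <= i by lia.
rewrite (ht0 (i - T)); last by lia.
rewrite /jump_approx (last_changeE hT Ti) /i cpairK -/i /=; congr nat_of_bool.
apply: halted_eq => j hj; rewrite /partial_output (last_changeE hT Ti) CodeSeq.codeK.
rewrite nth_mkseq; last by lia.
by rewrite nth_hist /=; [rewrite /output subKn //; lia|lia].
Qed.

(** * Convergence after the last mind change *)

Section Real.
Local Open Scope classical_set_scope.
Local Open Scope ring_scope.
Variable R : realType.

(** Denominators are cleared; one of the two truncated differences is 0, so their sum is the
    absolute value. *)
Lemma mind_changeP j c c' : (0 < j)%N ->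
  mind_change j c c' = (2 ^- j <= `|alpha (approx_code j c) - alpha (approx_code j.-1 c')|).
Proof.
move=> j0; rewrite /mind_change j0 /=.
have V i d : alpha (approx_code i d) = (approx_num i d)%:R / (approx_den i d)%:R.
  rewrite /alpha /approx_code cpairK /= cpairK /= subr0 prednK //; exact: approx_den_gt0.
have P i d : 0 < (approx_den i d)%:R :> rat by rewrite ltr0n approx_den_gt0.
rewrite !V; have := P j c; have := P j.-1 c'.
move: (approx_num j c) (approx_den j c) (approx_num j.-1 c') (approx_den j.-1 c') => a b a' b' hb' hb.
have -> : a%:R / b%:R - a'%:R / b'%:R = (a * b')%:R / (b * b')%:R - (a' * b)%:R / (b * b')%:R :> rat.
  by rewrite !natrM; field; rewrite !gt_eqF.
have bb : 0 < (b * b')%:R :> rat by rewrite natrM mulr_gt0.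
rewrite -mulrBl normrM normfV (ger0_norm (ltW bb)) ler_pdivlMr // mulrC ler_pdivrMr ?exprn_gt0 //.
move: (a * b')%N (a' * b)%N (b * b')%N {bb} => x y z.
rewrite -(ler_nat rat) !natrM natrX mulrC; congr (_ <= _ * _).
rewrite natrD; case: (leqP x y) => h.
  by rewrite (eqP h) add0r distrC ger0_norm ?subr_ge0 ?ler_nat // natrB.
by rewrite (eqP (ltnW h)) addr0 ger0_norm ?subr_ge0 ?ler_nat ?(ltnW h) // natrB // ltnW.
Qed.

Lemma delta_dist p (x : R) k : delta p x -> `|ratr (alpha (p k)) - x| <= 2 ^- k.
Proof.
move=> [hp hx].
have h : (fun n => `|ratr (alpha (p k)) - ratr (alpha (p n)) : R|) @ \oo --> `|ratr (alpha (p k)) - x|.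
  by apply: cvg_norm; apply: cvgB => //; exact: cvg_cst.
apply: (cvgr_to_le h); near=> n; have kn : (k <= n)%N by near: n; exists k.
rewrite distrC -rmorphB /= -ratr_norm; have := hp k n kn.
by rewrite -(ltr_rat R) => /ltW; rewrite fmorphV rmorphXn /= ratr_nat.
Unshelve. all: by end_near. Qed.

(** The steps from k to k + d add up to at most 2^-k - 2^-(k+d), which leaves room for the strict
    inequality. *)
Lemma cauchy_of_steps (p : baire) :
  (forall j, `|alpha (p j.+1) - alpha (p j)| < 2 ^- j.+1) -> cauchy_name p.
Proof.
move=> h k n /subnK <-; move: (n - k)%N => d; rewrite addnC.
suff : `|alpha (p (k + d)%N) - alpha (p k)| <= 2 ^- k - 2 ^- (k + d).
  move/le_lt_trans; apply; rewrite ltrBlDr ltrDl invr_gt0 exprn_gt0 //.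
elim: d => [|d IH]; first by rewrite addn0 !subrr normr0.
apply: le_trans (ler_distD (alpha (p (k + d)%N)) _ _) _.
rewrite addnS; apply: le_trans (lerD (ltW (h _)) IH) _.
have : 2 ^- (k + d) = 2 * 2 ^- (k + d).+1 :> rat.
  by rewrite exprS invfM mulrA divff ?mul1r.
by lra.
Qed.

Variable l : nat -> nat.
Hypothesis l_lim : forall n, (exists S, forall s, (S <= s)%N -> scale n s = l n) \/
  (l n = 0%N /\ forall B, exists S, forall s, (S <= s)%N -> (B <= scale n s)%N).

(** Consecutive approximations differ by at most C/4^i + C/4^(i+1), which is below 2^-(i+1) once 4 C
    < 2^i. *)
Lemma exists_last_change p (x : R) : delta p x -> exists T, last_change_at p T.
Proof.
move=> hp; have [C [T0 hT0]] := approx_code_rate l_lim (fun k => delta_dist k hp).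
have [T1 hT1] := pow4_large (4 * C).
have ex : exists T, `[< forall i, (T < i)%N -> ~~ mind_change i (odds p i) (odds p i.-1) >].
  exists (maxn T0 (2 * T1).+1); apply/asboolP => -[//|i]; rewrite ltnS geq_max => /andP[h0 h1].
  rewrite mind_changeP //= -ltNge -(ltr_rat R) ratr_norm rmorphB /= fmorphV rmorphXn /= ratr_nat.
  apply: le_lt_trans (ler_distD (bumps l x) _ _) _.
  apply: le_lt_trans (lerD (hT0 _ (leqW h0)) _) _; first by rewrite distrC; exact: hT0.
  have p4 : 0 < 4 ^+ i :> R by rewrite exprn_gt0.
  have p2 : 0 < 2 ^+ i :> R by rewrite exprn_gt0.
  have e4 : 4 ^+ i = 2 ^+ i * 2 ^+ i :> R by rewrite -exprMn; congr (_ ^+ _); lra.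
  have C4 : 4 * C < 2 ^+ i.
    apply: le_lt_trans (hT1 _ (leqnn _)) _.
    have -> : 4 = 2 ^+ 2 :> R by rewrite expr2; lra.
    by rewrite -exprM ltr_eXn2l // ltr1n.
  have C0 : 0 <= C.
    by have := le_trans (normr_ge0 _) (hT0 _ h0); rewrite pmulr_lge0 // invr_gt0.
  rewrite !exprS !invfM e4 invfM; set d := (2 ^+ i)^-1.
  have d0 : 0 < d by rewrite invr_gt0.
  have h := C4; rewrite -(ltr_pM2l d0) mulVf ?gt_eqF // in h.
  have h2 := h; rewrite -(ltr_pM2l d0) mulr1 in h2.
  have h3 : 0 <= C * (d * d) by rewrite !mulr_ge0 // ltW.
  have h4 : d * (d * (4 * C)) = 4 * (C * (d * d)) by ring.
  rewrite h4 in h2; have -> : C * (4^-1 * (d * d)) = (C * (d * d)) / 4 by field.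
  lra.
(* By minimality of T, either T = 0 or there is a change at T itself. *)
case: (ex_minnP ex) => T /asboolP hT minT; exists T; split=> //.
case: T hT minT => [|T] hT minT; first by left.
right; apply: contrapT => /negP nj; suff : (T.+1 <= T)%N by rewrite ltnn.
apply: minT; apply/asboolP => i; rewrite leq_eqVlt => /orP[/eqP <-|/hT] //.
Qed.

(** Step j of the final output passed the test with threshold 2^-(T + j.+1), at most the 2^-(j.+1)
    allowed to a name. The limit comes from the rate. *)
Lemma delta_output p (x : R) T : delta p x -> last_change_at p T -> delta (output p T) (bumps l x).
Proof.
move=> hp [_ hT]; split.
  apply: cauchy_of_steps => j; have := hT (T + j).+1; rewrite mind_changeP // -ltNge /output !addnS.
  move=> /(_ _)/lt_le_trans; apply; first by rewrite ltnS leq_addr.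
  by rewrite lef_pV2 ?posrE ?exprn_gt0 // ler_eXn2l // ?ltr1n // ltnS leq_addl.
have [C [T0 hT0]] := approx_code_rate l_lim (fun k => delta_dist k hp).
apply/cvgrPdist_le => e e0; have [T1 hT1] := pow4_large (C / e).
exists (maxn T0 T1) => // j; rewrite /= geq_max => /andP[h0 h1].
rewrite distrC; apply: le_trans (hT0 _ (leq_trans h0 (leq_addl _ _))) _.
rewrite ler_pdivrMr ?exprn_gt0 // mulrC -ler_pdivrMr //.
exact: hT1 (leq_trans h1 (leq_addl _ _)).
Qed.

End Real.

Lemma scale_limit : exists l : nat -> nat, forall n,
  (exists S, forall s, (S <= s) -> scale n s = l n) \/
  (l n = 0 /\ forall B, exists S, forall s, (S <= s) -> (B <= scale n s)).
Proof.
have nx n : exists k, (exists S, forall s, (S <= s) -> scale n s = k) \/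
    (k = 0 /\ forall B, exists S, forall s, (S <= s) -> (B <= scale n s)).
  have [[k hk]|h] := mono_stable_or_unbounded (scale_mono n); first by exists k; left.
  by exists 0; right.
by have [l hl] := choice nx; exists l.
Qed.

Lemma baire_lim_unique g l l' : baire_lim g l -> baire_lim g l' -> l = l'.
Proof.
move=> h h'; apply/funext => k; have [N hN] := h k; have [N' hN'] := h' k.
by rewrite -(hN (maxn N N')) ?leq_maxl // hN' // leq_maxr.
Qed.

(** * Realizers and the diagonal argument *)

Section Main.
Local Open Scope classical_set_scope.
Local Open Scope ring_scope.
Variable R : realType.
Variable l : nat -> nat.
Hypothesis l_lim : forall n, (exists S, forall s, (S <= s)%N -> scale n s = l n) \/
  (l n = 0%N /\ forall B, exists S, forall s, (S <= s)%N -> (B <= scale n s)%N).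

(** One realizer serves both mind changes and lowness. The stage T is picked by choice; the machines
    find it only in the limit. *)
Lemma realizer_of_last_change : exists T : baire -> nat,
  let F p := if `[< exists x : R, delta p x >] then Some (output p (T p)) else None in
  realizes F (bumps l : R -> R) /\ forall p r, F p = Some r -> last_change_at p (T p) /\ r = output p (T p).
Proof.
have nx p : exists T, (exists x : R, delta p x) -> last_change_at p T.
  case: (pselect (exists x : R, delta p x)) => [[x hx]|h]; last by exists 0%N.
  by have [T hT] := exists_last_change l_lim hx; exists T.
have [T hT] := choice nx; exists T; split=> [p x hx|p r].
  have ex : exists x : R, delta p x by exists x.
  exists (output p (T p)); split; first by case: asboolP.
  by apply: (delta_output l_lim hx); exact: hT.
by case: asboolP => // /hT h [<-].
Qed.

Lemma bumps_mind_change : has_realizer mind_change_computable (bumps l : R -> R).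
Proof.
have [T [h1 h2]] := realizer_of_last_change; eexists; split; first exact: h1.
have [M hM] := mind_change_machine; exists M => p r /h2[hT ->]; exact: hM.
Qed.

Lemma bumps_low : has_realizer low (bumps l : R -> R).
Proof.
have [T [h1 h2]] := realizer_of_last_change; eexists; split; first exact: h1.
set F := fun p => _ in h1 h2 *.
have [M [oM hM]] := low_machine.
have nx p : exists g, last_change_at p (T p) -> outputs M p g /\ baire_lim g (jump (output p (T p))).
  case: (pselect (last_change_at p (T p))) => [/hM[g hg]|]; first by exists g.
  by exists p.
have [g hg] := choice nx.
(* Cut down to the domain of F, since lowness asks for equality of graphs. *)
exists (fun p => if F p is Some r then Some (g p) else None); split.
  exists M; split=> // p r; case E: (F p) => [r'|//] [<-].
  by have [/hg[]] := h2 _ _ E.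
move=> p r; split=> [E|[g' []]].
  by have [/hg[_ h] ->] := h2 _ _ E; exists (g p); rewrite E.
(* The converse inclusion: by uniqueness of limits and injectivity of the jump, the limit determines
   r. *)
case E: (F p) => [r'|//] [<-] hl; have [/hg[_ h] e] := h2 _ _ E.
by rewrite e -(jump_inj (baire_lim_unique h hl)).
Qed.

Lemma delta_const (c : nat) : delta (fun=> c) (ratr (alpha c) : R).
Proof.
split; last exact: cvg_cst.
by move=> k n _; rewrite subrr normr0 invr_gt0 exprn_gt0.
Qed.

Lemma alpha_cpair (a w : nat) : ratr (alpha (cpair a (cpair 0 w))) = a%:R / w.+1%:R :> R.
Proof. by rewrite alphaE /rden !cpairK subr0. Qed.

(** exp(-4) is the 16th power of exp(-1/4) >= 3/4. Repeated squaring with rounding down gives 9/16,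
    5/16, 3/32 and 9/1024, and 256 times the last is 9/4. *)
Lemma psi_quarter : 2 < 256 * psi 0 4^-1 :> R.
Proof.
rewrite /psi invr_gt0 ltr0n expr0 mul1r invrK.
have -> : - 4 = 16%:R * - 4^-1 :> R by field.
rewrite expRM_natl; have h : 3 / 4 <= expR (- 4^-1) :> R.
  by apply: le_trans (expR_ge1Dx _); lra.
have sq (x y : R) : 0 <= y -> y <= x -> y * y <= x * x by move=> *; apply: ler_pM.
move: (expR _) h => a h.
have -> : a ^+ 16 = ((a * a) * (a * a)) * ((a * a) * (a * a)) *
   (((a * a) * (a * a)) * ((a * a) * (a * a))) by ring.
have h2 : 9 / 16 <= a * a by apply: le_trans (sq _ _ _ h); lra.
have h4 : 5 / 16 <= (a * a) * (a * a) by apply: le_trans (sq _ _ _ h2); lra.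
have h8 := sq _ _ _ h4; have {}h8 : 3 / 32 <= ((a * a) * (a * a)) * ((a * a) * (a * a)).
  by apply: le_trans (h8 _); lra.
have h16 := sq _ _ _ h8; have {}h16 := h16 ltac:(lra).
by apply: (@lt_le_trans _ _ (256 * (3 / 32 * (3 / 32)))); [lra|rewrite ler_pM2l ?ltr0n].
Qed.

Lemma bumps_nat n : bumps l n%:R = 0 :> R.
Proof.
have tn : Num.truncn (n%:R : R) = n by exact: natrK.
by rewrite /bumps max_r // phi_eq0l ?psi_le0 ?mulr0 // tn subrr mulr0 ler01.
Qed.

(** Here K z = 3/2, and both factors are 1/2. *)
Lemma bumps_peak n k : (4 <= k)%N -> l n = k ->
  bumps l (n%:R + 3 / (2 * k%:R)) = 256 * psi 0 4^-1 :> R.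
Proof.
move=> k4 lk; set z := 3 / _; have k0 : 4 <= k%:R :> R by rewrite ler_nat.
have hz : k%:R * z = 3 / 2 by rewrite /z; field; rewrite gt_eqF //; lra.
have z0 : 0 <= z by rewrite divr_ge0 //; lra.
have z1 : z < 1 by rewrite ltr_pdivrMr; lra.
have n0 : 0 <= n%:R :> R by [].
have tn : Num.truncn (n%:R + z) = n by apply: truncn_def; rewrite -natr1; lra.
rewrite /bumps max_r ?addr_ge0 // psi_phi tn lk addrAC subrr add0r hz.
by congr (_ * psi 0 _); field.
Qed.

Lemma bumps_not_relative : ~ has_realizer (computable_relative halting_problem) (bumps l : R -> R).
Proof.
move=> [F [hF [G [[M [oM hM]] hG]]]].
have [n tn] := tm_surj M.
have d0 : delta (const_name n) (n%:R : R).
  have := delta_const (cpair n 0); rewrite -[cpair n 0]/(cpair n (cpair 0 0)) alpha_cpair divr1.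
  by [].
have [r [Fr dr]] := hF _ _ d0; have hr := hM _ _ (hG _ _ Fr).
(* The correct output at n has a 2 in cell [r 0], and this cell is eventually filled. *)
have [t ht] : exists t, hit n t (join halting_problem (const_name n)).
  have [T0 h0] := hr (r 0%N); exists (maxn T0 (r 0%N)); apply/existsP.
  have lt : (r 0%N < (maxn T0 (r 0%N)).+1)%N by rewrite ltnS leq_maxr.
  exists (Ordinal lt); rewrite tn h0 ?leq_maxl //=.
  by have := tape_of_pos2 r 0; rewrite /pos big_ord0 => ->.
have [T [k [S [/existsP[c /eqP hc] kT hk]]]] := scale_hit ht.
rewrite tn in hc.
have lk : l n = k.
  case: (l_lim n) => [[S' hS']|[_ /(_ k.+1)[S' hS']]].
    by rewrite -(hS' (maxn S S')) ?leq_maxr // hk // leq_maxl.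
  by have := hS' _ (leq_maxr S S'); rewrite hk ?leq_maxl // ltnn.
have k4 : (4 <= k)%N.
  by apply: leq_trans kT; rewrite addn2 !expnS mulnA leq_pmulr // expn_gt0.
pose x : R := n%:R + 3 / (2 * k%:R).
pose cx := cpair (2 * k * n + 3) (cpair 0 (2 * k).-1).
have k0 : 0 < k%:R :> R by rewrite ltr0n; apply: leq_trans k4.
have ax : ratr (alpha cx) = x.
  rewrite alpha_cpair prednK; last by rewrite muln_gt0; apply: leq_trans k4.
  by rewrite natrD !natrM /x; field; rewrite gt_eqF.
(* A name of the peak that looks like the constant name of n as long as the machine has not
   committed itself. *)
pose p' : baire := fun i => if (i < T)%N then cpair n 0 else cx.
have d1 : delta p' x.
  have close j : (j < T)%N -> `|alpha cx - alpha (cpair n 0)| < 2 ^- j.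
    move=> jT; rewrite -(ltr_rat R) ratr_norm rmorphB /= ax fmorphV rmorphXn /= ratr_nat.
    rewrite -[cpair n 0]/(cpair n (cpair 0 0)) alpha_cpair divr1 /x addrAC subrr add0r.
    have p2 : 0 < 2 ^+ j :> R by rewrite exprn_gt0.
    rewrite ger0_norm; last by rewrite divr_ge0 // mulr_ge0 // ltW.
    rewrite ltr_pdivrMr ?mulr_gt0 // -(ltr_pM2l p2) mulrA divff ?mul1r ?gt_eqF //.
    (* From k >= 2^(T + 2) and j < T; hence 3/(2 k) < 2^-j. *)
    have h : 4 * 2 ^+ j <= k%:R :> R.
      rewrite -natrX -natrM ler_nat; apply: leq_trans kT; rewrite addn2 !expnS mulnA.
      by rewrite leq_mul2l leq_exp2l // ltnW.
    have j1 : 1 <= 2 ^+ j :> R by rewrite exprn_ege1 // ler1n.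
    nra.
  split.
    move=> i j ij; rewrite /p'; case: (ltnP j T) => jT.
      by rewrite (leq_ltn_trans ij jT) subrr normr0 invr_gt0 exprn_gt0.
    case: (ltnP i T) => iT; first exact: close.
    by rewrite subrr normr0 invr_gt0 exprn_gt0.
  rewrite -ax; apply: cvg_near_cst; exists T => // i /= iT.
  by rewrite /p' ltnNge iT.
have [r' [Fr' dr']] := hF _ _ d1; have hr' := hM _ _ (hG _ _ Fr').
have e : r 0%N = r' 0%N.
  apply: (one_way_first oM hr hr' _ hc) => i iT; rewrite /join; case: odd => //.
  rewrite /p' ifT //; lia.
(* The common first entry a satisfies |a| <= 1 and |a - b| <= 1 with b > 2. *)
have := delta_dist 0 dr; have := delta_dist 0 dr'.
rewrite -e bumps_nat /x bumps_peak // expr0 invr1 subr0.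
have := psi_quarter; move: (256 * _) (ratr _) => b a hb.
rewrite ler_distl ler_norml => /andP[h1 h2] /andP[h3 h4]; clear -hb h1 h4; lra.
Qed.

End Main.

Theorem proposition6p10 (R : realType) :
  exists f : R -> R,
    smooth f /\
    has_realizer mind_change_computable f /\
    has_realizer low f /\
    has_realizer limit_computable f /\
    ~ has_realizer (computable_relative halting_problem) f.
Proof.
have [l l_lim] := scale_limit; exists (bumps l).
have mc := bumps_mind_change R l_lim.
split; last split; last split; last split => //.
- apply: smooth_bumps => n; case: (l_lim n) => [[S hS]|[->]]; last by left.
  by right; rewrite -(hS S) // scale_ge4.
- exact: mc.
- exact: (bumps_low R l_lim).
- have [F [hF [M hM]]] := mc; exists F; split=> //; exists M => p r /hM[].
  by [].
- exact: (bumps_not_relative l_lim).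
Qed.
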